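(* Let $1<\alpha<2$ and consider the uncertain singular fractional order system $$ED^{\alpha}x(t)=(A_0+D_AF_AE_A)x(t),$$ where $E,A_0\in\mathbb{R}^{n\times n}$, $D_A\in\mathbb{R}^{n\times p}$, $E_A\in\mathbb{R}^{q\times n}$ are given and the uncertain matrix $F_A\in\mathbb{R}^{p\times q}$ satisfies $F_AF_A^T<I_p$. Let $$\Theta=\begin{bmatrix}\sin\frac{\pi}{2}\alpha & -\cos\frac{\pi}{2}\alpha\\ \cos\frac{\pi}{2}\alpha & \sin\frac{\pi}{2}\alpha\end{bmatrix}.$$ The system is robust admissible if there exists a matrix $X\in\mathbb{R}^{n\times n}$ such that $$\begin{bmatrix}\mathrm{Sym}\left\{\Theta\otimes(A_0^TX)\right\}+I_2\otimes(E_A^TE_A) & I_2\otimes(X^TD_A)\\ I_2\otimes(D_A^TX) & -I_2\otimes I_p\end{bmatrix}<0,\qquad E^TX=X^TE\ge0 .$$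
   Context: $\mathrm{Sym}(M)=M+M^{*}$ with $M^*$ the conjugate transpose; $\otimes$ is the Kronecker product; $<0$ means negative definite and $\ge0$ positive semidefinite. $D^{\alpha}$ is the Caputo fractional derivative of order $\alpha$ with lower terminal $0$. Robust admissible means: for every $F_A\in\mathbb{R}^{p\times q}$ with $F_AF_A^T<I_p$, the system $ED^\alpha x=Ax$ with $A=A_0+D_AF_AE_A$ is admissible, i.e. regular, impulse-free and asymptotically stable. Regular: the system has a unique solution (a solution of $ED^\alpha x=Ax+g$ exists for every sufficiently differentiable $g$ and is determined by $g$ and the initial data); then there exist nonsingular $M_0,P_0$ with $M_0EP_0=\mathrm{diag}(I_{n_1},N)$, $M_0AP_0=\mathrm{diag}(A_1,I_{n_2})$, $N$ nilpotent of index $h$, $n_1+n_2=n$. Impulse-free: for $\beta\in\mathbb{R}$ let $\delta^{(-\beta)}(t)=t^{\beta-1}/\Gamma(\beta)$ for $t>0$ and $0$ for $t<0$ (Laplace transform $s^{-\beta}$). With $P_0^{-1}x=[x_1^T\ x_2^T]^T$, the system splits into $D^\alpha x_1=A_1x_1$ and $ND^\alpha x_2=x_2$, and the latter has state response $x_2(t)=-\sum_{k=1}^{h-1}N^k\left(\delta^{(k\alpha-1)}(t)x_2(0)+\delta^{(k\alpha-2)}(t)\dot x_2(0)\right)$. The system is impulse-free if, for arbitrary initial conditions, its state response does not include impulsive response, i.e. the terms involving the functions $\delta^{(\cdot)}$ do not occur. Asymptotically stable: $\lim_{t\to+\infty}\|x(t)\|=0$ for every admissible initial condition $x(0)$, i.e.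 every $x(0)$ that does not result in discontinuous behaviour at $t=0$. *)

(* Defs.v *)
From HB Require Import structures.
From mathcomp Require Import all_boot all_order all_algebra.
From mathcomp Require Import mxtens.
From mathcomp Require Import all_classical all_reals all_analysis.

Set Implicit Arguments.
Unset Strict Implicit.
Unset Printing Implicit Defensive.

Import Order.TTheory GRing.Theory Num.Theory.
Import numFieldNormedType.Exports.

Local Open Scope classical_set_scope.
Local Open Scope ring_scope.

(* All matrices are real, so the conjugate transpose is [^T]; definiteness
   includes symmetry. *)
Definition Sym (R : realType) (m : nat) (M : 'M[R]_m) : 'M[R]_m := M + M^T.

Definition negdefmx (R : realType) (m : nat) (M : 'M[R]_m) : Prop :=
  M^T = M /\ forall v : 'cV[R]_m, v != 0 -> (v^T *m M *m v) 0 0 < 0.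

Definition possemidefmx (R : realType) (m : nat) (M : 'M[R]_m) : Prop :=
  M^T = M /\ forall v : 'cV[R]_m, 0 <= (v^T *m M *m v) 0 0.

Definition Theta (R : realType) (alpha : R) : 'M[R]_2 :=
  let s := sin (pi / 2 * alpha) in
  let c := cos (pi / 2 * alpha) in
  \matrix_(i < 2, j < 2) nth 0 (nth [::] [:: [:: s; - c]; [:: c; s]] i) j.

Definition Gamma (R : realType) (z : R) : R :=
  \int[@lebesgue_measure R]_(t in `]0, +oo[) (t `^ (z - 1) * expR (- t)).

(* The entire function [1 / Gamma], from [Gamma (z + 1) = z * Gamma z]; the
   shift [m] makes [z + m] positive. *)
Definition rGamma (R : realType) (z : R) : R :=
  let m := Num.truncn (1 + `|z|) in
  (\prod_(k < m) (z + k%:R)) / Gamma (z + m%:R).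

(* The natural domain of the derivative of order [alpha] in ]1, 2[: [f] is C^1
   on [0, +oo[ and C^2 on ]0, +oo[, with [f''] integrable near 0.  Asking for
   C^2 up to 0 would exclude the solutions of D^alpha f = lambda f, whose second
   derivative is of order t^(alpha - 2) at 0. *)
Definition caputo_dom (R : realType) (f : R -> R) : Prop :=
  [/\ {within `[0, +oo[, continuous f},
      exists v : R, f^`()%classic t @[t --> 0^'+] --> v,
      forall t, 0 < t ->
        [/\ derivable f t 1, derivable f^`()%classic t 1 & {for t, continuous f^`(2)%classic}] &
      forall t, 0 < t ->
        (@lebesgue_measure R).-integrable `]0, t[ (EFin \o f^`(2)%classic)].

Definition caputo (R : realType) (alpha : R) (f : R -> R) (t : R) : R :=
  (Gamma (2 - alpha))^-1 *
  \int[@lebesgue_measure R]_(s in `]0, t[) ((t - s) `^ (1 - alpha) * f^`(2)%classic s).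

Definition component (R : realType) (n : nat) (x : R -> 'cV[R]_n) (i : 'I_n) : R -> R :=
  fun t => x t i 0.

Definition caputo_vec (R : realType) (n : nat) (alpha : R) (x : R -> 'cV[R]_n)
    (t : R) : 'cV[R]_n :=
  \col_i caputo alpha (component x i) t.

(* [x] solves E D^alpha x = A x + g on ]0, +oo[.  The time t = 0 is left out
   because [caputo alpha f 0] is an integral over the empty set, whereas
   D^alpha f (t) need not tend to 0 as t tends to 0.  Values of [x] and [g] at
   negative times play no role. *)
Definition solution (R : realType) (n : nat) (alpha : R) (E A : 'M[R]_n)
    (g x : R -> 'cV[R]_n) : Prop :=
  (forall i, caputo_dom (component x i)) /\
  (forall t, 0 < t -> E *m caputo_vec alpha x t = A *m x t + g t).

(* x(0) = x0 and x'(0) = v0, the latter as the limit of x' at 0 from the right. *)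
Definition initial_data (R : realType) (n : nat) (x : R -> 'cV[R]_n)
    (x0 v0 : 'cV[R]_n) : Prop :=
  x 0 = x0 /\ forall i, (component x i)^`()%classic t @[t --> 0^'+] --> v0 i 0.

Definition Cdiff (R : realType) (K : nat) (f : R -> R) : Prop :=
  (forall k, (k < K)%N -> forall t, derivable f^`(k)%classic t 1) /\
  continuous f^`(K)%classic.

(* The forcing terms are taken C^K on the whole line: this is no restriction,
   a function that is C^K on [0, +oo[ extends to such a function. *)
Definition regular (R : realType) (n : nat) (alpha : R) (E A : 'M[R]_n) : Prop :=
  (exists K : nat, forall g : R -> 'cV[R]_n, (forall i, Cdiff K (component g i)) ->
     exists x, solution alpha E A g x) /\
  (forall (g x y : R -> 'cV[R]_n) (x0 v0 : 'cV[R]_n),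
     solution alpha E A g x -> solution alpha E A g y ->
     initial_data x x0 v0 -> initial_data y x0 v0 ->
     forall t, 0 <= t -> x t = y t).

Definition nilpotent_of_index (R : realType) (m : nat) (N : 'M[R]_m) (h : nat) : Prop :=
  N ^+ h = 0 /\ forall k, (k < h)%N -> N ^+ k <> 0.

Definition decomposition (R : realType) (n : nat) (E A M0 P0 : 'M[R]_n)
    (n1 n2 : nat) (en : (n1 + n2)%N = n)
    (A1 : 'M[R]_n1) (N : 'M[R]_n2) (h : nat) : Prop :=
  [/\ M0 \in unitmx, P0 \in unitmx,
      M0 *m E *m P0 = castmx (en, en) (block_mx 1%:M 0 0 N),
      M0 *m A *m P0 = castmx (en, en) (block_mx A1 0 0 1%:M) &
      nilpotent_of_index N h].

(* [delta sigma] is the function written delta^(sigma), sigma = - beta. *)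
Definition delta (R : realType) (sigma t : R) : R :=
  if 0 < t then t `^ (- sigma - 1) * rGamma (- sigma) else 0.

(* The terms of the state response of N D^alpha x2 = x2 with x2(0) = x0 and
   x2'(0) = v0: a pair (sigma, v) stands for delta^(sigma) v. *)
Definition response_terms (R : realType) (m : nat) (alpha : R) (N : 'M[R]_m)
    (h : nat) (x0 v0 : 'cV[R]_m) : seq (R * 'cV[R]_m) :=
  flatten [seq [:: (k%:R * alpha - 1, - (N ^+ k *m x0));
                   (k%:R * alpha - 2, - (N ^+ k *m v0))] | k <- index_iota 1 h].

Definition state_response (R : realType) (m : nat) (alpha : R) (N : 'M[R]_m)
    (h : nat) (x0 v0 : 'cV[R]_m) (t : R) : 'cV[R]_m :=
  \sum_(u <- response_terms alpha N h x0 v0) delta u.1 t *: u.2.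

Lemma state_responseE (R : realType) (m : nat) (alpha : R) (N : 'M[R]_m)
    (h : nat) (x0 v0 : 'cV[R]_m) (t : R) :
  state_response alpha N h x0 v0 t =
  - \sum_(1 <= k < h)
      N ^+ k *m (delta (k%:R * alpha - 1) t *: x0 + delta (k%:R * alpha - 2) t *: v0).
Proof.
rewrite /state_response big_flatten big_map -sumrN; apply: eq_bigr => k _.
rewrite !big_cons big_nil /= addr0.
by rewrite mulmxDr -!scalemxAr !scalerN [RHS]opprD.
Qed.

(* A term delta^(sigma) v occurs in the response when v <> 0; the orders sigma
   of distinct terms are distinct for alpha > 1.  Occurrence is read off the
   coefficients because delta^(sigma) is a derivative of the Dirac mass at 0,
   not visible at t <> 0, when sigma is a natural number. *)
Definition impulse_free (R : realType) (n : nat) (alpha : R) (E A : 'M[R]_n) : Prop :=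
  exists (M0 P0 : 'M[R]_n) (n1 n2 : nat) (en : (n1 + n2)%N = n)
         (A1 : 'M[R]_n1) (N : 'M[R]_n2) (h : nat),
    decomposition E A M0 P0 en A1 N h /\
    forall (x0 v0 : 'cV[R]_n2) (u : R * 'cV[R]_n2),
      u \in response_terms alpha N h x0 v0 -> u.2 = 0.

(* Solutions are continuous at 0, so their values x(0) are exactly the initial
   conditions that do not result in discontinuous behaviour at 0. *)
Definition asymptotically_stable (R : realType) (n : nat) (alpha : R)
    (E A : 'M[R]_n) : Prop :=
  forall x : R -> 'cV[R]_n,
    solution alpha E A (fun _ => 0) x -> `|x t| @[t --> +oo] --> (0 : R).

Definition admissible (R : realType) (n : nat) (alpha : R) (E A : 'M[R]_n) : Prop :=
  [/\ regular alpha E A, impulse_free alpha E A & asymptotically_stable alpha E A].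

Definition robust_admissible (R : realType) (n p q : nat) (alpha : R)
    (E A0 : 'M[R]_n) (DA : 'M[R]_(n, p)) (EA : 'M[R]_(q, n)) : Prop :=
  forall FA : 'M[R]_(p, q), negdefmx (FA *m FA^T - 1%:M) ->
    admissible alpha E (A0 + DA *m FA *m EA).

(* Main.v *)
Require Import Defs.
From mathcomp Require Import all_boot all_order all_algebra.
From mathcomp Require Import mxtens.
From mathcomp Require Import all_classical all_reals all_analysis.
From mathcomp Require Import measurable_realfun ring lra.
Import Order.TTheory GRing.Theory Num.Theory.
Import numFieldNormedType.Exports.

Local Open Scope classical_set_scope.
Local Open Scope ring_scope.

Set Implicit Arguments.
Unset Strict Implicit.
Unset Printing Implicit Defensive.

(* Write alpha = 1 + b and k(t) = t^(-b).  The LMI, together with the fact that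
   F_A is a contraction, gives for G = A^T X
     sin(pi alpha/2) (a'Ga + b'Gb) - cos(pi alpha/2) (a'Gb - b'Ga) < 0
   for all (a, b) <> (0, 0).  In the rank normal form of E, the condition
   E^T X = X^T E >= 0 makes X block triangular; the inequality then makes the
   algebraic block of A invertible, so that N = 0, and x1 obeys
   D^alpha x1 = A1 x1 with a symmetric P > 0 such that A1^T P satisfies the same
   sector inequality.
   For D^alpha x = A1 x put r = k * (x'' + x'(0) e^(-t)), which is a constant
   multiple of A1 x up to a decaying term.  Then r' = c0 A1 J^b r + f, where J^b
   is convolution with t^(b-1) and f is integrable.  Up to a constant phase,
   t^(b-1) is the limit as e -> 0 of
     (e - it)^(b-1) = const * int x^(-b) e^(-(e - it)x) dx,
   and the sector inequality says precisely that the contribution of each x to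
   int r' (-P A1) J^b r is nonnegative, so r'Pr stays bounded.  Applied to
   -P A1 - d and combined with t^(b-1) = const * int rho^(-b) e^(-rho t) d rho,
   this also bounds int |z|^2 for the exponential average z of r.  Barbalat's
   lemma gives z -> 0 and then r -> 0, hence x -> 0; with zero data the energy
   estimate gives r = 0, hence uniqueness.  Existence is by Picard iteration. *)

(** * Convolution on the half-line *)

Section affine.
Context {R : realType}.
Local Notation mu := (@lebesgue_measure R).

(** The matrix -P A1 is not symmetric in general, so the positivity of the scalar kernel t^(b-1)
    says nothing about its form: the phase of the kernel matters. The Fourier symbol of J^b has
    modulus |w|^(-b) and constant phase of angle b pi/2 on each half-axis, and this angle is the one
    in the sector inequality. The density x^(-b) is not integrable at infinity, so integrals can be
    exchanged only with the damping e^(-ex); damping bends the phase, which becomes constant again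
    only in the limit. The symbol also decays at high frequency, so the energy bounds an average z
    of r and not r itself; this is why Barbalat's lemma is needed twice, for z and then for z' = r -
    z. It requires r to be Lipschitz, hence J^b r bounded, and boundedness of r does not give this
    because t^(b-1) is not integrable at infinity. The correction x'(0) e^(-t) supplies it: x +
    x'(0) e^(-t) is a bounded function whose derivative is a constant multiple of J^b r. *)

Lemma measurable_reflect (t : R) :
  measurable_fun setT ((fun x => t - x) : measurableTypeR R -> measurableTypeR R).
Proof. exact: measurable_funB. Qed.

Lemma measurable_scale (c : R) :
  measurable_fun setT ((fun x => c * x) : measurableTypeR R -> measurableTypeR R).
Proof. exact: measurable_funM. Qed.

(** Lebesgue measure is determined by its values on the intervals []a, b]]. Their preimages are
    closed on the left and open on the right, which does not affect the length. *)
Lemma lebesgue_measure_reflect (t : R) (A : set (measurableTypeR R)) : measurable A ->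
  pushforward mu ((fun x => t - x) : measurableTypeR R -> measurableTypeR R) A = mu A.
Proof.
move=> mA; apply/esym.
apply: lebesgue_measure_unique => //=; first exact: measurable_reflect.
move=> _ _ [[a b]] _ <-.
rewrite /pushforward.
have -> : (fun x : R => t - x) @^-1` `]a, b] = `[t - b, t - a[%classic.
  by apply/seteqP; split => x /=; rewrite !in_itv/=; lra.
rewrite !lebesgue_measure_itv/= !lte_fin ltrD2l ltrN2; case: ifP => // _.
by rewrite -!EFinB; congr (_%:E); ring.
Qed.

Lemma ge0_integral_reflect (t : R) (h : R -> \bar R) : measurable_fun setT h ->
  (forall x, 0 <= h x)%E -> (\int[mu]_x h (t - x)%R = \int[mu]_x h x)%E.
Proof.
move=> mh h0.
have := @ge0_integral_pushforward _ _ _ _ _ _ (measurable_reflect t) mu setT h measurableT mh.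
rewrite preimage_setT => <- //.
apply: eq_measure_integral; first exact: measurable_reflect.
move=> m A mA _; exact: (@lebesgue_measure_reflect t A mA).
Qed.

Lemma integral_reflect (t : R) (h : R -> \bar R) : measurable_fun setT h ->
  (\int[mu]_x h (t - x)%R = \int[mu]_x h x)%E.
Proof.
move=> mh; rewrite [LHS]integralE [RHS]integralE; congr (_ - _)%E.
  rewrite -[RHS](ge0_integral_reflect t)//; last exact: measurable_funepos.
  by apply: eq_integral => x _; rewrite !funeposE.
rewrite -[RHS](ge0_integral_reflect t)//; last exact: measurable_funeneg.
by apply: eq_integral => x _; rewrite !funenegE.
Qed.

Lemma ge0_integral_scale (c : R) (D : set R) (h : R -> \bar R) : 0 < c -> measurable D ->
  measurable_fun D h -> {in D, forall x, 0 <= h x}%E ->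
  (\int[mu]_(x in D) h x = c%:E * \int[mu]_(x in (fun x => (c * x)%R) @^-1` D) h (c * x)%R)%E.
Proof.
move=> c0 mD mh h0.
rewrite -(@ge0_integral_pushforward _ _ _ _ _ _ (measurable_scale c) mu D h)//.

(* [nu] is [c] times the image of Lebesgue measure under the dilation. It gives every []a, b]] its
   length, so it is Lebesgue measure. *)
pose nu : {measure set (measurableTypeR R) -> \bar R} := mscale (NngNum (ltW c0))
   (measure_function_pushforward__canonical__measure_function_Measure mu (measurable_scale c)).
transitivity (\int[nu]_(x in D) h x)%E.
  apply: eq_measure_integral => A mA _.
  apply: (@lebesgue_measure_unique R nu) => // _ [[a b]] _ <-.
  rewrite /nu/= /mscale/= /pushforward.
  have -> : (fun x : R => c * x) @^-1` `]a, b] = `]c^-1 * a, c^-1 * b]%classic.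
    by apply/seteqP; split => x /=; rewrite !in_itv/= ltr_pdivrMl// ler_pdivlMl.
  rewrite !lebesgue_measure_itv/= !lte_fin ltr_pM2l ?invr_gt0//; case: ifP => // _.
    by rewrite -!EFinB -EFinM; congr (_%:E); rewrite mulrBr !mulVKf// gt_eqF.
  by rewrite mule0.
rewrite ge0_integral_mscale//.
by move=> x Dx; apply: h0; rewrite inE.
Qed.

Lemma measurable_fun_subfst_snd (f : R -> R) : measurable_fun setT f ->
  measurable_fun setT (fun x : measurableTypeR R * measurableTypeR R => f (x.1 - x.2)).
Proof.
move=> mf; apply: (measurableT_comp mf).
exact: measurable_funB.
Qed.

Definition conv (f g : R -> R) (t : R) : R := \int[mu]_s (f (t - s) * g s).

Lemma conv_comm (f g : R -> R) t : measurable_fun setT f -> measurable_fun setT g ->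
  conv f g t = conv g f t.
Proof.
move=> mf mg; rewrite /conv /Rintegral; congr fine.
rewrite -[RHS](@integral_reflect t).
  by apply: eq_integral => x _; rewrite subKr mulrC.
apply/measurable_EFinP; apply: measurable_funM => //.
by apply: (measurableT_comp mg); exact: measurable_reflect.
Qed.

(** No integrability is assumed: Tonelli's theorem handles the positive and negative parts
    separately, and [conv] is [fine] of their difference, whatever its value. *)
Lemma measurable_conv (f g : R -> R) : measurable_fun setT f -> measurable_fun setT g ->
  measurable_fun setT (conv f g).
Proof.
move=> mf mg.
pose F (x : measurableTypeR R * measurableTypeR R) := (f (x.1 - x.2) * g x.2)%:E.
have mF : measurable_fun setT F.
  apply/measurable_EFinP; apply: measurable_funM; first exact: measurable_fun_subfst_snd.
  exact: measurableT_comp.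
rewrite (_ : conv f g = fun t => fine (\int[mu]_s F (t, s))%E)//.
apply: measurableT_comp => //.
rewrite [X in measurable_fun _ X](_ : _ = fun t => (\int[mu]_s (F^\+ (t, s)) - \int[mu]_s (F^\- (t, s)))%E).
  apply: emeasurable_funB.
    apply: (@measurable_fun_fubini_tonelli_F _ _ _ _ _ mu (F^\+)%E) => //; exact: measurable_funepos.
  apply: (@measurable_fun_fubini_tonelli_F _ _ _ _ _ mu (F^\-)%E) => //; exact: measurable_funeneg.
apply/funext => t; rewrite integralE; congr (_ - _)%E; apply: eq_integral => s _.
  by rewrite !funeposE.
by rewrite !funenegE.
Qed.

(** Fubini's theorem for [f (t - r) * g (r - s) * h s]. The hypothesis is the integrability of this
    function, with the inner integral translated so that it reads as a convolution of absolute
    values at [t - s]. *)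
Lemma conv_assoc (f g h : R -> R) t : measurable_fun setT f -> measurable_fun setT g ->
  measurable_fun setT h ->
  (\int[mu]_s (`|h s|%:E * \int[mu]_r (`|f (t - s - r) * g r|)%:E) < +oo)%E ->
  conv f (conv g h) t = conv (conv f g) h t.
Proof.
move=> mf mg mh foo.
pose F (x : measurableTypeR R * measurableTypeR R) := (f (t - x.1) * g (x.1 - x.2) * h x.2)%:E.
have mF : measurable_fun setT F.
  apply/measurable_EFinP; apply: measurable_funM; last exact: measurableT_comp.
  apply: measurable_funM; last exact: measurable_fun_subfst_snd.
  apply: (measurableT_comp mf); exact: measurable_funB.
have inner s : (\int[mu]_r (`|f (t - r) * g (r - s)|)%:E = \int[mu]_r (`|f (t - s - r) * g r|)%:E)%E.
  rewrite -[LHS](ge0_integral_reflect (t+0)) //; last first.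
    apply/measurable_EFinP; apply: measurableT_comp => //; apply: measurable_funM.
      apply: (measurableT_comp mf); exact: measurable_funB.
    apply: (measurableT_comp mg); exact: measurable_funB.
  rewrite -[RHS](ge0_integral_reflect (t - s)) //; last first.
    apply/measurable_EFinP; apply: measurableT_comp => //; apply: measurable_funM => //.
    apply: (measurableT_comp mf); exact: measurable_funB.
  apply: eq_integral => x _; congr (`| f _ * g _|)%:E; ring.
have iF : (mu \x mu)%E.-integrable setT F.
  apply/integrable21ltyP => //.
  apply: le_lt_trans foo; rewrite le_eqVlt; apply/orP; left; apply/eqP.
  apply: eq_integral => s _.
  rewrite -inner -ge0_integralZl//.
    by apply: eq_integral => r _; rewrite /F/= normrM mulrC EFinM.
  apply/measurable_EFinP; apply: measurableT_comp => //; apply: measurable_funM.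
    apply: (measurableT_comp mf); exact: measurable_funB.
  apply: (measurableT_comp mg); exact: measurable_funB.
have mgh := measurable_conv mg mh; have mfg := measurable_conv mf mg.
(* The inner integrals are finite only for almost every value of the outer variable, so a factor
   must be moved across using the integrability of the product alone. When [c = 0] this says nothing
   about [k], hence the case split. *)
have finZ (c : R) (k : R -> R) : (mu.-integrable setT (fun s => (c * k s)%:E)) ->
    (\int[mu]_s (c * k s)%:E = (c * \int[mu]_s k s)%:E)%E.
  have [->|c0] := eqVneq c 0.
    move=> _; rewrite mul0r; under eq_integral do rewrite mul0r.
    by rewrite integral0.
  move=> ick; have ik : mu.-integrable setT (EFin \o k).
    apply: (@eq_integrable _ _ _ mu setT measurableT (fun s => (c^-1)%:E * (c * k s)%:E)%E) => //.
      by move=> s _; rewrite -EFinM mulKf.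
    exact: integrableZl.
  by rewrite -RintegralZl// /Rintegral fineK//; exact: integrable_fin_num.
have E1 : conv f (conv g h) t = fine (\int[mu]_r \int[mu]_s F (r, s))%E.
  rewrite /conv /Rintegral; congr fine; apply/esym/ae_eq_integral => //.
  - exact: (measurable_int mu (integrable_fubini_F iF)).
  - apply/measurable_EFinP; apply: measurable_funM => //.
    by apply: (measurableT_comp mf); exact: measurable_funB.
  - apply: filterS (ae_integrable1 iF) => r ir _.
    rewrite -finZ; first by apply: eq_integral => s _; rewrite /F/= mulrA.
    by apply: eq_integrable ir => // s _; rewrite /F/= mulrA.
have E2 : conv (conv f g) h t = fine (\int[mu]_s \int[mu]_r F (r, s))%E.
  rewrite [LHS]/conv /Rintegral; congr fine; apply/esym/ae_eq_integral => //.
  - exact: (measurable_fubini_G iF).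
  - apply/measurable_EFinP; apply: measurable_funM => //.
    by apply: (measurableT_comp mfg); exact: measurable_funB.
  - apply: filterS (ae_integrable2 iF) => s is_ _.
    rewrite mulrC.
    have -> : conv f g (t - s) = \int[mu]_r (f (t - r) * g (r - s)).
      rewrite /conv /Rintegral; congr fine.
      rewrite -[LHS](@integral_reflect (t - s)); last first.
        apply/measurable_EFinP; apply: measurable_funM => //.
        by apply: (measurableT_comp mf); exact: measurable_funB.
      rewrite -[RHS](@integral_reflect t); last first.
        apply/measurable_EFinP; apply: measurable_funM => //.
          by apply: (measurableT_comp mf); exact: measurable_funB.
        by apply: (measurableT_comp mg); exact: measurable_funB.
      by apply: eq_integral => x _; congr (f _ * g _)%:E; ring.
    rewrite -finZ; first by apply: eq_integral => r _; rewrite /F/= mulrC.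
    by apply: eq_integrable is_ => // r _; rewrite /F/= mulrC.
by rewrite E1 E2 Fubini.
Qed.

Definition vconv (f g : R -> R) (t : R) : R :=
  \int[mu]_(s in `]0, t[) (f (t - s) * g s).

Local Notation lintegrable f t := (mu.-integrable `]0, t[ (EFin \o f)).

(** For 0 < s < t both arguments lie in []0, T[], and for any other [s] one of the truncated factors
    vanishes. Results on the whole line thus transfer to functions controlled only on []0, T[]. *)
Lemma conv_restrictE (T t : R) (f g : R -> R) : t <= T ->
  conv (f \_ `]0, T[) (g \_ `]0, T[) t = vconv f g t.
Proof.
move=> tT; rewrite /vconv Rintegral_mkcond; apply: eq_Rintegral => s _.
rewrite !patchE !mem_setE !in_itv/=.
have [s0|s0] := ltP 0 s; last by rewrite mulr0.
have [st|st] := ltP s t => /=.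
  by rewrite !ifT//; lra.
by rewrite subr_gt0 ltNge st/= mul0r.
Qed.

Lemma lintegrable_measurable (f : R -> R) (t : R) : lintegrable f t -> measurable_fun `]0, t[ f.
Proof. by move=> /measurable_int/measurable_EFinP. Qed.

Lemma measurable_restrict (f : R -> R) (t : R) : measurable_fun `]0, t[ f ->
  measurable_fun setT (f \_ `]0, t[).
Proof. by move=> mf; apply/(measurable_restrictT _ _).1. Qed.

Lemma vconv_comm (f g : R -> R) (t : R) : measurable_fun `]0, t[ f -> measurable_fun `]0, t[ g ->
  vconv f g t = vconv g f t.
Proof.
move=> mf mg; rewrite -(conv_restrictE f g (lexx t)) conv_comm; last 2 first.
- exact: measurable_restrict.
- exact: measurable_restrict.
exact: conv_restrictE.
Qed.

Lemma eq_vconv (f f' g g' : R -> R) t : {in `]0, t[, f =1 f'} -> {in `]0, t[, g =1 g'} ->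
  vconv f g t = vconv f' g' t.
Proof.
move=> ff gg; apply: eq_Rintegral => s; rewrite inE/= => st.
rewrite gg// ff//; move: st; rewrite !in_itv/=; lra.
Qed.

(** Both [f] and [g] may be singular at 0, like t^(b-1) and t^(-b), whose convolution is constant. A
    uniform bound on the convolution of their absolute values, together with the integrability of
    [h], yields the hypothesis of [conv_assoc]. *)
Lemma vconv_assoc (C : R) (f g h : R -> R) t :
  lintegrable f t -> lintegrable g t -> lintegrable h t ->
  (forall u, 0 < u < t -> (\int[mu]_(r in `]0%R, u[) (`|f (u - r) * g r|)%:E <= C%:E)%E) ->
  vconv f (vconv g h) t = vconv (vconv f g) h t.
Proof.
move=> lf lg lh fgC.
have mr k : lintegrable k t -> measurable_fun setT (k \_ `]0, t[).
  by move=> /lintegrable_measurable; exact: measurable_restrict.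
pose f' := f \_ `]0, t[; pose g' := g \_ `]0, t[; pose h' := h \_ `]0, t[.
transitivity (conv f' (conv g' h') t).
  rewrite -(conv_restrictE f (vconv g h) (lexx t)).
  apply: eq_Rintegral => s _.
  rewrite /f' !patchE !mem_setE !in_itv/=.
  have [s0|s0] := ltP 0 s => /=; last by rewrite ifF ?mul0r//; lra.
  have [st|st] := ltP s t => /=.
    by rewrite ifT; [rewrite conv_restrictE// ltW|lra].
  by rewrite subr_gt0 [t > s]ltNge st/= !mul0r.
transitivity (conv (conv f' g') h' t); last first.
  rewrite -(conv_restrictE (vconv f g) h (lexx t)).
  apply: eq_Rintegral => s _.
  rewrite /h' !patchE !mem_setE !in_itv/=.
  have [s0|s0] := ltP 0 s => /=; last by rewrite !mulr0.
  have [st|st] := ltP s t => /=; last by rewrite !mulr0.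
  rewrite ifT; last by lra.
  by rewrite conv_restrictE//; lra.
apply: conv_assoc; [exact: mr..|].
apply: (@le_lt_trans _ _ (\int[mu]_(s in `]0%R, t[) (`|C| * `|h s|)%:E)%E).
  rewrite [leRHS]integral_mkcond.
  have mfg : measurable_fun setT (fun x : measurableTypeR R * measurableTypeR R =>
      (`|f' (t - x.1 - x.2) * g' x.2|)%:E).
    apply/measurable_EFinP; apply: measurableT_comp => //; apply: measurable_funM.
      apply: (measurableT_comp (mr _ lf)); apply: measurable_funB => //.
      exact: measurable_funB.
    exact: (measurableT_comp (mr _ lg)).
  apply: ge0_le_integral => //.
  - by move=> s _; apply: mule_ge0 => //; exact: integral_ge0.
  - apply: emeasurable_funM.
      by apply/measurable_EFinP; apply: measurableT_comp => //; exact: mr.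
    exact: (@measurable_fun_fubini_tonelli_F _ _ _ _ _ mu _ mfg).
  - apply/(measurable_restrictT _ _).1 => //.
    apply/measurable_EFinP; apply: measurable_funM => //; apply: measurableT_comp => //.
    exact: lintegrable_measurable lh.
  move=> s _; rewrite /h' !patchE; case: ifPn; last by rewrite normr0 mul0e.
  rewrite mem_setE in_itv/= => /andP[s0 st].
  rewrite muleC EFinM; apply: lee_pmul => //; first exact: integral_ge0.
  apply: (@le_trans _ _ C%:E); last by rewrite lee_fin ler_norm.
  apply: le_trans (fgC (t - s) _); last by lra.
  rewrite [leRHS]integral_mkcond le_eqVlt; apply/orP; left; apply/eqP.
  apply: eq_integral => r _; rewrite /f' /g' !patchE !mem_setE !in_itv/=.
  have [r0|r0] := ltP 0 r => /=; last by rewrite mulr0 normr0.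
  have [rt|rt] := ltP r (t - s) => /=; first by rewrite !ifT//; lra.
  by rewrite ifF ?mul0r ?normr0//; lra.
have : mu.-integrable `]0, t[ (fun s => (`|C|)%:E * `|(h s)%:E|)%E.
  by apply: integrableZl => //; exact: integrable_abse.
by move/integrable_lty; apply.
Qed.

Lemma lintegrable_reflect f t : lintegrable f t -> lintegrable (fun s => f (t - s)) t.
Proof.
move=> lf; have mf := measurable_restrict (lintegrable_measurable lf).
have E : (EFin \o (fun s => f (t - s))) \_ `]0, t[ = (EFin \o (f \_ `]0, t[)) \o (fun s => t - s).
  apply/funext => s; rewrite /= !patchE !mem_setE !in_itv/= (_ : (0 < s < t) = (0 < t - s < t)).
    by case: ifP.
  by apply/idP/idP; lra.
apply/(integrable_mkcond _ _).2 => //; rewrite E.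
have : mu.-integrable setT (EFin \o f \_ `]0, t[).
  by rewrite -restrict_EFin; apply/(integrable_mkcond _ _).1.
move=> /integrableP[mh hoo]; apply/integrableP; split.
  by apply: (measurableT_comp mh); exact: measurable_reflect.
rewrite (ge0_integral_reflect t (h := abse \o (EFin \o f \_ `]0, t[)))//.
  exact: measurableT_comp.
by move=> x; exact: abse_ge0.
Qed.

(** The two singularities sit at opposite ends: for s <= t/2 the factor [f (t - s)] is bounded, for
    s > t/2 the factor [g s] is. *)
Lemma lintegrable_conv (C : R) (f g : R -> R) t :
  lintegrable f t -> lintegrable g t ->
  (forall s, t / 2 <= s < t -> `|f s| <= C) ->
  (forall s, t / 2 <= s < t -> `|g s| <= C) ->
  lintegrable (fun s => f (t - s) * g s) t.
Proof.
move=> lf lg fC gC.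
have lf' := lintegrable_reflect lf.
have [t0|t0] := leP t 0.
  by rewrite set_itv_ge ?bnd_simp -?leNgt//; exact: integrable_set0.
have C0 : 0 <= C by apply: le_trans (fC (t / 2) _) => //; lra.
apply: (@le_integrable _ _ _ mu `]0, t[ _ _ (fun s => (C * (`|g s| + `|f (t - s)|))%:E)) => //.
- apply/measurable_EFinP/measurable_funM.
    exact: lintegrable_measurable lf'.
  exact: lintegrable_measurable lg.
- move=> s; rewrite /= in_itv/= => /andP[s0 st].
  rewrite lee_fin [leRHS]ger0_norm ?mulr_ge0 ?addr_ge0// normrM mulrDr.
  have [sle|sgt] := leP s (t / 2).
    apply: (@le_trans _ _ (C * `|g s|)); last by rewrite lerDl mulr_ge0.
    by rewrite ler_wpM2r// fC//; lra.
  apply: (@le_trans _ _ (C * `|f (t - s)|)); last by rewrite lerDr mulr_ge0.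
  by rewrite mulrC ler_wpM2r// gC//; lra.
rewrite (_ : (fun s => _) = (fun s => C%:E * ((`|g s|)%:E + (`|f (t - s)|)%:E))%E); last first.
  by apply/funext => s; rewrite EFinM EFinD.
apply: integrableZl => //; apply: integrableD => //.
  exact: (integrable_abse lg).
exact: (integrable_abse lf').
Qed.

End affine.

(** * Functions continuous on the open half-line *)

Section calculus.
Context {R : realType}.
Implicit Types (f g F : R -> R) (x t a b c l T : R).
Local Notation mu := (@lebesgue_measure R).
Local Notation lintegrable f t := (mu.-integrable `]0, t[ (EFin \o f)).

Lemma isd_eq x f a b : is_derive x 1 f a -> a = b -> is_derive x 1 f b.
Proof. by move=> ? <-. Qed.

Lemma isd_cst x c : is_derive x 1 (fun _ : R => c) 0.
Proof. exact: is_derive_cst. Qed.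

Lemma isd_id x : is_derive x 1 (fun y : R => y) 1.
Proof. exact: is_derive_id. Qed.

Lemma isd_D x f g a b : is_derive x 1 f a -> is_derive x 1 g b ->
  is_derive x 1 (fun y => f y + g y) (a + b).
Proof. exact: is_deriveD. Qed.

Lemma isd_B x f g a b : is_derive x 1 f a -> is_derive x 1 g b ->
  is_derive x 1 (fun y => f y - g y) (a - b).
Proof. exact: is_deriveB. Qed.

Lemma isd_N x f a : is_derive x 1 f a -> is_derive x 1 (fun y => - f y) (- a).
Proof. exact: is_deriveN. Qed.

Lemma isd_M x f g a b : is_derive x 1 f a -> is_derive x 1 g b ->
  is_derive x 1 (fun y => f y * g y) (a * g x + f x * b).
Proof.
move=> fa gb; apply: isd_eq (is_deriveM fa gb) _.
by rewrite addrC /GRing.scale/= (mulrC (g x)).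
Qed.

Lemma isd_Z x f a c : is_derive x 1 f a -> is_derive x 1 (fun y => c * f y) (c * a).
Proof. by move=> fa; apply: isd_eq (isd_M (isd_cst x c) fa) _; rewrite mul0r add0r. Qed.

Lemma isd_sum (I : Type) (r : seq I) x (f : I -> R -> R) (a : I -> R) :
  (forall i, is_derive x 1 (f i) (a i)) ->
  is_derive x 1 (fun y => \sum_(i <- r) f i y) (\sum_(i <- r) a i).
Proof.
move=> fa; elim: r => [|i r IHr].
  rewrite big_nil (_ : (fun y => _) = cst 0); last by apply/funext => y; rewrite big_nil.
  exact: isd_cst.
rewrite big_cons (_ : (fun y => _) = (fun y => f i y + \sum_(j <- r) f j y)).
  exact: isd_D.
by apply/funext => y; rewrite big_cons.
Qed.

Lemma isd_comp x f g a b : is_derive (g x) 1 f a -> is_derive x 1 g b ->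
  is_derive x 1 (fun y => f (g y)) (a * b).
Proof. exact: is_derive1_comp. Qed.

Lemma isd_exp x f a : is_derive x 1 f a -> is_derive x 1 (fun y => expR (f y)) (expR (f x) * a).
Proof. by move=> fa; apply: (isd_comp (f := expR)). Qed.

Lemma isd_sin x f a : is_derive x 1 f a -> is_derive x 1 (fun y => sin (f y)) (cos (f x) * a).
Proof. by move=> fa; apply: (isd_comp (f := sin)). Qed.

Lemma isd_cos x f a : is_derive x 1 f a -> is_derive x 1 (fun y => cos (f y)) (- sin (f x) * a).
Proof. by move=> fa; apply: (isd_comp (f := cos)). Qed.

Lemma isd_powR x c : 0 < x -> is_derive x 1 (fun y => y `^ c) (c * x `^ (c - 1)).
Proof. exact: is_derive1_powR. Qed.

Lemma isd_powRc x f a c : 0 < f x -> is_derive x 1 f a ->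
  is_derive x 1 (fun y => f y `^ c) (c * f x `^ (c - 1) * a).
Proof. by move=> f0 fa; apply: (@isd_comp x (fun y => y `^ c)) => //; exact: isd_powR. Qed.

Lemma isd_near x f g a : (\forall y \near x, f y = g y) -> is_derive x 1 f a -> is_derive x 1 g a.
Proof. exact: near_eq_is_derive. Qed.

Lemma isd_derive1 x f a : is_derive x 1 f a -> f^`()%classic x = a.
Proof. by move=> fa; rewrite derive1E derive_val. Qed.

Lemma derivable_isd x f : derivable f x 1 -> is_derive x 1 f (f^`()%classic x).
Proof. by move=> /derivableP; rewrite derive1E. Qed.

Lemma isd_derivable x f a : is_derive x 1 f a -> derivable f x 1.
Proof. by case. Qed.

Lemma isd_cont x f a : is_derive x 1 f a -> {for x, continuous f}.
Proof.
move=> fa; apply: differentiable_continuous; apply/derivable1_diffP.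
exact: ex_derive.
Qed.

Lemma near_pos x : 0 < x -> \forall y \near x, 0 < y.
Proof. exact: lt_nbhsr. Qed.

(** Kernels and second derivatives are [cpos], and may blow up at 0; states are [czero]. Keeping the
    limit at 0 apart allows two-sided derivatives at every positive time, with no constraint on
    negative times. *)
Definition cpos f := forall t, 0 < t -> {for t, continuous f}.
Definition czero f := cpos f /\ f x @[x --> 0^'+] --> f 0.

Lemma czeroP f : {within `[0, +oo[, continuous f} <-> czero f.
Proof.
split=> [/continuous_within_itvcyP[fc f0]|[fc f0]].
  by split=> // t t0; apply: fc; rewrite in_itv/= t0.
apply/continuous_within_itvcyP; split=> // t; rewrite in_itv/= andbT; exact: fc.
Qed.

Lemma czero_within f T : czero f -> {within `[0, T], continuous f}.
Proof.
move=> /czeroP; apply: continuous_subspaceW.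
by move=> x /=; rewrite !in_itv/= andbT => /andP[].
Qed.

Lemma cpos_within f a T : 0 < a -> cpos f -> {within `[a, T], continuous f}.
Proof.
move=> a0 fc; apply: continuous_in_subspaceT => x; rewrite inE/= in_itv/= => /andP[ax _].
by apply: fc; exact: lt_le_trans ax.
Qed.

Lemma cpos_measurable f : cpos f -> measurable_fun (`]0, +oo[ : set R) f.
Proof.
move=> fc; apply: open_continuous_measurable_fun => // x.
by rewrite inE/= in_itv/= andbT; exact: fc.
Qed.

Lemma cpos_measurable_itv f T : cpos f -> measurable_fun (`]0, T[ : set R) f.
Proof.
move=> fc; apply: measurable_funS (cpos_measurable fc) => //.
by move=> x /=; rewrite !in_itv/= andbT => /andP[].
Qed.

Lemma within_bounded f a b : {within `[a, b], continuous f} ->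
  exists C, forall t, a <= t <= b -> `|f t| <= C.
Proof.
move=> fc; have [ab|ba] := leP a b; last by exists 0 => t; lra.
have [M _ MP] := EVT_max ab fc; have [m _ mP] := EVT_min ab fc.
exists (`|f M| + `|f m|) => t tab; have tI : t \in `[a, b] by rewrite in_itv.
rewrite ler_norml; have := MP _ tI; have := mP _ tI.
have := ler_norm (f M); have := ler_norm (- f m); rewrite normrN.
have := normr_ge0 (f m); have := normr_ge0 (f M); lra.
Qed.

Lemma czero_bounded f T : czero f -> exists C, forall t, 0 <= t <= T -> `|f t| <= C.
Proof. by move=> fc; exact/within_bounded/czero_within. Qed.

Lemma within_integrable f a b : {within `[a, b], continuous f} ->
  mu.-integrable `[a, b] (EFin \o f).
Proof. by move=> fc; apply: continuous_compact_integrable => //; exact: segment_compact. Qed.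

Lemma czero_lintegrable f T : czero f -> lintegrable f T.
Proof.
move=> fc; have h := within_integrable (@czero_within _ T fc).
apply: (@integrableS _ _ _ mu _ _ _ (measurable_itv _) (measurable_itv _) _ h).
by move=> x /=; rewrite !in_itv/= => /andP[/ltW -> /ltW ->].
Qed.

Lemma integrable_D (D : set R) f g : measurable D -> mu.-integrable D (EFin \o f) ->
  mu.-integrable D (EFin \o g) -> mu.-integrable D (EFin \o (fun x => f x + g x)).
Proof. by move=> mD fi gi; apply: (@eq_integrable _ _ _ mu D mD ((EFin \o f) \+ (EFin \o g))%E) => //; exact: integrableD. Qed.

Lemma integrable_B (D : set R) f g : measurable D -> mu.-integrable D (EFin \o f) ->
  mu.-integrable D (EFin \o g) -> mu.-integrable D (EFin \o (fun x => f x - g x)).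
Proof. by move=> mD fi gi; apply: (@eq_integrable _ _ _ mu D mD ((EFin \o f) \- (EFin \o g))%E) => //; exact: integrableB. Qed.

Lemma integrable_Z (D : set R) c f : measurable D -> mu.-integrable D (EFin \o f) ->
  mu.-integrable D (EFin \o (fun x => c * f x)).
Proof. by move=> mD fi; apply: (@eq_integrable _ _ _ mu D mD (fun x => c%:E * (EFin \o f) x)%E) => //; exact: integrableZl. Qed.

Lemma FTC_pos f T : 0 < T -> (forall t, lintegrable f t) -> {for T, continuous f} ->
  is_derive T 1 (fun t => \int[mu]_(s in `]0, t[) f s) (f T).
Proof.
move=> T0 lf fT.
have T1 : T < T + 1 by rewrite ltrDl.
have lT : mu.-integrable [set` Interval (BRight 0) (BRight (T + 1))] (EFin \o f).
  apply: integrableS (lf (T + 2)) => //.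
  by move=> x /=; rewrite !in_itv/= => /andP[-> /=]; lra.
have a0 : (BRight (0 : R) < BRight T)%O by rewrite bnd_simp.
have [dF F'] := continuous_FTC1 T1 lT a0 fT.
have E : (fun t => \int[mu]_(s in `]0, t[) f s) = (fun t => \int[mu]_(s in `]0, t]) f s).
  by apply/funext => t; apply: Rintegral_itv_bndo_bndc.
rewrite E -F'; exact: derivable_isd.
Qed.

Lemma primitive_czero f : (forall t, lintegrable f t) ->
  forall T, {within `[0, T], continuous (fun t => \int[mu]_(s in `]0, t[) f s)}.
Proof.
move=> lf T; have [T0|T0] := leP 0 T; last first.
  by rewrite set_itv_ge ?bnd_simp -?ltNge//; exact: continuous_subspace0.
have lT : mu.-integrable (`[0, T] : set R) (EFin \o f).
  have mf := lintegrable_measurable (lf T).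
  apply/integrableP; split.
    by apply/measurable_EFinP; exact: measurable_fun_itv_cc mf.
  rewrite integral_itv_bndoo; first by move/integrableP : (lf T) => [].
  by apply: measurableT_comp => //; exact/measurable_EFinP.
have := parameterized_integral_continuous T0 lT.
suff -> : (fun x => parameterized_integral mu 0 x f) = (fun t => \int[mu]_(s in `]0, t[) f s) by [].
apply/funext => t; rewrite /parameterized_integral /Rintegral integral_itv_bndoo//.
apply/measurable_EFinP; exact: lintegrable_measurable (lf t).
Qed.

(** Monotone convergence along the intervals [[T / (n + 2), T]], on which [f] is continuous; the
    shift by 2 keeps them nondegenerate. Integrability near 0 is a consequence and not a hypothesis,
    which is how it is obtained for powers. *)
Lemma ge0_FTC f F l T : 0 < T -> (forall t, 0 < t -> 0 <= f t) -> cpos f ->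
  (forall t, 0 < t -> is_derive t 1 F (f t)) -> F x @[x --> 0^'+] --> l ->
  (\int[mu]_(s in `]0%R, T[) (f s)%:E = (F T - l)%:E)%E.
Proof.
move=> T0 f0 fc dF Fl.
pose A n : set R := [set` `[T / n.+2%:R, T]].
have e0 n : 0 < T / n.+2%:R by rewrite divr_gt0.
have eT n : T / n.+2%:R < T by rewrite ltr_pdivrMr// ltr_pMr// ltr1n.
have -> : (\int[mu]_(s in `]0%R, T[) (f s)%:E = \int[mu]_(s in \bigcup_n A n) (f s)%:E)%E.
  rewrite integral_itv_bndo_bndc; last by apply/measurable_EFinP; exact: cpos_measurable_itv.
  congr integral; apply/seteqP; split => x /=; rewrite in_itv/=.
    move=> /andP[x0 xT].
    exists (Num.truncn (T / x)) => //=; rewrite /A/= in_itv/= xT andbT.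
    rewrite ler_pdivrMr// mulrC -ler_pdivrMr//.
    apply/ltW/(lt_le_trans (truncnS_gt _)); by rewrite ler_nat.
  by move=> [n _]; rewrite /A/= in_itv/= => /andP[+ ->]; rewrite andbT; apply: lt_le_trans.
have mA n : measurable_fun (A n) (EFin \o f).
  apply/measurable_EFinP; apply: measurable_funS (cpos_measurable fc) => //.
  move=> x; rewrite /A/= !in_itv/= andbT => /andP[+ _]; exact: lt_le_trans.
have cv1 : (\int[mu]_(s in A n) (f s)%:E @[n --> \oo] --> \int[mu]_(s in \bigcup_n A n) (f s)%:E)%E.
  apply: ge0_nondecreasing_set_cvg_integral => //.
  - apply/nondecreasing_seqP => n; apply/subsetPset => x; rewrite /A/= !in_itv/=.
    move=> /andP[xn ->]; rewrite andbT (le_trans _ xn)//.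
    by rewrite ler_pM2l// lef_pV2 ?posrE// ler_nat.
  - by move=> n; exact: measurable_itv.
  - move=> n x; rewrite /A/= in_itv/= lee_fin => /andP[xn _]; apply: f0; exact: lt_le_trans xn.
have cv2 : (\int[mu]_(s in A n) (f s)%:E @[n --> \oo] --> (F T - l)%:E)%E.
  rewrite (_ : (fun n => _) = (fun n => (F T - F (T / n.+2%:R))%:E)).
    apply: cvg_EFin; first by near=> n.
    apply: cvgB; first exact: cvg_cst.
    move/cvg_at_rightP : Fl; apply; split=> //.
    rewrite -[X in _ --> X](mulr0 T); apply: cvgMr.
    by rewrite (cvg_shiftS (fun n => n.+1%:R^-1 : R)); exact: cvg_harmonic.
  apply/funext => n; rewrite (@continuous_FTC2 _ f F)//.
  - exact: cpos_within.
  - split.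
    + move=> x; rewrite in_itv/= => /andP[x0 _].
      by apply: isd_derivable (dF x _); exact: lt_trans (e0 n) x0.
    + apply: cvg_at_right_filter; exact: isd_cont (dF _ (e0 n)).
    + apply: cvg_at_left_filter; exact: isd_cont (dF _ T0).
  - by move=> x; rewrite in_itv/= => /andP[x0 _]; apply: isd_derive1; apply: dF; exact: lt_trans x0.
exact: cvg_unique cv1 cv2.
Unshelve. all: by end_near. Qed.

Lemma ge0_FTC_lintegrable f F l : (forall t, 0 < t -> 0 <= f t) -> cpos f ->
  (forall t, 0 < t -> is_derive t 1 F (f t)) -> F x @[x --> 0^'+] --> l ->
  forall T, lintegrable f T.
Proof.
move=> f0 fc dF Fl T; have [T0|T0] := leP T 0.
  by rewrite set_itv_ge ?bnd_simp -?leNgt//; exact: integrable_set0.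
apply/integrableP; split; first by apply/measurable_EFinP; exact: cpos_measurable_itv.
rewrite [X in (X < _)%E](_ : _ = \int[mu]_(s in `]0%R, T[) (f s)%:E)%E.
  by rewrite (ge0_FTC T0 f0 fc dF Fl) ltry.
apply: eq_integral => x; rewrite /=.
 by rewrite inE/= in_itv/= => /andP[x0 _]; rewrite ger0_norm// f0.
Qed.

(** The difference between [F] and the indefinite integral has zero derivative on []0, T[] and is
    continuous up to the ends, so the mean value theorem applies even if [f] is unbounded at 0. *)
Lemma FTC_eq f F T : 0 < T -> czero F -> (forall t, 0 < t -> is_derive t 1 F (f t)) ->
  cpos f -> (forall t, lintegrable f t) -> \int[mu]_(s in `]0, T[) f s = F T - F 0.
Proof.
move=> T0 cF dF fc lf; pose G t := \int[mu]_(s in `]0, t[) f s.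
have G0 : G 0 = 0 by rewrite /G set_itv_ge ?bnd_simp ?ltxx// Rintegral_set0.
have [||c _] := @MVT R (fun t => F t - G t) (fun=> 0) 0 T T0.
- move=> x; rewrite in_itv/= => /andP[x0 _].
  by apply: isd_eq (isd_B (dF x x0) (FTC_pos x0 lf (fc x x0))) _; rewrite subrr.
- move=> x; apply: continuousB; first exact: (@czero_within _ T cF).
  exact: primitive_czero.
by rewrite mul0r G0; rewrite /G; lra.
Qed.

Lemma powRDp p q t : 0 < t -> t `^ (p + q) = t `^ p * t `^ q.
Proof. by move=> t0; rewrite powRD ?(gt_eqF t0) ?implybT. Qed.

Lemma cpos_powR c : cpos (fun t => t `^ c).
Proof. by move=> t t0; apply: isd_cont; exact: isd_powR. Qed.
Arguments cpos_powR : clear implicits.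

Lemma isd_powR1 p t : 0 < p -> 0 < t -> is_derive t 1 (fun t => t `^ p / p) (t `^ (p - 1)).
Proof.
move=> p0 t0; apply: isd_eq (isd_M (isd_powR p t0) (isd_cst t p^-1)) _.
by rewrite mulr0 addr0 mulrC mulrA mulVf ?mul1r// gt_eqF.
Qed.

Lemma powR_p_cvg0 p : 0 < p -> t `^ p / p @[t --> (0 : R)^'+] --> (0 : R).
Proof. by move=> p0; rewrite -[X in _ --> X](mul0r p^-1); apply: cvgMl; exact: powR_cvg0. Qed.

Lemma lintegrable_powR p T : 0 < p -> lintegrable (fun t => t `^ (p - 1)) T.
Proof.
move=> p0; apply: (@ge0_FTC_lintegrable _ (fun t => t `^ p / p) 0).
- by move=> t _; exact: powR_ge0.
- exact: cpos_powR.
- by move=> t; exact: isd_powR1.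
- exact: powR_p_cvg0.
Qed.

Lemma integral_powR p T : 0 < p -> 0 <= T -> \int[mu]_(t in `]0, T[) t `^ (p - 1) = T `^ p / p.
Proof.
move=> p0; rewrite le_eqVlt => /predU1P[<-|T0].
  by rewrite powR0 ?gt_eqF// mul0r set_itv_ge ?bnd_simp ?ltxx// Rintegral_set0.
have -> // : \int[mu]_(t in `]0, T[) t `^ (p - 1) = T `^ p / p - 0; last by rewrite subr0.
suff E : (\int[mu]_(t in `]0%R, T[) (t `^ (p - 1))%:E = (T `^ p / p - 0)%:E)%E by rewrite /Rintegral E.
apply: (@ge0_FTC _ (fun t => t `^ p / p)) => //.
- by move=> t _; exact: powR_ge0.
- exact: cpos_powR.
- by move=> t; exact: isd_powR1.
- exact: powR_p_cvg0.
Qed.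

Lemma Rintegral_gt0 (D : set R) f a b : measurable D -> mu.-integrable D (EFin \o f) ->
  (forall x, D x -> 0 <= f x) -> [set` `[a, b]] `<=` D -> a < b ->
  {within `[a, b], continuous f} -> (forall x, a <= x <= b -> 0 < f x) ->
  0 < \int[mu]_(x in D) f x.
Proof.
move=> mD fD f0 abD ab cf fp.
have [c cab cP] := EVT_min (ltW ab) cf.
have fc0 : 0 < f c by apply: fp; move: cab; rewrite in_itv.
have : (0 < (f c * (b - a))%:E)%E by rewrite lte_fin mulr_gt0// subr_gt0.
move=> /lt_le_trans lt; rewrite -lte_fin /Rintegral fineK; last exact: integrable_fin_num.
apply: lt; apply: (@le_trans _ _ (\int[mu]_(x in [set` `[a, b]]) (f x)%:E)%E).
  apply: (@le_trans _ _ (\int[mu]_(x in [set` `[a, b]]) (f c)%:E)%E).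
    rewrite integral_cst//= lebesgue_measure_itv/= lte_fin ab -EFinB -EFinM.
    exact: lexx.
  apply: ge0_le_integral => //.
  - by move=> x _; rewrite lee_fin ltW.
  - apply: (measurable_funS mD abD); exact: (measurable_int mu fD).
by apply: ge0_subset_integral => //; exact: (measurable_int mu fD).
Qed.

Lemma lintegrable_EFin f t : lintegrable f t ->
  (\int[mu]_(s in `]0%R, t[) (f s)%:E = (\int[mu]_(s in `]0, t[) f s)%:E)%E.
Proof. by move=> lf; rewrite /Rintegral fineK//; apply: integrable_fin_num. Qed.

Definition Beta (p q : R) : R := vconv (fun s => s `^ (p - 1)) (fun s => s `^ (q - 1)) 1.

Lemma lintegrable_powR_conv p f t : 0 < p -> lintegrable f t -> cpos f ->
  lintegrable (fun s => (t - s) `^ (p - 1) * f s) t.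
Proof.
move=> p0 lf fc; have [t0|t0] := leP t 0.
  by rewrite set_itv_ge ?bnd_simp -?leNgt//; exact: integrable_set0.
have t20 : 0 < t / 2 by lra.
have [C1 C1P] := within_bounded (@cpos_within _ (t / 2) t t20 (cpos_powR (p - 1))).
have [C2 C2P] := within_bounded (cpos_within (T := t) t20 fc).
apply: (@lintegrable_conv _ (`|C1| + `|C2|) (fun s => s `^ (p - 1))) => //.
- exact: lintegrable_powR.
- move=> s st; have := C1P s; have := ler_norm C1; have := normr_ge0 C2; lra.
- move=> s st; have := C2P s; have := ler_norm C2; have := normr_ge0 C1; lra.
Qed.

(** The substitution s = t x scales [t] out. In extended reals the identity gives the value of the
    convolution of two powers and also the bound that [vconv_assoc] asks for. *)
Lemma beta_integral p q t : 0 < p -> 0 < q -> 0 < t ->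
  (\int[mu]_(s in `]0%R, t[) ((t - s) `^ (p - 1) * s `^ (q - 1))%:E =
    (Beta p q * t `^ (p + q - 1))%:E)%E.
Proof.
move=> p0 q0 t0.
have l1 := @lintegrable_powR_conv p (fun s => s `^ (q - 1)) 1 p0 (lintegrable_powR 1 q0) (cpos_powR _).
have lt := @lintegrable_powR_conv p (fun s => s `^ (q - 1)) t p0 (lintegrable_powR t q0) (cpos_powR _).
rewrite (ge0_integral_scale t0)//; last 2 first.
- exact: (measurable_int mu lt).
- by move=> x _; rewrite lee_fin mulr_ge0// powR_ge0.
have -> : (fun x => t * x) @^-1` `]0, t[ = [set` `]0, 1[].
  by apply/seteqP; split => x /=; rewrite !in_itv/= pmulr_rgt0// gtr_pMr.
have -> : (\int[mu]_(x in `]0%R, 1%R[) ((t - t * x) `^ (p - 1) * (t * x) `^ (q - 1))%:E =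
    \int[mu]_(x in `]0%R, 1%R[) ((t `^ (p + q - 2))%:E * ((1 - x) `^ (p - 1) * x `^ (q - 1))%:E))%E.
  apply: eq_integral.
  move=> x; rewrite inE/= in_itv/= => /andP[x0 x1]; rewrite -EFinM; congr EFin.
  rewrite (_ : t - t * x = t * (1 - x)); last by ring.
  rewrite !powRM; try lra.
  rewrite (_ : p + q - 2 = (p - 1) + (q - 1)); last by ring.
  rewrite (powRDp (p - 1) (q - 1) t0).
  ring.
rewrite integralZl//= muleA -EFinM.
have -> : t * t `^ (p + q - 2) = t `^ (p + q - 1).
  rewrite -[X in X * _](powRr1 (ltW t0)) -powRD; last by rewrite (gt_eqF t0) implybT.
  by congr powR; ring.
by rewrite (lintegrable_EFin l1) -EFinM mulrC.
Qed.

Lemma vconv_powR p q t : 0 < p -> 0 < q -> 0 < t ->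
  vconv (fun s => s `^ (p - 1)) (fun s => s `^ (q - 1)) t = Beta p q * t `^ (p + q - 1).
Proof. by move=> p0 q0 t0; rewrite /vconv /Rintegral beta_integral. Qed.

Lemma Beta_gt0 p q : 0 < p -> 0 < q -> 0 < Beta p q.
Proof.
move=> p0 q0; apply: (@Rintegral_gt0 _ _ (1/4) (1/2)) => //.
- by apply: (lintegrable_powR_conv p0 _ (cpos_powR (q - 1))); exact: lintegrable_powR.
- by move=> x _; rewrite mulr_ge0// powR_ge0.
- by move=> x /=; rewrite !in_itv/=; lra.
- lra.
- apply: continuous_in_subspaceT => x; rewrite inE/= in_itv/= => xab.
  have x0 : 0 < x by lra.
  have x1 : 0 < 1 - x by lra.
  apply: isd_cont.
  apply: (isd_M _ (isd_powR (q - 1) x0)).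
  apply: (isd_powRc (f := fun y => 1 - y)) => //.
- by move=> x xab; rewrite mulr_gt0// powR_gt0//; lra.
Qed.

End calculus.

(** * Integrals over the half-line, Fubini's theorem and Gamma integrands *)

Section halfline.
Context {R : realType}.
Implicit Types (f g F : R -> R) (x t a b c l T : R).
Local Notation mu := (@lebesgue_measure R).
Local Notation lintegrable f t := (mu.-integrable `]0, t[ (EFin \o f)).
Local Notation hl := (`]0, +oo[%classic : set R).

(** The tool for superpositions: if every [x] contributes a nonnegative integral over [D2], so does
    the mixture over [x]. The majorant [g] of the inner norms makes [k] integrable on the
    product. *)
Lemma Fubini_ge0 (D1 D2 : set R) (k : R -> R -> R) (g : R -> R) : measurable D1 -> measurable D2 ->
  measurable_fun setT (fun z : measurableTypeR R * measurableTypeR R => k z.1 z.2) ->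
  (forall y, D2 y -> mu.-integrable D1 (EFin \o k ^~ y)) ->
  (forall y, D2 y -> \int[mu]_(x in D1) `|k x y| <= g y) ->
  mu.-integrable D2 (EFin \o g) ->
  (forall x, D1 x -> mu.-integrable D2 (EFin \o k x)) ->
  (forall x, D1 x -> 0 <= \int[mu]_(y in D2) k x y) ->
  0 <= \int[mu]_(y in D2) \int[mu]_(x in D1) k x y.
Proof.
move=> mD1 mD2 mk ik1 kg ig ik2 k0.
(* The indicators move both domains into the integrand, so that Fubini's theorem is applied on the
   whole plane. *)
pose F (z : measurableTypeR R * measurableTypeR R) := (k z.1 z.2 * \1_D1 z.1 * \1_D2 z.2)%:E.
have mF : measurable_fun setT F.
  apply/measurable_EFinP; apply: measurable_funM; first apply: measurable_funM => //.
    by apply: (@measurableT_comp _ _ _ _ _ _ (\1_D1 : R -> R)) => //; exact: measurable_indic.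
  by apply: (@measurableT_comp _ _ _ _ _ _ (\1_D2 : R -> R)) => //; exact: measurable_indic.
have iF : (mu \x mu)%E.-integrable setT F.
  apply/integrable21ltyP => //.
  apply: (@le_lt_trans _ _ (\int[mu]_(y in D2) `|(g y)%:E|)%E); last by move/integrableP : ig => [].
  rewrite [leRHS]integral_mkcond; apply: ge0_le_integral => //.
  - by move=> y _; exact: integral_ge0.
  - apply: (@measurable_fun_fubini_tonelli_G _ _ _ _ _ mu (abse \o F)) => //.
    exact: measurableT_comp.
  - by move=> z; exact: abse_ge0.
  - apply/(measurable_restrictT _ _).1 => //; apply: measurableT_comp => //.
    exact: (measurable_int mu ig).
  move=> y _; rewrite /F patchE; case: ifPn => [yD2|yD2].
    apply: (@le_trans _ _ (\int[mu]_(x in D1) `|k x y|%:E)%E).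
      rewrite [leRHS]integral_mkcond le_eqVlt; apply/orP; left; apply/eqP.
      apply: eq_integral => x _; rewrite patchE !indicE/= yD2 mulr1.
      by case: ifP => _; rewrite ?mulr1 ?mulr0 ?normr0.
    rewrite -(@fineK _ (\int[mu]_(x in D1) `|k x y|%:E)%E); last first.
      apply: integrable_fin_num => //; apply: integrable_norm => //; apply: ik1; exact: set_mem.
    rewrite lee_fin; apply: le_trans (ler_norm _); apply: kg; exact: set_mem.
  rewrite integral0_eq// => x _; rewrite !indicE/= (negbTE yD2) mulr0 normr0//.
have inner1 y : D2 y -> (\int[mu]_x F (x, y))%E = (\int[mu]_(x in D1) k x y)%:E.
  move=> yD2; rewrite /Rintegral fineK; last by apply: integrable_fin_num => //; exact: ik1.
  rewrite [RHS]integral_mkcond; apply: eq_integral => x _; rewrite patchE /F !indicE/= (mem_set yD2) mulr1.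
  by case: ifP => _; rewrite ?mulr1 ?mulr0.
have inner2 x : D1 x -> (\int[mu]_y F (x, y))%E = (\int[mu]_(y in D2) k x y)%:E.
  move=> xD; rewrite /Rintegral fineK; last by apply: integrable_fin_num => //; exact: ik2.
  rewrite [RHS]integral_mkcond; apply: eq_integral => y _; rewrite patchE /F !indicE/= (mem_set xD) mulr1.
  by case: ifP => _; rewrite ?mulr1 ?mulr0.
have -> : \int[mu]_(y in D2) \int[mu]_(x in D1) k x y = fine (\int[mu]_y \int[mu]_x F (x, y))%E.
  rewrite /Rintegral; congr fine; rewrite [LHS]integral_mkcond; apply: eq_integral => y _.
  rewrite patchE; case: ifPn => [/set_mem yD|yD]; first by rewrite inner1.
  by rewrite integral0_eq// => x _; rewrite /F !indicE/= (negbTE yD) mulr0.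
rewrite -Fubini// fine_ge0//; apply: integral_ge0 => x _.
have [xD|xD] := boolP (x \in D1).
  by rewrite inner2 ?lee_fin ?k0//; exact: set_mem.
by rewrite integral0_eq// => y _; rewrite /F !indicE/= (negbTE xD) mulr0 mul0r.
Qed.

Lemma integrable_hl_lint f T : mu.-integrable hl (EFin \o f) -> lintegrable f T.
Proof.
move=> h; apply: (@integrableS _ _ _ mu _ _ _ (measurable_itv _) (measurable_itv _) _ h).
by move=> x /=; rewrite !in_itv/= andbT => /andP[].
Qed.

Lemma hl_bigcup : hl = \bigcup_n [set` `]0, n%:R[] :> set R.
Proof.
apply/seteqP; split => x /=; rewrite ?in_itv/= ?andbT.
  move=> x0; exists (Num.truncn x).+1 => //=; rewrite in_itv/= x0/=; exact: truncnS_gt.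
by move=> [n _]; rewrite /= in_itv/= => /andP[].
Qed.

Lemma hl_integral_cvg f : mu.-integrable hl (EFin \o f) ->
  \int[mu]_(s in `]0, n%:R[) f s @[n --> \oo] --> \int[mu]_(s in hl) f s.
Proof.
move=> fi; rewrite /Rintegral; apply: fine_cvg; rewrite fineK; last exact: integrable_fin_num.
rewrite integral_mkcond; under eq_fun do rewrite integral_mkcond.
have mf := measurable_int mu fi.
apply: (@dominated_cvg _ _ _ mu setT measurableT _ _ (fun x => `|(EFin \o f) \_ hl x|%E)) => //.
- move=> n; apply/(measurable_restrictT _ _).1 => //.
  by apply: measurable_funS mf => // x /=; rewrite !in_itv/= andbT => /andP[].
- move=> x _; apply: cvg_near_cst; near=> n.
  rewrite !patchE !mem_setE !in_itv/= andbT.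
  case: ltP => //= x0; rewrite ifT//.
  near: n; exact: nbhs_infty_gtr.
- by move=> x _; rewrite patchE; case: ifP.
- by apply: integrable_abse; apply/(integrable_mkcond _ _).1.
- move=> n x _; rewrite !patchE !mem_setE !in_itv/= andbT.
  by case: ltP => //= x0; case: ltP => //= _; rewrite normr0 lee_fin.
Unshelve. all: by end_near. Qed.

Lemma FTC_hl f F l : cpos f -> czero F -> (forall t, 0 < t -> is_derive t 1 F (f t)) ->
  mu.-integrable hl (EFin \o f) -> F x @[x --> +oo] --> l ->
  \int[mu]_(s in hl) f s = l - F 0.
Proof.
move=> fc cF dF fi Fl.
have h1 := hl_integral_cvg fi.
have h2 : \int[mu]_(s in `]0, n%:R[) f s @[n --> \oo] --> l - F 0.
  apply: (@cvg_trans _ ((F n%:R - F 0) @[n --> \oo])).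
    apply: near_eq_cvg; near=> n.
    rewrite (FTC_eq (F := F))//; first by rewrite ltr0n; near: n; exact: nbhs_infty_gt.
    by move=> t; exact: integrable_hl_lint.
  apply: cvgB; last exact: cvg_cst.
  exact: (cvg_comp _ _ (@cvgr_idn R) Fl).
exact: cvg_unique h1 h2.
Unshelve. all: by end_near. Qed.

Lemma ge0_hl_integrable f C : cpos f -> (forall t, 0 < t -> 0 <= f t) ->
  (forall t, 0 < t -> lintegrable f t) -> (forall t, 0 < t -> \int[mu]_(s in `]0, t[) f s <= C) ->
  mu.-integrable hl (EFin \o f).
Proof.
move=> fc f0 lf fC; apply/integrableP; split; first by apply/measurable_EFinP; exact: cpos_measurable.
apply: (@le_lt_trans _ _ C%:E); last exact: ltry.
have -> : (\int[mu]_(x in hl) `|(EFin \o f) x| = \int[mu]_(x in \bigcup_n [set` `]0%R, n%:R[]) (f x)%:E)%E.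
  rewrite -hl_bigcup; apply: eq_integral => x; rewrite inE/= in_itv/= andbT => x0.
  by rewrite ger0_norm// f0.
have cv : (\int[mu]_(x in [set` `]0%R, n%:R[]) (f x)%:E @[n --> \oo] -->
   \int[mu]_(x in \bigcup_n [set` `]0%R, n%:R[]) (f x)%:E)%E.
  apply: ge0_nondecreasing_set_cvg_integral => //.
  - apply/nondecreasing_seqP => n; apply/subsetPset => x /=; rewrite !in_itv/=.
    by move=> /andP[-> /= xn]; rewrite (lt_le_trans xn)// ler_nat.
  - by move=> n; apply/measurable_EFinP; exact: cpos_measurable_itv.
  - by move=> n x /=; rewrite in_itv/= lee_fin => /andP[x0 _]; exact: f0.
rewrite -(cvg_lim _ cv)//; apply: lime_le; first by apply/cvg_ex; eexists; exact: cv.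
near=> n; have n0 : 0 < n%:R :> R by rewrite ltr0n; near: n; exact: nbhs_infty_gt.
rewrite -[X in (X <= _)%E]fineK; first by rewrite lee_fin; exact: fC.
by apply: integrable_fin_num => //; exact: lf.
Unshelve. all: by end_near. Qed.

Lemma expN_cvg0 (e : R) : 0 < e -> expR (- (e * x)) @[x --> +oo] --> (0 : R).
Proof.
move=> e0; apply: (cvg_comp (fun x => e * x) (fun y => expR (- y)) _ (@cvgr_expR R)).
exact: gt0_cvgMry.
Qed.

Lemma isd_expN (e t : R) : is_derive t 1 (fun x => expR (- (e * x))) (- e * expR (- (e * t))).
Proof.
apply: isd_eq (isd_exp (isd_N (isd_Z e (isd_id t)))) _.
by rewrite mulr1 mulrC.
Qed.

Lemma expN_integrable (e : R) : 0 < e -> mu.-integrable hl (EFin \o (fun x => expR (- (e * x)))).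
Proof.
move=> e0.
have dF t : 0 < t -> is_derive t 1 (fun x => - e^-1 * expR (- (e * x))) (expR (- (e * t))).
  move=> _; apply: isd_eq (isd_Z _ (isd_expN e t)) _; by rewrite mulrA mulrNN mulVf ?mul1r// gt_eqF.
have fc : cpos (fun x => expR (- (e * x))) by move=> t _; apply: isd_cont (isd_expN e t).
have lf T : lintegrable (fun x => expR (- (e * x))) T.
  apply: czero_lintegrable; split => //.
  by apply: cvg_at_right_filter; exact: isd_cont (isd_expN e 0).
apply: (ge0_hl_integrable (C := e^-1)) => //.
- move=> t t0; rewrite (FTC_eq (F := fun x => - e^-1 * expR (- (e * x))))//; last first.
    split; first by move=> u u0; exact: isd_cont (dF u u0).
    by apply: cvg_at_right_filter; apply: isd_cont (isd_Z _ (isd_expN e 0)).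
  rewrite mulr0 oppr0 expR0 mulr1 opprK mulNr gerDr oppr_le0 mulr_ge0 ?expR_ge0//.
  by rewrite invr_ge0 ltW.
Qed.

(** Below 1 the exponential is dropped. Above 1 the condition p <= 2 gives x^(p-1) <= x, and x <=
    (2/e) exp(ex/2) costs half of the decay rate. *)
Lemma gamma_bound (e p x : R) : 0 < e -> 0 < p <= 2 -> 0 < x ->
  x `^ (p - 1) * expR (- (e * x)) <= x `^ (p - 1) * \1_(`]0, 1[%classic : set R) x + 2 / e * expR (- (e / 2 * x)).
Proof.
move=> e0 /andP[p0 p2] x0; rewrite indicE mem_setE in_itv/= x0/=.
have [x1|x1] := ltP x 1.
  rewrite mulr1 (@le_trans _ _ (x `^ (p - 1)))//.
    by rewrite ler_piMr ?powR_ge0// expR_le1 oppr_le0 mulr_ge0// ltW.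
  by rewrite lerDl mulr_ge0 ?expR_ge0// divr_ge0// ltW.
rewrite mulr0 add0r.
have xp : x `^ (p - 1) <= x.
  apply: le_trans (ler_powR x1 (_ : p - 1 <= 1)) _; first by lra.
  by rewrite powRr1// ltW.
apply: (@le_trans _ _ (x * expR (- (e * x)))); first by rewrite ler_wpM2r ?expR_ge0.
have xe : x <= 2 / e * expR (e / 2 * x).
  rewrite -ler_pdivrMl ?divr_gt0// invf_div; apply: le_trans (expR_ge1Dx _); lra.
apply: (@le_trans _ _ (2 / e * expR (e / 2 * x) * expR (- (e * x)))).
  by rewrite ler_wpM2r ?expR_ge0.
by rewrite -mulrA -expRD; rewrite (_ : e / 2 * x + - (e * x) = - (e / 2 * x))//; field.
Qed.

Lemma gamma_integrable (e p : R) : 0 < e -> 0 < p <= 2 ->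
  mu.-integrable hl (EFin \o (fun x => x `^ (p - 1) * expR (- (e * x)))).
Proof.
move=> e0 p02; have /andP[p0 p2] := p02.
apply: (@le_integrable _ _ _ mu hl _ _ (fun x => (x `^ (p - 1) * \1_(`]0%R, 1%R[%classic : set R) x)%:E + (2 / e)%:E * (expR (- (e / 2 * x)))%:E)%E) => //.
- apply/measurable_EFinP; apply: cpos_measurable => t t0.
  by apply: isd_cont; apply: isd_M (isd_powR _ t0) (isd_expN e t).
- move=> x /=; rewrite in_itv/= andbT => x0.
  have h1 : 0 <= x `^ (p - 1) * expR (- (e * x)) by rewrite mulr_ge0 ?powR_ge0 ?expR_ge0.
  by rewrite /= lee_fin ger0_norm// (le_trans (gamma_bound e0 p02 x0))// ler_norm.
- apply: integrableD => //; last by apply: integrableZl => //; apply: expN_integrable; rewrite divr_gt0.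
  apply: (@eq_integrable _ _ _ mu hl _ ((EFin \o (fun x => x `^ (p - 1))) \_ `]0, 1[)) => //.
    move=> x _; rewrite patchE indicE; case: ifP => _; by rewrite /= ?mulr1 ?mulr0.
  apply: (@integrableS _ _ _ mu setT) => //.
  apply/(integrable_mkcond _ _).1 => //; exact: lintegrable_powR.
Qed.

Lemma gamma_cvg0 (e p : R) : 0 < e -> 0 < p <= 2 ->
  x `^ (p - 1) * expR (- (e * x)) @[x --> +oo] --> (0 : R).
Proof.
move=> e0 p02.
apply: (@squeeze_cvgr _ _ _ _ (fun=> 0) (fun x => 2 / e * expR (- (e / 2 * x)))).
- near=> x; rewrite mulr_ge0 ?powR_ge0 ?expR_ge0//=.
  have x1 : 1 < x by near: x; exact: nbhs_pinfty_gt.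
  apply: le_trans (gamma_bound e0 p02 _) _; first lra.
  rewrite indicE mem_setE in_itv/= [x < 1]ltNge (ltW x1)/= andbF mulr0 add0r//.
- exact: cvg_cst.
- rewrite -[X in _ --> X](mulr0 (2 / e)); apply: cvgMr; apply: expN_cvg0; rewrite divr_gt0//.
Unshelve. all: by end_near. Qed.

End halfline.

(** * The Laplace representation of the kernel t^(b-1) *)

Section kernel.
Context {R : realType}.
Implicit Types (f g F : R -> R) (x t a c l T : R).
Local Notation mu := (@lebesgue_measure R).
Local Notation lintegrable f t := (mu.-integrable `]0, t[ (EFin \o f)).
Local Notation hl := (`]0, +oo[%classic : set R).

Section trig.
Variables (th e : R).
(* gw and gv are the Gamma integrands of exponents th and th + 1 at rate e;
   kcos - i ksin is the Laplace transform of x^(th-1) at e + it. *)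
Definition gw x := x `^ (th - 1) * expR (- (e * x)).
Definition gv x := x `^ (th + 1 - 1) * expR (- (e * x)).
Definition kcos t := \int[mu]_(x in hl) (gw x * cos (x * t)).
Definition ksin t := \int[mu]_(x in hl) (gw x * sin (x * t)).
Definition vcos t := \int[mu]_(x in hl) (gv x * cos (x * t)).
Definition vsin t := \int[mu]_(x in hl) (gv x * sin (x * t)).

Hypotheses (th0 : 0 < th) (th1 : th < 1) (e0 : 0 < e).

Lemma gw_integrable : mu.-integrable hl (EFin \o gw).
Proof. have h : 0 < th <= 2 by move: th0 th1; lra. exact: gamma_integrable e0 h. Qed.

Lemma gv_integrable : mu.-integrable hl (EFin \o gv).
Proof. have h : 0 < th + 1 <= 2 by move: th0 th1; lra. exact: gamma_integrable e0 h. Qed.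

Lemma cpos_gw : cpos gw.
Proof. by move=> t t0; apply: isd_cont (isd_M (isd_powR _ t0) (isd_expN e t)). Qed.

Lemma cpos_gv : cpos gv.
Proof. by move=> t t0; apply: isd_cont (isd_M (isd_powR _ t0) (isd_expN e t)). Qed.

Lemma gw_ge0 x : 0 <= gw x. Proof. by rewrite mulr_ge0 ?powR_ge0 ?expR_ge0. Qed.
Lemma gv_ge0 x : 0 <= gv x. Proof. by rewrite mulr_ge0 ?powR_ge0 ?expR_ge0. Qed.

Lemma integrable_osc (w o : R -> R) : mu.-integrable hl (EFin \o w) -> cpos o ->
  (forall x, `|o x| <= 1) -> mu.-integrable hl (EFin \o (fun x => w x * o x)).
Proof.
move=> wi oc o1; apply: (@le_integrable _ _ _ mu hl _ _ (EFin \o w)) => //.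
  apply/measurable_EFinP; apply: measurable_funM; last exact: cpos_measurable.
  by apply/measurable_EFinP; exact: (measurable_int mu wi).
by move=> x _; rewrite /= lee_fin normrM ler_piMr.
Qed.

Lemma norm_cos_le1 x : `|cos x| <= 1.
Proof. by rewrite ler_norml cos_geN1 cos_le1. Qed.

Lemma norm_sin_le1 x : `|sin x| <= 1.
Proof. by rewrite ler_norml sin_geN1 sin_le1. Qed.

Lemma isd_cosl x t : is_derive x 1 (fun x => cos (x * t)) (- t * sin (x * t)).
Proof. by apply: isd_eq (isd_cos (isd_M (isd_id x) (isd_cst x t))) _; ring. Qed.

Lemma isd_sinl x t : is_derive x 1 (fun x => sin (x * t)) (t * cos (x * t)).
Proof. by apply: isd_eq (isd_sin (isd_M (isd_id x) (isd_cst x t))) _; ring. Qed.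

Lemma isd_cosr x t : is_derive t 1 (fun t => cos (x * t)) (- x * sin (x * t)).
Proof. by apply: isd_eq (isd_cos (isd_Z x (isd_id t))) _; ring. Qed.

Lemma isd_sinr x t : is_derive t 1 (fun t => sin (x * t)) (x * cos (x * t)).
Proof. by apply: isd_eq (isd_sin (isd_Z x (isd_id t))) _; ring. Qed.

Lemma cpos_cosl t : cpos (fun x => cos (x * t)).
Proof. by move=> x _; exact: isd_cont (isd_cosl x t). Qed.
Lemma cpos_sinl t : cpos (fun x => sin (x * t)).
Proof. by move=> x _; exact: isd_cont (isd_sinl x t). Qed.

Lemma gvE x : 0 < x -> gv x = x * gw x.
Proof.
move=> x0; rewrite /gv /gw mulrA; congr (_ * _).
by rewrite addrK mulr_powRB1// ltW.
Qed.

(** Differentiation in [t] brings out a factor [x], and [x * gw x = gv x] is an integrable majorant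
    that does not depend on [t]. *)
Lemma isd_under (o o' : R -> R -> R) t :
  (forall x t, is_derive t 1 (o ^~ x) (x * o' t x)) ->
  (forall t, cpos (o t)) -> (forall t, cpos (o' t)) ->
  (forall t x, `|o t x| <= 1) -> (forall t x, `|o' t x| <= 1) ->
  is_derive t 1 (fun t => \int[mu]_(x in hl) (gw x * o t x)) (\int[mu]_(x in hl) (gv x * o' t x)).
Proof.
move=> do_ oc oc' o1 o1'.
pose f (t x : R) := gw x * o t x.
have df (u x : R) : is_derive u 1 (f ^~ x) (gw x * (x * o' u x)) by apply: isd_Z.
have It : (`]t - 1, t + 1[%classic : set R) t by rewrite /= in_itv/=; lra.
have intf u : (`]t - 1, t + 1[%classic : set R) u -> mu.-integrable hl (EFin \o f u).
  by move=> _; apply: integrable_osc => //; exact: gw_integrable.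
have derf u x : (`]t - 1, t + 1[%classic : set R) u -> hl x -> derivable (f ^~ x) u 1.
  by move=> _ _; exact: isd_derivable (df u x).
have G_ub u x : (`]t - 1, t + 1[%classic : set R) u -> hl x -> `|partial1of2 f u x| <= gv x.
  move=> _; rewrite /= in_itv/= andbT => x0; rewrite /partial1of2 (isd_derive1 (df u x)).
  by rewrite mulrA [gw x * x]mulrC -gvE// normrM ger0_norm ?gv_ge0// ler_piMr// gv_ge0.
have D := @derivable_under_integral R _ _ mu f hl (measurable_itv _) t _ _ It intf derf gv gv_ge0 gv_integrable G_ub.
have E := @differentiation_under_integral R _ _ mu f hl (measurable_itv _) t _ _ It intf derf gv gv_ge0 gv_integrable G_ub.
apply: isd_eq (derivable_isd D) _; rewrite E; apply: eq_Rintegral => x; rewrite inE/= in_itv/= andbT => x0.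
by rewrite /partial1of2 (isd_derive1 (df t x)) mulrA [gw x * x]mulrC -gvE.
Qed.

Lemma isd_kcos t : is_derive t 1 kcos (- vsin t).
Proof.
have := @isd_under (fun t x => cos (x * t)) (fun t x => - sin (x * t)) t.
move=> /(_ _ _ _ _ _)/isd_eq; apply.
- by move=> x u; apply: isd_eq (isd_cosr x u) _; ring.
- exact: cpos_cosl.
- by move=> u x x0; apply: isd_cont (isd_N (isd_sinl x u)).
- by move=> u x; exact: norm_cos_le1.
- by move=> u x; rewrite normrN; exact: norm_sin_le1.
rewrite /vsin -mulN1r -RintegralZl//.
  by apply: eq_Rintegral => x _; ring.
apply: integrable_osc gv_integrable _ _; first exact: cpos_sinl.
by move=> x; exact: norm_sin_le1.
Qed.

Lemma isd_ksin t : is_derive t 1 ksin (vcos t).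
Proof.
apply: (@isd_under (fun t x => sin (x * t)) (fun t x => cos (x * t)) t).
- by move=> x u; exact: isd_sinr.
- exact: cpos_sinl.
- exact: cpos_cosl.
- by move=> u x; exact: norm_sin_le1.
- by move=> u x; exact: norm_cos_le1.
Qed.

Definition gP x := x `^ th * expR (- (e * x)).
Lemma isd_gP x : 0 < x -> is_derive x 1 gP (th * gw x - e * gv x).
Proof.
move=> x0; apply: isd_eq (isd_M (isd_powR th x0) (isd_expN e x)) _.
by rewrite /gw /gv addrK; ring.
Qed.

(** The left-hand side is the integral of the derivative of [gP x * o x], and [gP] vanishes at 0 and
    at infinity. *)
Lemma boundary_term (o o' : R -> R) t : (forall x, is_derive x 1 o (t * o' x)) ->
  (forall x, `|o x| <= 1) -> (forall x, `|o' x| <= 1) -> cpos o' ->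
  th * \int[mu]_(x in hl) (gw x * o x) - e * \int[mu]_(x in hl) (gv x * o x)
  + t * \int[mu]_(x in hl) (gv x * o' x) = 0.
Proof.
move=> do_ o1 o1' oc'.
have oc : cpos o by move=> x _; exact: isd_cont (do_ x).
have i1 := integrable_osc gw_integrable oc o1.
have i2 := integrable_osc gv_integrable oc o1.
have i3 := integrable_osc gv_integrable oc' o1'.
pose f x := th * (gw x * o x) - e * (gv x * o x) + t * (gv x * o' x).
have dF x : 0 < x -> is_derive x 1 (fun x => gP x * o x) (f x).
  move=> x0; apply: isd_eq (isd_M (isd_gP x0) (do_ x)) _.
  by rewrite /f /gP /gv addrK; ring.
have fc : cpos f.
  move=> x x0; apply: continuousD; first apply: continuousB.
  - by apply: continuousM; [exact: cst_continuous|apply: continuousM; [exact: cpos_gw|exact: oc]].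
  - by apply: continuousM; [exact: cst_continuous|apply: continuousM; [exact: cpos_gv|exact: oc]].
  - by apply: continuousM; [exact: cst_continuous|apply: continuousM; [exact: cpos_gv|exact: oc']].
have fi : mu.-integrable hl (EFin \o f).
  by apply: integrable_D => //; [apply: integrable_B => //|]; exact: integrable_Z.
have P0 : gP 0 * o 0 = 0 by rewrite /gP powR0 ?mul0r ?mul0r// gt_eqF.
have bound x : 0 <= x -> `|gP x * o x| <= gP x.
  move=> x0; have Pge : 0 <= gP x by rewrite mulr_ge0 ?powR_ge0 ?expR_ge0.
  by rewrite normrM ger0_norm// ler_piMr.
have E : \int[mu]_(s in hl) f s = 0 - gP 0 * o 0.
  apply: FTC_hl => //.
  - split; first by move=> x x0; exact: isd_cont (dF x x0).
    rewrite P0.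
    apply/norm_cvg0P; apply: (@squeeze_cvgr _ _ _ _ (fun=> 0) (fun x => x `^ th)).
    + near=> x.
      have x0 : 0 <= x by near: x; exact: nbhs_right_ge.
      rewrite normr_ge0/=; apply: le_trans (bound x x0) _.
      by rewrite ler_piMr ?powR_ge0// expR_le1 oppr_le0 mulr_ge0// ?(ltW e0).
    + exact: cvg_cst.
    + exact: powR_cvg0.
  - apply/norm_cvg0P; apply: (@squeeze_cvgr _ _ _ _ (fun=> 0) gP).
    + near=> x; rewrite normr_ge0/=; apply: bound.
      by near: x; exact: nbhs_pinfty_ge.
    + exact: cvg_cst.
    + have := @gamma_cvg0 R e (th + 1) e0; rewrite addrK; apply; move: th0 th1; lra.
apply: (@etrans _ _ (\int[mu]_(s in hl) f s)); last by rewrite E P0 subrr.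
rewrite /f RintegralD//; last 2 first.
- by apply: integrable_B => //; exact: integrable_Z.
- exact: integrable_Z.
by rewrite RintegralB ?RintegralZl//; exact: integrable_Z.
Unshelve. all: by end_near. Qed.

Lemma kernel_ode1 t : th * ksin t - e * vsin t + t * vcos t = 0.
Proof.
apply: boundary_term.
- by move=> x; exact: isd_sinl.
- by move=> x; exact: norm_sin_le1.
- by move=> x; exact: norm_cos_le1.
- exact: cpos_cosl.
Qed.

Lemma kernel_ode2 t : th * kcos t - e * vcos t - t * vsin t = 0.
Proof.
have := @boundary_term (fun x => cos (x * t)) (fun x => - sin (x * t)) t.
have -> : \int[mu]_(x in hl) (gv x * - sin (x * t)) = - vsin t.
  rewrite /vsin -mulN1r -RintegralZl//.
    by apply: eq_Rintegral => x _; ring.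
  apply: integrable_osc gv_integrable _ _; first exact: cpos_sinl.
  by move=> x; exact: norm_sin_le1.
rewrite mulrN; apply.
- by move=> x; apply: isd_eq (isd_cosl x t) _; ring.
- by move=> x; exact: norm_cos_le1.
- by move=> x; rewrite normrN; exact: norm_sin_le1.
- by move=> x x0; apply: isd_cont (isd_N (isd_sinl x t)).
Qed.


Let A t := atan (t / e).
Let rr t := (t ^+ 2 + e ^+ 2) `^ (th / 2).

(* Integration by parts gives a linear first-order system for (kcos, ksin);
   in the frame rotating at angle th * atan (t / e) its solution is constant
   up to the factor (t^2 + e^2)^(-th/2). *)
Lemma kernel_phase t :
  ksin t * cos (th * A t) - kcos t * sin (th * A t) = 0 /\
  (kcos t * cos (th * A t) + ksin t * sin (th * A t)) * rr t = kcos 0 * rr 0.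
Proof.
have q0 u : 0 < u ^+ 2 + e ^+ 2 by rewrite ltr_wpDl ?sqr_ge0// exprn_gt0.
have dA (u : R) : is_derive u 1 A (e / (u ^+ 2 + e ^+ 2)).
  apply: isd_eq (isd_comp (is_derive1_atan _) (isd_M (isd_id u) (isd_cst u e^-1))) _.
  have := q0 u; have : e != 0 by rewrite gt_eqF.
  move=> ne qu; have : u ^+ 2 + e ^+ 2 != 0 by rewrite gt_eqF.
  have : 1 + (u / e) ^+ 2 != 0 by rewrite gt_eqF// ltr_pwDl// sqr_ge0.
  by move=> n1 n2; field; rewrite ne n2.
have dr (u : R) : is_derive u 1 rr (th * u / (u ^+ 2 + e ^+ 2) * rr u).
  have dq : is_derive u 1 (fun y => y ^+ 2 + e ^+ 2) (2 * u).
    apply: isd_eq (isd_D (isd_M (isd_id u) (isd_id u)) (isd_cst u (e ^+ 2))) _; ring.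
  apply: isd_eq (@isd_powRc _ u (fun y => y ^+ 2 + e ^+ 2) _ (th / 2) (q0 u) dq) _.
  rewrite /rr -(mulr_powRB1 (p := th / 2) (ltW (q0 u))) ?divr_gt0//.
  by field; rewrite gt_eqF.
have dc (u : R) : is_derive u 1 (fun t => cos (th * A t)) (- sin (th * A u) * (th * (e / (u ^+ 2 + e ^+ 2)))).
  exact: isd_cos (isd_Z th (dA u)).
have ds (u : R) : is_derive u 1 (fun t => sin (th * A t)) (cos (th * A u) * (th * (e / (u ^+ 2 + e ^+ 2)))).
  exact: isd_sin (isd_Z th (dA u)).
(* The two identities from integration by parts form a linear system in [vsin] and [vcos], with
   determinant u^2 + e^2. *)
have Evs u : vsin u = th * (e * ksin u + u * kcos u) / (u ^+ 2 + e ^+ 2).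
  have n2 : u ^+ 2 + e ^+ 2 != 0 by rewrite gt_eqF.
  apply: (mulIf n2); rewrite mulfVK//.
  apply/eqP; rewrite -subr_eq0; apply/eqP.
  transitivity (- e * (th * ksin u - e * vsin u + u * vcos u)
     - u * (th * kcos u - e * vcos u - u * vsin u)); first by ring.
  by rewrite kernel_ode1 kernel_ode2; ring.
have Evc u : vcos u = th * (e * kcos u - u * ksin u) / (u ^+ 2 + e ^+ 2).
  have n2 : u ^+ 2 + e ^+ 2 != 0 by rewrite gt_eqF.
  apply: (mulIf n2); rewrite mulfVK//.
  apply/eqP; rewrite -subr_eq0; apply/eqP.
  transitivity (u * (th * ksin u - e * vsin u + u * vcos u)
     - e * (th * kcos u - e * vcos u - u * vsin u)); first by ring.
  by rewrite kernel_ode1 kernel_ode2; ring.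
(* [q + i m] is (kcos + i ksin) e^(-i th A) rr: the rotation and the modulus factor are undone, and
   the result has derivative 0. *)
pose m u := (ksin u * cos (th * A u) - kcos u * sin (th * A u)) * rr u.
pose q u := (kcos u * cos (th * A u) + ksin u * sin (th * A u)) * rr u.
have dm (u : R) : is_derive u 1 m 0.
  apply: isd_eq (isd_M (isd_B (isd_M (isd_ksin u) (dc u)) (isd_M (isd_kcos u) (ds u))) (dr u)) _.
  by rewrite Evs Evc; field; rewrite gt_eqF.
have dq (u : R) : is_derive u 1 q 0.
  apply: isd_eq (isd_M (isd_D (isd_M (isd_kcos u) (dc u)) (isd_M (isd_ksin u) (ds u))) (dr u)) _.
  by rewrite Evs Evc; field; rewrite gt_eqF.
have A0 : A 0 = 0 by rewrite /A mul0r atan0.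
have s0 : ksin 0 = 0.
  rewrite /ksin; under eq_Rintegral do rewrite mulr0 sin0 mulr0.
  by rewrite Rintegral_cst// mul0r.
have r0 : rr t != 0 by rewrite gt_eqF// powR_gt0.
split.
  have := is_derive_0_is_cst t 0 dm; rewrite /m A0 mulr0 sin0 s0 mul0r mulr0 subrr mul0r.
  by move/eqP; rewrite mulf_eq0 (negbTE r0) orbF => /eqP.
have := is_derive_0_is_cst t 0 dq; rewrite /q A0 mulr0 sin0 cos0 s0 mulr1 mulr0 addr0//.
Qed.

Lemma kcos0_gt0 : 0 < kcos 0.
Proof.
rewrite /kcos; under eq_Rintegral do rewrite mulr0 cos0 mulr1.
apply: (@Rintegral_gt0 _ _ _ 1 2) => //.
- exact: gw_integrable.
- by move=> x _; exact: gw_ge0.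
- by move=> x /=; rewrite !in_itv/=; lra.
- lra.
- by apply: cpos_within => //; exact: cpos_gw.
- by move=> x x12; rewrite mulr_gt0 ?expR_gt0// powR_gt0; lra.
Qed.

(** This is the formula for the Laplace transform of x^(th-1) at e - it, namely Gamma(th) (e -
    it)^(-th), written in polar form; [N] is Gamma(th). *)
Lemma kernel_polar : exists2 N, 0 < N & forall t,
  kcos t = N * ((t ^+ 2 + e ^+ 2) `^ (- (th / 2)) * cos (th * atan (t / e))) /\
  ksin t = N * ((t ^+ 2 + e ^+ 2) `^ (- (th / 2)) * sin (th * atan (t / e))).
Proof.
have q0 u : 0 < u ^+ 2 + e ^+ 2 by rewrite ltr_wpDl ?sqr_ge0// exprn_gt0.
have r0 u : 0 < rr u by rewrite powR_gt0.
exists (kcos 0 * rr 0) => [|t]; first by rewrite mulr_gt0 ?kcos0_gt0.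
have [h1 h2] := kernel_phase t; rewrite -h2 powRN -/(rr t) -/(A t).
have := cos2Dsin2 (th * A t); set c := cos _ in h1 h2 *; set s := sin _ in h1 h2 * => cs.
have n0 : rr t != 0 by rewrite gt_eqF.
split; rewrite -mulrA mulVKf//.
- transitivity (kcos t * (c ^+ 2 + s ^+ 2) + s * (ksin t * c - kcos t * s)); last by ring.
  by rewrite h1 cs; ring.
- transitivity (ksin t * (c ^+ 2 + s ^+ 2) - c * (ksin t * c - kcos t * s)); last by ring.
  by rewrite h1 cs; ring.
Qed.

End trig.

Lemma Rdominated_cvg (D : set R) (f_ : nat -> R -> R) f g : measurable D ->
  (forall n, measurable_fun D (f_ n)) -> measurable_fun D f ->
  (forall x, D x -> f_ n x @[n --> \oo] --> f x) ->
  mu.-integrable D (EFin \o g) -> (forall n x, D x -> `|f_ n x| <= g x) ->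
  \int[mu]_(x in D) f_ n x @[n --> \oo] --> \int[mu]_(x in D) f x.
Proof.
move=> mD mf_ mf cf gi fg.
have h1 : {ae mu, forall x, D x -> (f_ n x)%:E @[n --> \oo] --> (f x)%:E}.
  by apply: aeW => x Dx; apply: cvg_EFin (cf x Dx); exact: nearW.
have h2 : {ae mu, forall x n, D x -> (`|(f_ n x)%:E| <= (g x)%:E)%E}.
  by apply: aeW => x n Dx; rewrite lee_fin; exact: fg.
have [fi _ cv] := @dominated_convergence _ _ _ mu D mD (fun n => EFin \o f_ n) (EFin \o f) (EFin \o g)
  (fun n => (measurable_EFinP _ _).2 (mf_ n)) ((measurable_EFinP _ _).2 mf) h1 gi h2.
apply: fine_cvg; rewrite fineK//; exact: integrable_fin_num fi.
Qed.

Section sector.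
Variables (b T C : R) (U V : R -> R).
Hypotheses (b0 : 0 < b) (b1 : b < 1) (T0 : 0 < T).
Hypotheses (mU : measurable_fun setT U) (mV : measurable_fun setT V).
Hypotheses (UC : forall x, `|U x| <= C) (VC : forall x, `|V x| <= C).
Let cb := cos (b * pi / 2).
Let sb := sin (b * pi / 2).
Hypothesis pos : forall x, 0 < x ->
  0 <= \int[mu]_(t in `]0, T[) (cb * (cos (x * t) * U t) + sb * (sin (x * t) * V t)).

Lemma bounded_lintegrable f (K S : R) : measurable_fun `]0, S[ f -> (forall x, 0 < x < S -> `|f x| <= K) ->
  lintegrable f S.
Proof.
move=> mf fK; apply: (@le_integrable _ _ _ mu `]0, S[ _ _ (EFin \o cst K)) => //.
- exact/measurable_EFinP.
- by move=> x /=; rewrite in_itv/= lee_fin => /fK h; rewrite (le_trans h)// ler_norm.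
- apply: czero_lintegrable; split; first by move=> t _; exact: cst_continuous.
  exact: cvg_cst.
Qed.

Lemma osc_lintegrable (o W : R -> R) : measurable_fun setT W -> (forall x, `|W x| <= C) ->
  measurable_fun setT o -> (forall x, `|o x| <= 1) -> lintegrable (fun t => o t * W t) T.
Proof.
move=> mW WC mo o1; apply: (@bounded_lintegrable _ C).
  by apply: measurable_funM; exact: measurable_funTS.
by move=> x _; rewrite normrM (le_trans _ (WC x))// ler_piMl.
Qed.

Lemma measurable_cosr x : measurable_fun setT (fun t : R => cos (x * t)).
Proof. by apply: continuous_measurable_fun => t; exact: isd_cont (isd_cosr x t). Qed.
Lemma measurable_sinr x : measurable_fun setT (fun t : R => sin (x * t)).
Proof. by apply: continuous_measurable_fun => t; exact: isd_cont (isd_sinr x t). Qed.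

(** The hypothesis [pos] at frequency [x] is weighted by x^(-b) e^(-ex) and integrated over [x]. The
    damping makes the weight integrable at infinity, which is what allows the exchange of
    integrals. *)
Lemma sector_eps (e : R) : 0 < e ->
  0 <= \int[mu]_(t in `]0, T[) (cb * (kcos (1 - b) e t * U t) + sb * (ksin (1 - b) e t * V t)).
Proof.
move=> e0; have th0 : 0 < 1 - b by rewrite subr_gt0.
have th1 : 1 - b < 1 by rewrite ltrBlDr ltrDl.
set w := gw (1 - b) e.
pose k x t := w x * (cb * (cos (x * t) * U t) + sb * (sin (x * t) * V t)).
have wi : mu.-integrable hl (EFin \o w) by exact: gw_integrable.
have icos t : mu.-integrable hl (EFin \o (fun x => w x * cos (x * t))).
  by apply: integrable_osc wi _ _; [exact: cpos_cosl|move=> x; exact: norm_cos_le1].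
have isin t : mu.-integrable hl (EFin \o (fun x => w x * sin (x * t))).
  by apply: integrable_osc wi _ _; [exact: cpos_sinl|move=> x; exact: norm_sin_le1].
have ik t : mu.-integrable hl (EFin \o k ^~ t).
  apply: (@eq_integrable _ _ _ mu hl (measurable_itv _) (EFin \o (fun x => (cb * U t) * (w x * cos (x * t)) + (sb * V t) * (w x * sin (x * t))))).
    by move=> x _; rewrite /= /k; congr EFin; ring.
  by apply: integrable_D => //; exact: integrable_Z.
have kb x t : `|k x t| <= w x * (C + C).
  rewrite /k normrM ger0_norm ?gw_ge0// ler_wpM2l ?gw_ge0//.
  rewrite (le_trans (ler_normD _ _))// lerD// !normrM.
    apply: le_trans (UC t); rewrite mulrA ler_piMl//.
    by rewrite mulr_ile1// norm_cos_le1.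
  apply: le_trans (VC t); rewrite mulrA ler_piMl//.
  by rewrite mulr_ile1// norm_sin_le1.
suff : 0 <= \int[mu]_(t in `]0, T[) \int[mu]_(x in hl) k x t.
  move=> /le_trans; apply; rewrite le_eqVlt; apply/orP; left; apply/eqP; apply: eq_Rintegral => t _.
  transitivity (\int[mu]_(x in hl) ((cb * U t) * (w x * cos (x * t)) + (sb * V t) * (w x * sin (x * t)))).
    by apply: eq_Rintegral => x _; rewrite /k; ring.
  rewrite RintegralD//; [|exact: integrable_Z|exact: integrable_Z].
  by rewrite !RintegralZl// -/(kcos _ _ _) -/(ksin _ _ _); rewrite /kcos /ksin -/w; ring.
apply: (@Fubini_ge0 _ hl _ k (fun=> \int[mu]_(x in hl) (w x * (C + C)))) => //.
- rewrite /k; apply: measurable_funM.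
    apply: (@measurableT_comp _ _ _ _ _ _ w); last exact: measurable_fst.
    apply: measurable_funM; first exact: measurable_powR.
    by apply: continuous_measurable_fun => x; exact: isd_cont (isd_expN e x).
  have mxt : measurable_fun setT (fun z : measurableTypeR R * measurableTypeR R => z.1 * z.2).
    exact: measurable_funM.
  apply: measurable_funD; apply: measurable_funM => //; apply: measurable_funM.
  + apply: (@measurableT_comp _ _ _ _ _ _ (@cos R)) => //.
    by apply: continuous_measurable_fun => x; exact: continuous_cos.
  + exact: (@measurableT_comp _ _ _ _ _ _ U).
  + apply: (@measurableT_comp _ _ _ _ _ _ (@sin R)) => //.
    by apply: continuous_measurable_fun => x; exact: continuous_sin.
  + exact: (@measurableT_comp _ _ _ _ _ _ V).
- move=> t _; apply: le_Rintegral => //.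
  + exact: integrable_norm.
  + under [X in EFin \o X]eq_fun do rewrite mulrC.
    exact: integrable_Z.
- apply: czero_lintegrable; split; first by move=> t _; exact: cst_continuous.
  exact: cvg_cst.
- move=> x _; apply: integrable_Z => //; apply: integrable_D => //; apply: integrable_Z => //.
  + by apply: osc_lintegrable => //; [exact: measurable_cosr|move=> y; exact: norm_cos_le1].
  + by apply: osc_lintegrable => //; [exact: measurable_sinr|move=> y; exact: norm_sin_le1].
- move=> x; rewrite /= in_itv/= andbT => x0; rewrite RintegralZl//.
    by rewrite mulr_ge0 ?gw_ge0// pos.
  apply: integrable_D => //; apply: integrable_Z => //.
  + by apply: osc_lintegrable => //; [exact: measurable_cosr|move=> y; exact: norm_cos_le1].
  + by apply: osc_lintegrable => //; [exact: measurable_sinr|move=> y; exact: norm_sin_le1].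
Qed.

Lemma osc_bound (c r w u K p : R) : 0 <= c -> 0 <= r <= p -> `|w| <= 1 -> `|u| <= K ->
  `|c * (r * w * u)| <= c * K * p.
Proof.
move=> c0 /andP[r0 rp] w1 uK; rewrite normrM (ger0_norm c0) -[leRHS]mulrA ler_wpM2l//.
rewrite mulrC !normrM (ger0_norm r0) mulrC; rewrite [K * p]mulrC ler_pM// ?mulr_ge0//.
by apply: le_trans rp; rewrite ler_piMr.
Qed.

(* The regularized kernel at e tends to t^(b-1) (cos, sin)((1-b) pi/2) as e -> 0,
   and (cb, sb) contracts it to cb * sb * t^(b-1) on both U and V. *)
Lemma sector_kernel : 0 <= \int[mu]_(t in `]0, T[) (t `^ (b - 1) * (U t + V t)).
Proof.
have th0 : 0 < 1 - b by rewrite subr_gt0.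
have th1 : 1 - b < 1 by rewrite ltrBlDr ltrDl.
have pi0 := pi_gt0 R.
have hb : 0 < b * pi / 2 < pi / 2.
  by rewrite divr_gt0 ?mulr_gt0//= ltr_pM2r ?invr_gt0// gtr_pMl.
have sb0 : 0 < sb by apply: sin_gt0_pi; move: hb; lra.
have cb0 : 0 < cb by apply: cos_gt0_pihalf; move: hb pi0; lra.
pose en (n : nat) : R := n.+1%:R^-1.
have en0 n : 0 < en n by rewrite /en invr_gt0.
pose r n t := (t ^+ 2 + en n ^+ 2) `^ (- ((1 - b) / 2)).
pose A n t := (1 - b) * atan (t / en n).
pose f n t := cb * (r n t * cos (A n t) * U t) + sb * (r n t * sin (A n t) * V t).
have rE t : 0 < t -> (t ^+ 2) `^ (- ((1 - b) / 2)) = t `^ (b - 1).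
  move=> t0; rewrite -powR_mulrn ?ltW// -powRrM; congr powR; by field.
(* The undamped power dominates all the regularized moduli at once, and it is integrable at 0
   because b > 0. *)
have rle n t : 0 < t -> r n t <= t `^ (b - 1).
  move=> t0; rewrite -rE// /r !powRN lef_pV2 ?posrE ?powR_gt0 ?ltr_wpDr ?exprn_gt0 ?sqr_ge0//.
  rewrite ge0_ler_powR ?nnegrE ?addr_ge0 ?sqr_ge0// ?lerDl ?sqr_ge0//.
  by rewrite divr_ge0// ltW.
have r_ge0 n t : 0 <= r n t by exact: powR_ge0.
have mr n (o : R -> R) : (forall x, {for x, continuous o}) -> measurable_fun setT (fun t => r n t * o (A n t)).
  move=> oc; apply: continuous_measurable_fun => t.
  apply: continuousM.
    have q0 : 0 < t ^+ 2 + en n ^+ 2 by rewrite ltr_wpDl ?sqr_ge0// exprn_gt0.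
    have dq : is_derive t 1 (fun y => y ^+ 2 + en n ^+ 2) (1 * t + t * 1 + 0).
      exact: isd_D (isd_M (isd_id t) (isd_id t)) (isd_cst t (en n ^+ 2)).
    exact: isd_cont (@isd_powRc _ t (fun y => y ^+ 2 + en n ^+ 2) _ _ q0 dq).
  apply: (@continuous_comp _ _ _ (A n) o); last exact: oc.
  apply: isd_cont (isd_Z (1 - b) (isd_comp (is_derive1_atan _) (isd_M (isd_id t) (isd_cst t (en n)^-1)))).
have mf n : measurable_fun setT (f n).
  apply: measurable_funD; apply: measurable_funM => //; apply: measurable_funM => //.
    by apply: mr => x; exact: continuous_cos.
  by apply: mr => x; exact: continuous_sin.
have fle n t : 0 < t -> `|f n t| <= (cb * C + sb * C) * t `^ (b - 1).
  move=> t0; rewrite (le_trans (ler_normD _ _))// mulrDl lerD//.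
    by apply: osc_bound => //; [exact: ltW|rewrite r_ge0 rle|exact: norm_cos_le1].
  by apply: osc_bound => //; [exact: ltW|rewrite r_ge0 rle|exact: norm_sin_le1].
have fi n : lintegrable (f n) T.
  apply: (@le_integrable _ _ _ mu `]0, T[ _ _ (EFin \o (fun t => (cb * C + sb * C) * t `^ (b - 1)))) => //.
  - by apply/measurable_EFinP; apply: (@measurable_funS _ _ _ _ setT) => //; exact: mf.
  - move=> t /=; rewrite in_itv/= lee_fin => /andP[t0 _].
    by rewrite (le_trans (fle n t t0))// ler_norm.
  by apply: integrable_Z => //; exact: lintegrable_powR.
have f_ge0 n : 0 <= \int[mu]_(t in `]0, T[) f n t.
  have [N N0 NE] := @kernel_polar (1 - b) (en n) th0 th1 (en0 n).
  have := sector_eps (en0 n).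
  have E : \int[mu]_(t in `]0, T[) (cb * (kcos (1 - b) (en n) t * U t) + sb * (ksin (1 - b) (en n) t * V t)) =
      N * \int[mu]_(t in `]0, T[) f n t.
    rewrite -RintegralZl//.
    by apply: eq_Rintegral => t _; have [-> ->] := NE t; rewrite /f /r /A; ring.
  by rewrite E pmulr_rge0.
have cv : \int[mu]_(t in `]0, T[) f n t @[n --> \oo] -->
    \int[mu]_(t in `]0, T[) (cb * sb * (t `^ (b - 1) * (U t + V t))).
  apply: (@Rdominated_cvg _ _ _ (fun t => (cb * C + sb * C) * t `^ (b - 1))) => //.
  - by move=> n; apply: (@measurable_funS _ _ _ _ setT) => //; exact: mf.
  - apply: measurable_funM => //; apply: measurable_funM.
      by apply: cpos_measurable_itv; exact: cpos_powR.
    by apply: measurable_funD; exact: measurable_funTS.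
  - move=> t /=; rewrite in_itv/= => /andP[t0 _].
    have t20 : 0 < t ^+ 2 by rewrite exprn_gt0.
    have en_cvg : en n @[n --> \oo] --> (0 : R) by exact: cvg_harmonic.
    have rt : r n t @[n --> \oo] --> t `^ (b - 1).
      rewrite -(rE t t0).
      have /isd_cont c1 := isd_powR (- ((1 - b) / 2)) t20.
      have c2 : t ^+ 2 + en n ^+ 2 @[n --> \oo] --> t ^+ 2 + 0 * 0.
        by apply: cvgD; [exact: cvg_cst|apply: cvgM].
      rewrite mulr0 addr0 in c2.
      exact: (cvg_comp _ _ c2 c1).
    have At : A n t @[n --> \oo] --> (1 - b) * (pi / 2).
      apply: cvgMr.
      suff c3 : t / en n @[n --> \oo] --> +oo by exact: (cvg_comp _ _ c3 (@cvgy_atan R)).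
      apply/cvgryPge => M; near=> n; rewrite /en invrK mulrC -ler_pdivrMr//.
      rewrite (@le_trans _ _ n%:R)// ?ler_nat//.
      by apply/ltW; near: n; exact: nbhs_infty_gtr.
    have cA : cos (A n t) @[n --> \oo] --> sb.
      have <- : cos ((1 - b) * (pi / 2)) = sb.
        rewrite (_ : (1 - b) * (pi / 2) = pi / 2 - b * pi / 2); last by ring.
        by rewrite cosB cos_pihalf sin_pihalf mul0r add0r mul1r.
      apply: (cvg_comp _ _ At); exact: continuous_cos.
    have sA : sin (A n t) @[n --> \oo] --> cb.
      have <- : sin ((1 - b) * (pi / 2)) = cb.
        rewrite (_ : (1 - b) * (pi / 2) = pi / 2 - b * pi / 2); last by ring.
        by rewrite sinB cos_pihalf sin_pihalf mul0r subr0 mul1r.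
      apply: (cvg_comp _ _ At); exact: continuous_sin.
    rewrite (_ : cb * sb * _ = cb * (t `^ (b - 1) * sb * U t) + sb * (t `^ (b - 1) * cb * V t)); last by ring.
    by apply: cvgD; apply: cvgMr; apply: cvgMl; apply: cvgM.
  - by apply: integrable_Z => //; exact: lintegrable_powR.
  - by move=> n t /=; rewrite in_itv/= => /andP[t0 _]; exact: fle.
have : 0 <= \int[mu]_(t in `]0, T[) (cb * sb * (t `^ (b - 1) * (U t + V t))).
  rewrite -(cvg_lim _ cv)//; apply: limr_ge; first by apply/cvg_ex; eexists; exact: cv.
  exact: nearW.
rewrite RintegralZl//; first by rewrite pmulr_rge0// mulr_gt0.
apply: (@le_integrable _ _ _ mu `]0, T[ _ _ (EFin \o (fun t => (C + C) * t `^ (b - 1)))) => //.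
- apply/measurable_EFinP; apply: measurable_funM; first by apply: cpos_measurable_itv; exact: cpos_powR.
  by apply: measurable_funD; exact: measurable_funTS.
- move=> t _; rewrite /= lee_fin; apply: le_trans (ler_norm _).
  rewrite normrM (ger0_norm (powR_ge0 t (b - 1))) mulrC ler_wpM2r ?powR_ge0//.
  by rewrite (le_trans (ler_normD _ _))// lerD.
by apply: integrable_Z => //; exact: lintegrable_powR.
Unshelve. all: by end_near. Qed.

End sector.
End kernel.

(** * Continuity of fractional integrals *)

Section volterra.
Context {R : realType}.
Implicit Types (f g F : R -> R) (x t a c l T : R).
Local Notation mu := (@lebesgue_measure R).
Local Notation lintegrable f t := (mu.-integrable `]0, t[ (EFin \o f)).
Local Notation hl := (`]0, +oo[%classic : set R).

Lemma ler0_le f df a c : a <= c -> {within `[a, c], continuous f} ->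
  (forall x, a < x < c -> is_derive x 1 f (df x)) -> (forall x, a < x < c -> df x <= 0) -> f c <= f a.
Proof.
rewrite le_eqVlt => /predU1P[-> //|ac] cf fdf df0.
have h x : x \in `]a, c[ -> is_derive x 1 f (df x) by rewrite in_itv/=; exact: fdf.
have [d dac E] := MVT ac h cf.
rewrite -subr_le0 E mulr_le0_ge0 ?subr_ge0 ?(ltW ac)//.
by apply: df0; move: dac; rewrite in_itv.
Qed.

Lemma czero_cst c : czero (fun _ : R => c).
Proof. by split; [move=> t _; exact: cst_continuous|exact: cvg_cst]. Qed.

Lemma czero_continuous f : continuous f -> czero f.
Proof. by move=> fc; split; [move=> t _; exact: fc|apply: cvg_at_right_filter; exact: fc]. Qed.

Lemma czero_D f g : czero f -> czero g -> czero (fun x => f x + g x).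
Proof. by move=> [f1 f2] [g1 g2]; split; [move=> t t0; apply: continuousD; auto|exact: cvgD]. Qed.

Lemma czero_B f g : czero f -> czero g -> czero (fun x => f x - g x).
Proof. by move=> [f1 f2] [g1 g2]; split; [move=> t t0; apply: continuousB; auto|exact: cvgB]. Qed.

Lemma czero_M f g : czero f -> czero g -> czero (fun x => f x * g x).
Proof. by move=> [f1 f2] [g1 g2]; split; [move=> t t0; apply: continuousM; auto|exact: cvgM]. Qed.

Lemma czero_sum (I : Type) (s : seq I) (f : I -> R -> R) : (forall i, czero (f i)) ->
  czero (fun x => \sum_(i <- s) f i x).
Proof.
move=> fc; elim: s => [|i s IHs].
  by under eq_fun do rewrite big_nil; exact: czero_cst.
by under eq_fun do rewrite big_cons; exact: czero_D.
Qed.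

Lemma vconv_powR_cst b t : 0 < b -> 0 <= t -> vconv (fun s => s `^ (b - 1)) (fun _ => 1) t = t `^ b / b.
Proof.
move=> b0 t0; rewrite vconv_comm; last 2 first.
- by apply: cpos_measurable_itv; exact: cpos_powR.
- exact: measurable_cst.
by rewrite /vconv; under eq_Rintegral do rewrite mul1r; exact: integral_powR.
Qed.

Lemma vconv0 f g t : t <= 0 -> vconv f g t = 0.
Proof. by move=> t0; rewrite /vconv set_itv_ge ?Rintegral_set0// bnd_simp -leNgt. Qed.

Lemma lintegrable_vconv_powR b g t : 0 < b -> czero g ->
  lintegrable (fun s => (t - s) `^ (b - 1) * g s) t.
Proof.
move=> b0 gc; apply: lintegrable_powR_conv => //; last by case: gc.
exact: czero_lintegrable.
Qed.

Lemma lint_split f t T : 0 <= t <= T -> lintegrable f T ->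
  \int[mu]_(s in `]0, T[) f s = \int[mu]_(s in `]0, t[) f s + \int[mu]_(s in `]t, T[) f s.
Proof.
move=> /andP[t0]; rewrite le_eqVlt => /predU1P[<-|tT] lf.
  by rewrite [X in _ + X](_ : _ = 0) ?addr0// set_itv_ge ?bnd_simp ?ltxx// Rintegral_set0.
rewrite -(@Rintegral_itvB R f (BRight 0) (BLeft T) t)//; try by rewrite bnd_simp ?ltW.
rewrite -(@Rintegral_itv_bndo_bndc R (BRight 0) t f) ?subrKC//.
apply: (@integrableS _ _ _ mu _ _ _ (measurable_itv _) (measurable_itv _) _ lf).
by move=> x /=; rewrite !in_itv/= => /andP[-> /=]; lra.
Qed.

Lemma abs_Rintegral_le (D : set R) f g : measurable D -> mu.-integrable D (EFin \o f) ->
  mu.-integrable D (EFin \o g) -> (forall x, D x -> `|f x| <= g x) ->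
  `|\int[mu]_(x in D) f x| <= \int[mu]_(x in D) g x.
Proof.
move=> mD lf lg fg; apply: (le_trans (@le_normr_Rintegral _ _ R mu D f mD lf)).
apply: le_Rintegral => //; exact: (integrable_norm lf).
Qed.

Lemma powR_small b e : 0 < b -> 0 < e -> exists2 d, 0 < d & forall u : R, 0 <= u < d -> u `^ b / b < e.
Proof.
move=> b0 e0; have /cvgrPdist_lt/(_ e e0) := powR_p_cvg0 b0.
rewrite near_withinE => -[d /= d0 h]; exists d => // u /andP[]; rewrite le_eqVlt => /predU1P[<-|u0] ud.
  by rewrite powR0 ?gt_eqF// mul0r.
have := h u; rewrite /= !sub0r !normrN (gtr0_norm u0) ger0_norm; first exact.
by rewrite divr_ge0 ?powR_ge0// ltW.
Qed.

Lemma integral_powR_end b t d : 0 < b -> 0 <= d ->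
  \int[mu]_(s in `]t, (t + d)[) (t + d - s) `^ (b - 1) = d `^ b / b.
Proof.
move=> b0 d0; rewrite -(integral_powR b0 d0) Rintegral_mkcond [RHS]Rintegral_mkcond.
rewrite /Rintegral; congr fine.
rewrite -(@integral_reflect R (t + d) (fun x => (((fun x => x `^ (b - 1)) \_ `]0, d[) x)%:E)).
  apply: eq_integral => x _; rewrite /patch !mem_setE !in_itv/=.
  by have -> : (0 < t + d - x) && (t + d - x < d) = (t < x < t + d) by apply/idP/idP; lra.
apply/measurable_EFinP; apply: measurable_restrict.
by apply: cpos_measurable_itv; exact: cpos_powR.
Qed.

Lemma lintegrable_cst c t : lintegrable (fun _ : R => c) t.
Proof. by apply: czero_lintegrable; exact: czero_cst. Qed.

(** Split at [t]. On []0, t[] the shifted kernel is the smaller one, so the integral of the absolute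
    difference is (t^b - (t+d)^b + d^b)/b <= d^b/b. The new piece []t, t + d[] contributes d^b/b
    again, hence the factor 2. The bound does not grow with [t]. *)
Lemma vconv_powR_holder b g M T t d : 0 < b < 1 -> czero g -> (forall s, 0 <= s <= T -> `|g s| <= M) ->
  0 <= t -> 0 <= d -> t + d <= T ->
  `|vconv (fun s => s `^ (b - 1)) g (t + d) - vconv (fun s => s `^ (b - 1)) g t| <= 2 * M * (d `^ b / b).
Proof.
move=> /andP[b0 b1] gc gM t0 d0 tdT.
have M0 : 0 <= M by apply: le_trans (gM 0 _) => //; lra.
pose k s := (t + d - s) `^ (b - 1); pose k0 s := (t - s) `^ (b - 1).
have tt : 0 <= t <= t + d by lra.
have lk h : czero h -> lintegrable (fun s => k s * h s) (t + d).
  by move=> hc; exact: lintegrable_vconv_powR.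
have sub (f : R -> R) : lintegrable f (t + d) -> lintegrable f t.
  move=> lf; apply: (@integrableS _ _ _ mu _ _ _ (measurable_itv _) (measurable_itv _) _ lf).
  by move=> x /=; rewrite !in_itv/= => /andP[-> /=]; lra.
have sub' (f : R -> R) : lintegrable f (t + d) -> mu.-integrable `]t, (t + d)[ (EFin \o f).
  move=> lf; apply: (@integrableS _ _ _ mu _ _ _ (measurable_itv _) (measurable_itv _) _ lf).
  by move=> x /=; rewrite !in_itv/=; lra.
have lk0 h : czero h -> lintegrable (fun s => k0 s * h s) t.
  by move=> hc; exact: lintegrable_vconv_powR.
have lk1 : lintegrable k (t + d).
  by have := lk _ (czero_cst 1); congr (mu.-integrable _ _); apply/funext => s /=; rewrite mulr1.
have lk01 : lintegrable k0 t.
  by have := lk0 _ (czero_cst 1); congr (mu.-integrable _ _); apply/funext => s /=; rewrite mulr1.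
have I0 : \int[mu]_(s in `]0, t[) k0 s = t `^ b / b.
  by rewrite -(vconv_powR_cst b0 t0); apply: eq_Rintegral => s _; rewrite mulr1.
have I1 : \int[mu]_(s in `]0, t[) k s = (t + d) `^ b / b - d `^ b / b.
  rewrite -(@integral_powR_end b t d)// -vconv_powR_cst//; last by lra.
  rewrite /vconv (lint_split tt (lk _ (czero_cst 1))).
  under [in RHS]eq_Rintegral do rewrite mulr1.
  by under [X in _ = _ + X - _]eq_Rintegral do rewrite mulr1; rewrite addrK.
rewrite [X in X - _]/vconv (lint_split tt (lk _ gc)) addrAC -RintegralB//; last 2 first.
- exact/sub/lk.
- exact: lk0.
apply: (le_trans (ler_normD _ _)).
have {I0 I1} H1 : `|\int[mu]_(s in `]0, t[) (k s * g s - k0 s * g s)| <= M * (t `^ b / b - ((t + d) `^ b / b - d `^ b / b)).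
  rewrite -{}I1 -{}I0 -RintegralB//; last exact: sub.
  rewrite -RintegralZl//; last by apply: integrable_B => //; exact: sub.
  apply: abs_Rintegral_le => //.
  - by apply: integrable_B => //; [exact/sub/lk|exact: lk0].
  - by apply: integrable_Z => //; apply: integrable_B => //; exact: sub.
  move=> s /=; rewrite in_itv/= => /andP[s0 st]; rewrite -mulrBl normrM mulrC ler_pM//.
    by apply: gM; lra.
  have kk : k s <= k0 s.
    have s1 : 0 < t - s by lra.
    have s2 : 0 < t + d - s by lra.
    have b2 : 0 <= 1 - b by lra.
    rewrite /k /k0 -[b - 1]opprB !powRN lef_pV2 ?posrE ?powR_gt0//.
    by rewrite ge0_ler_powR ?nnegrE ?(ltW s1) ?(ltW s2)//; lra.
  by rewrite distrC ger0_norm// subr_ge0.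
have H2 : `|\int[mu]_(s in `]t, (t + d)[) (k s * g s)| <= M * (d `^ b / b).
  rewrite -(@integral_powR_end b t d)// -RintegralZl//; last exact: sub'.
  apply: abs_Rintegral_le => //.
  - exact/sub'/lk.
  - by apply: integrable_Z => //; exact: sub'.
  move=> s /=; rewrite in_itv/= => /andP[st std]; rewrite normrM mulrC [`|k s|]ger0_norm ?powR_ge0//.
  by rewrite ler_wpM2r ?powR_ge0//; apply: gM; lra.
apply: (le_trans (lerD H1 H2)).
have H3 : t `^ b / b <= (t + d) `^ b / b.
  have td0 : 0 <= t + d by lra.
  by rewrite ler_pM2r ?invr_gt0// ge0_ler_powR ?nnegrE ?(ltW b0)// lerDl.
have : M * (t `^ b / b) <= M * ((t + d) `^ b / b) by rewrite ler_wpM2l.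
lra.
Qed.

Lemma czero_vconv_powR b g : 0 < b < 1 -> czero g -> czero (vconv (fun s => s `^ (b - 1)) g).
Proof.
move=> b01 gc; have /andP[b0 b1] := b01.
have key T e : 0 < e -> exists2 d, 0 < d & forall u v, 0 <= u <= v -> v <= T -> v - u < d ->
    `|vconv (fun s => s `^ (b - 1)) g v - vconv (fun s => s `^ (b - 1)) g u| < e.
  move=> e0; have [M gM] := czero_bounded T gc; pose M' := Num.max M 1.
  have M'0 : 0 < M' by rewrite lt_max ltr01 orbT.
  have gM' s : 0 <= s <= T -> `|g s| <= M'.
    by move=> sT; rewrite le_max gM.
  have [|d d0 h] := @powR_small b (e / (2 * M')) b0; first by rewrite divr_gt0// mulr_gt0.
  exists d => // u v /andP[u0 uv] vT vu.
  have vE : v = u + (v - u) by rewrite subrKC.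
  rewrite {1}vE; apply: (le_lt_trans (vconv_powR_holder b01 gc gM' u0 _ _)).
  - by rewrite subr_ge0.
  - by rewrite -vE.
  by rewrite mulrC -ltr_pdivlMr ?mulr_gt0//; apply: h; rewrite subr_ge0 uv.
split.
  move=> t t0; apply/cvgrPdist_lt => e e0; have [d d0 h] := key (t + 1) e e0.
  near=> y.
  have y0 : 0 < y by near: y; exact: lt_nbhsr.
  have yT : y < t + 1 by near: y; apply: lt_nbhsl; rewrite ltrDl.
  have yd : `|t - y| < d by near: y; apply/nbhs_ballP; exists d.
  move: yd; rewrite ltr_norml => /andP[y1 y2].
  have [ty|yt] := leP t y; first by rewrite distrC; apply: h; lra.
  by apply: h; lra.
apply/cvgrPdist_lt => e e0; have [d d0 h] := key 1 e e0.
near=> y; rewrite distrC; apply: h.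
- by rewrite lexx/=; near: y; exact: nbhs_right_ge.
- by near: y; apply: nbhs_right_le.
- by rewrite subr0; near: y; exact: nbhs_right_lt.
Unshelve. all: by end_near. Qed.

Section form.
Variables (T : R).
Hypothesis T0 : 0 < T.

Definition rev p (t : R) : R := p (T - t).
(* corr p q tau is the integral of p (tau + s) * q s over 0 < s < T - tau. *)
Definition corr (p q : R -> R) (tau : R) : R := conv (rev p \_ `]0, T[) (q \_ `]0, T[) (T - tau).

Lemma lintegrable_rev p : czero p -> lintegrable (rev p) T.
Proof. by move=> pc; apply: lintegrable_reflect; exact: czero_lintegrable. Qed.

Lemma measurable_corr p q : czero p -> czero q -> measurable_fun setT (corr p q).
Proof.
move=> pc qc; apply: (@measurableT_comp _ _ _ _ _ _ (conv (rev p \_ `]0, T[) (q \_ `]0, T[))).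
  apply: measurable_conv; apply: measurable_restrict; apply: lintegrable_measurable.
    exact: lintegrable_rev.
  exact: czero_lintegrable.
exact: measurable_reflect.
Qed.

Lemma conv_integrand_bound p q Cp Cq u : 0 < u <= T -> czero p -> czero q ->
  (forall t, 0 <= t <= T -> `|p t| <= Cp) -> (forall t, 0 <= t <= T -> `|q t| <= Cq) ->
  (\int[mu]_(r in `]0%R, u[) (`|rev p (u - r) * q r|)%:E <= (Cp * Cq * T)%:E)%E.
Proof.
move=> /andP[u0 uT] pc qc CpP CqP.
have Cpq : 0 <= Cp * Cq.
  by rewrite mulr_ge0//; [apply: le_trans (CpP 0 _)|apply: le_trans (CqP 0 _)] => //; lra.
apply: (@le_trans _ _ (\int[mu]_(r in `]0%R, u[) (Cp * Cq)%:E)%E).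
  apply: ge0_le_integral => //.
  - apply/measurable_EFinP; apply: measurableT_comp => //; apply: measurable_funM.
      have mp : measurable_fun `]0, T[ (rev p) by apply: lintegrable_measurable; exact: lintegrable_rev.
      apply: lintegrable_measurable; apply: lintegrable_reflect.
      apply: (@integrableS _ _ _ mu _ _ _ (measurable_itv _) (measurable_itv _) _ (lintegrable_rev pc)).
      by move=> x /=; rewrite !in_itv/= => /andP[-> /=]; lra.
    by apply: cpos_measurable_itv; case: qc.
  - move=> x /=; rewrite in_itv/= => /andP[x0 xu]; rewrite lee_fin normrM ler_pM//.
      by apply: CpP; lra.
    by apply: CqP; lra.
rewrite integral_cst//= lebesgue_measure_itv/= lte_fin u0 -EFinB -EFinM lee_fin subr0.
by rewrite ler_wpM2l.
Qed.

Lemma corr_bounded p q : czero p -> czero q -> exists C, forall tau, `|corr p q tau| <= C.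
Proof.
move=> pc qc; have [Cp CpP] := czero_bounded T pc; have [Cq CqP] := czero_bounded T qc.
have C0 : 0 <= Cp by apply: le_trans (CpP 0 _) => //; move: T0; lra.
have mq : measurable_fun setT (q \_ `]0, T[).
  by apply: measurable_restrict; apply: cpos_measurable_itv; case: qc.
have mp : measurable_fun setT (rev p \_ `]0, T[).
  by apply: measurable_restrict; apply: lintegrable_measurable; exact: lintegrable_rev.
exists (\int[mu]_(s in `]0, T[) (Cp * Cq)) => tau; rewrite /corr /conv.
rewrite (_ : \int[mu]_s _ = \int[mu]_(s in `]0, T[) ((rev p \_ `]0, T[) (T - tau - s) * q s)); last first.
  rewrite [RHS]Rintegral_mkcond; apply: eq_Rintegral => s _; rewrite /patch.
  by case: (s \in [set` `]0, T[]) => //; exact: mulr0.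
have bd s : `]0, T[%classic s -> `|(rev p \_ `]0, T[) (T - tau - s) * q s| <= Cp * Cq.
  rewrite /= in_itv/= => /andP[s0 sT]; rewrite normrM ler_pM//; last by apply: CqP; lra.
  rewrite /patch mem_setE in_itv/=; case: ifP => [/andP[u0 u1]|_]; last by rewrite normr0.
  by apply: CpP; lra.
apply: abs_Rintegral_le => //; last exact: lintegrable_cst.
apply: (@bounded_lintegrable _ _ (Cp * Cq)); last by move=> x xT; apply: bd; rewrite /= in_itv.
apply: measurable_funM; last by apply: cpos_measurable_itv; case: qc.
apply: (@measurable_funS _ _ _ _ setT) => //.
by apply: (measurableT_comp mp); exact: measurable_reflect.
Qed.

(** The left-hand side is the triple convolution of [rev p], [k] and [q] at [T], reassociated so
    that [k] stands alone. The quadratic form becomes linear in the kernel, tested against a fixed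
    bounded function, so positivity can pass through mixtures and limits of kernels. *)
Lemma form_corr k p q : czero p -> czero q -> lintegrable k T ->
  \int[mu]_(t in `]0, T[) (p t * vconv k q t) = \int[mu]_(t in `]0, T[) (k t * corr p q t).
Proof.
move=> pc qc lk; have [Cp CpP] := czero_bounded T pc; have [Cq CqP] := czero_bounded T qc.
transitivity (vconv (rev p) (vconv q k) T).
  apply: eq_Rintegral => s; rewrite inE/= in_itv/= => /andP[s0 sT].
  rewrite /rev subKr vconv_comm//.
    apply: lintegrable_measurable; apply: (@integrableS _ _ _ mu _ _ _ (measurable_itv _) (measurable_itv _) _ lk).
    by move=> x /=; rewrite !in_itv/= => /andP[-> /=]; lra.
  exact: lintegrable_measurable (czero_lintegrable s qc).
rewrite (@vconv_assoc _ (Cp * Cq * T))//.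
- apply: eq_Rintegral => s; rewrite inE/= in_itv/= => /andP[s0 sT].
  by rewrite mulrC /corr conv_restrictE//; lra.
- exact: lintegrable_rev.
- exact: czero_lintegrable.
- by move=> u u0T; apply: conv_integrand_bound => //; lra.
Qed.

End form.
End volterra.

(** * Positivity of the fractional quadratic form *)

Section positivity.
Context {R : realType}.
Implicit Types (f g p q : R -> R) (x t a c T : R).
Local Notation mu := (@lebesgue_measure R).
Local Notation lintegrable f t := (mu.-integrable `]0, t[ (EFin \o f)).

Lemma integrable_sum (D : set R) (I : Type) (s : seq I) (f : I -> R -> R) : measurable D ->
  (forall i, mu.-integrable D (EFin \o f i)) ->
  mu.-integrable D (EFin \o (fun x => \sum_(i <- s) f i x)).
Proof.
move=> mD fi; elim: s => [|i s IHs].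
  by under eq_fun do rewrite big_nil; exact: integrable0.
by under eq_fun do rewrite big_cons; exact: integrable_D.
Qed.

Lemma Rintegral_sum (D : set R) (I : Type) (s : seq I) (f : I -> R -> R) : measurable D ->
  (forall i, mu.-integrable D (EFin \o f i)) ->
  \int[mu]_(x in D) (\sum_(i <- s) f i x) = \sum_(i <- s) \int[mu]_(x in D) f i x.
Proof.
move=> mD fi; elim: s => [|i s IHs].
  under eq_Rintegral do rewrite big_nil.
  by rewrite big_nil Rintegral_cst// mul0r.
under eq_Rintegral do rewrite big_cons.
by rewrite big_cons -IHs RintegralD//; exact: integrable_sum.
Qed.

Definition prim f t := \int[mu]_(s in `]0, t[) f s.

Lemma prim0 f : prim f 0 = 0.
Proof. by rewrite /prim set_itv_ge ?bnd_simp ?ltxx// Rintegral_set0. Qed.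

Lemma czero_prim f : (forall t, lintegrable f t) -> czero (prim f).
Proof.
move=> lf; apply/czeroP; apply/continuous_within_itvcyP; split.
  move=> t; rewrite in_itv/= andbT => t0.
  have /continuous_within_itvP[] := primitive_czero lf (T := t + 1); first by lra.
  by move=> h _ _; apply: h; rewrite in_itv/=; lra.
by have /continuous_within_itvP[|] := primitive_czero lf (T := 1); [lra|].
Qed.

Lemma isd_prim f t : czero f -> 0 < t -> is_derive t 1 (prim f) (f t).
Proof. by move=> fc t0; apply: FTC_pos => // [u|]; [exact: czero_lintegrable|exact: fc.1]. Qed.

Lemma czero_cos x : czero (fun t : R => cos (x * t)).
Proof. by apply: czero_continuous => t; apply: isd_cont (isd_cosr x t). Qed.

Lemma czero_sin x : czero (fun t : R => sin (x * t)).
Proof. by apply: czero_continuous => t; apply: isd_cont (isd_sinr x t). Qed.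

Variables (T : R).
Hypothesis T0 : 0 < T.

Section pair.
Variables (x : R) (p q : R -> R).
Hypotheses (pc : czero p) (qc : czero q).
Let ca (f : R -> R) := prim (fun s => cos (x * s) * f s).
Let sa (f : R -> R) := prim (fun s => sin (x * s) * f s).

Lemma vconv_cos f t : czero f ->
  vconv (fun s => cos (x * s)) f t = cos (x * t) * ca f t + sin (x * t) * sa f t.
Proof.
move=> fc; have lc := czero_lintegrable t (czero_M (czero_cos x) fc).
have ls := czero_lintegrable t (czero_M (czero_sin x) fc).
rewrite -!RintegralZl// -RintegralD//; last 2 first.
- exact: integrable_Z.
- exact: integrable_Z.
by apply: eq_Rintegral => s _; rewrite mulrBr cosB; ring.
Qed.

Lemma vconv_sin f t : czero f ->
  vconv (fun s => sin (x * s)) f t = sin (x * t) * ca f t - cos (x * t) * sa f t.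
Proof.
move=> fc; have lc := czero_lintegrable t (czero_M (czero_cos x) fc).
have ls := czero_lintegrable t (czero_M (czero_sin x) fc).
rewrite -!RintegralZl// -RintegralB//; last 2 first.
- exact: integrable_Z.
- exact: integrable_Z.
by apply: eq_Rintegral => s _; rewrite mulrBr sinB; ring.
Qed.

Let czc f : czero f -> czero (ca f).
Proof. by move=> fc; apply: czero_prim => t; apply: czero_lintegrable; exact: czero_M (czero_cos x) fc. Qed.
Let czs f : czero f -> czero (sa f).
Proof. by move=> fc; apply: czero_prim => t; apply: czero_lintegrable; exact: czero_M (czero_sin x) fc. Qed.

Lemma vconv_czero_cos f : czero f -> czero (vconv (fun s => cos (x * s)) f).
Proof.
move=> fc; rewrite (_ : vconv _ _ = fun t => cos (x * t) * ca f t + sin (x * t) * sa f t).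
  by apply: czero_D; apply: czero_M; [exact: czero_cos|exact: czc|exact: czero_sin|exact: czs].
by apply/funext => t; exact: vconv_cos.
Qed.

Lemma vconv_czero_sin f : czero f -> czero (vconv (fun s => sin (x * s)) f).
Proof.
move=> fc; rewrite (_ : vconv _ _ = fun t => sin (x * t) * ca f t - cos (x * t) * sa f t).
  by apply: czero_B; apply: czero_M; [exact: czero_sin|exact: czc|exact: czero_cos|exact: czs].
by apply/funext => t; exact: vconv_sin.
Qed.

(** With the truncated Fourier coefficients P = ca p + i sa p and Q = ca q + i sa q, this is the
    real part of P times the conjugate of Q. The addition formula separates the variables, and the
    symmetrized integrand is then an exact derivative. *)
Lemma form_cos : \int[mu]_(t in `]0, T[) (cos (x * t) * corr T p q t) +
    \int[mu]_(t in `]0, T[) (cos (x * t) * corr T q p t) = ca p T * ca q T + sa p T * sa q T.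
Proof.
have lc := czero_lintegrable T (czero_cos x).
have h1 := czero_M pc (vconv_czero_cos qc); have h2 := czero_M qc (vconv_czero_cos pc).
rewrite -!form_corr// -RintegralD//; last 2 first.
- exact: czero_lintegrable.
- exact: czero_lintegrable.
transitivity ((fun t => ca p t * ca q t + sa p t * sa q t) T - (fun t => ca p t * ca q t + sa p t * sa q t) 0); last first.
  by rewrite /ca /sa !prim0 !mul0r addr0 subr0.
apply: (@FTC_eq R _ (fun t => ca p t * ca q t + sa p t * sa q t) T T0).
- by apply: czero_D; apply: czero_M; [exact: czc|exact: czc|exact: czs|exact: czs].
- move=> t t0.
  have dc f : czero f -> is_derive t 1 (ca f) (cos (x * t) * f t).
    by move=> fc; exact: isd_prim (czero_M (czero_cos x) fc) t0.
  have ds f : czero f -> is_derive t 1 (sa f) (sin (x * t) * f t).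
    by move=> fc; exact: isd_prim (czero_M (czero_sin x) fc) t0.
  apply: isd_eq (isd_D (isd_M (dc _ pc) (dc _ qc)) (isd_M (ds _ pc) (ds _ qc))) _.
  by rewrite !vconv_cos//; ring.
- by have [] := czero_D h1 h2.
- by move=> t; apply: czero_lintegrable; exact: czero_D h1 h2.
Qed.

(** The imaginary part of the same product; the sine kernel is odd, so here the antisymmetrized
    integrand is the exact derivative. *)
Lemma form_sin : \int[mu]_(t in `]0, T[) (sin (x * t) * corr T p q t) -
    \int[mu]_(t in `]0, T[) (sin (x * t) * corr T q p t) = sa p T * ca q T - ca p T * sa q T.
Proof.
have lc := czero_lintegrable T (czero_sin x).
have h1 := czero_M pc (vconv_czero_sin qc); have h2 := czero_M qc (vconv_czero_sin pc).
rewrite -!form_corr// -RintegralB//; last 2 first.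
- exact: czero_lintegrable.
- exact: czero_lintegrable.
transitivity ((fun t => sa p t * ca q t - ca p t * sa q t) T - (fun t => sa p t * ca q t - ca p t * sa q t) 0); last first.
  by rewrite /ca /sa !prim0 !mul0r !subr0.
apply: (@FTC_eq R _ (fun t => sa p t * ca q t - ca p t * sa q t) T T0).
- by apply: czero_B; apply: czero_M; [exact: czs|exact: czc|exact: czc|exact: czs].
- move=> t t0.
  have dc f : czero f -> is_derive t 1 (ca f) (cos (x * t) * f t).
    by move=> fc; exact: isd_prim (czero_M (czero_cos x) fc) t0.
  have ds f : czero f -> is_derive t 1 (sa f) (sin (x * t) * f t).
    by move=> fc; exact: isd_prim (czero_M (czero_sin x) fc) t0.
  apply: isd_eq (isd_B (isd_M (ds _ pc) (dc _ qc)) (isd_M (dc _ pc) (ds _ qc))) _.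
  by rewrite !vconv_sin//; ring.
- by have [] := czero_B h1 h2.
- by move=> t; apply: czero_lintegrable; exact: czero_B h1 h2.
Qed.

End pair.

Variables (n : nat) (b : R) (Q : 'M[R]_n) (r : 'I_n -> R -> R).
Hypotheses (b01 : 0 < b < 1) (rc : forall i, czero (r i)).
Hypothesis Qpos : forall u v : 'I_n -> R, 0 <= \sum_i \sum_j
  Q i j * (cos (b * pi / 2) * (u i * u j + v i * v j) + sin (b * pi / 2) * (v i * u j - u i * v j)).

Let J f := vconv (fun s => s `^ (b - 1)) f.
Let RR i j := corr T (r i) (r j).

Lemma corr_lintegrable k i j : lintegrable k T -> lintegrable (fun t => k t * corr T (r i) (r j) t) T.
Proof.
move=> lk; have [C CP] := corr_bounded T0 (rc i) (rc j).
apply: (@le_integrable _ _ _ mu _ _ _ (EFin \o (fun t => C * `|k t|))) => //.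
- apply/measurable_EFinP; apply: measurable_funM; first exact: lintegrable_measurable.
  apply: (@measurable_funS _ _ _ _ setT) => //; exact: measurable_corr.
- move=> t _ /=; rewrite lee_fin !normrM normr_id mulrC ler_wpM2r//.
  exact: le_trans (CP t) (ler_norm _).
- apply: integrable_Z => //; exact: (integrable_norm lk).
Qed.

(** [U] and [V] collect the symmetric and antisymmetric parts of the correlations, so that U + V is
    the correlation weighted by [Q]. At frequency [x], testing [U] against the cosine and [V]
    against the sine gives half of the form in [Qpos] at the Fourier coefficients of [r], which is
    the positivity that [sector_kernel] requires. *)
Lemma form_ge0 : 0 <= \sum_i \sum_j Q i j * \int[mu]_(t in `]0, T[) (r i t * J (r j) t).
Proof.
have /andP[b0 b1] := b01.
pose U t := \sum_i \sum_j (Q i j / 2) * (RR i j t + RR j i t).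
pose V t := \sum_i \sum_j (Q i j / 2) * (RR i j t - RR j i t).
have mRR i j : measurable_fun setT (RR i j) by exact: measurable_corr.
have mU : measurable_fun setT U.
  apply: measurable_sum => i; apply: measurable_sum => j; apply: measurable_funM => //.
  exact: measurable_funD.
have mV : measurable_fun setT V.
  apply: measurable_sum => i; apply: measurable_sum => j; apply: measurable_funM => //.
  exact: measurable_funB.
have [CR CRP] : exists C : 'I_n -> 'I_n -> R, forall i j t, `|RR i j t| <= C i j.
  have h i j := cid (corr_bounded T0 (rc i) (rc j)).
  by exists (fun i j => sval (h i j)) => i j; exact: (svalP (h i j)).
pose C := \sum_i \sum_j `|Q i j / 2| * (CR i j + CR j i).
have UC t : `|U t| <= C.
  apply: (le_trans (ler_norm_sum _ _ _)); apply: ler_sum => i _.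
  apply: (le_trans (ler_norm_sum _ _ _)); apply: ler_sum => j _.
  by rewrite normrM ler_wpM2l// (le_trans (ler_normD _ _))// lerD.
have VC t : `|V t| <= C.
  apply: (le_trans (ler_norm_sum _ _ _)); apply: ler_sum => i _.
  apply: (le_trans (ler_norm_sum _ _ _)); apply: ler_sum => j _.
  by rewrite normrM ler_wpM2l// (le_trans (ler_normB _ _))// lerD.
have := @sector_kernel R b T C U V b0 b1 mU mV UC VC.
have lpow := lintegrable_powR T b0.
have -> : \int[mu]_(t in `]0, T[) (t `^ (b - 1) * (U t + V t)) =
    \sum_i \sum_j Q i j * \int[mu]_(t in `]0, T[) (r i t * J (r j) t).
  transitivity (\int[mu]_(t in `]0, T[) (\sum_i \sum_j Q i j * (t `^ (b - 1) * RR i j t))).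
    apply: eq_Rintegral => t _; rewrite /U /V -big_split mulr_sumr; apply: eq_bigr => i _.
    by rewrite -big_split mulr_sumr; apply: eq_bigr => j _ /=; field.
  have li i j : lintegrable (fun t => Q i j * (t `^ (b - 1) * RR i j t)) T.
    by apply: integrable_Z => //; exact: corr_lintegrable.
  rewrite Rintegral_sum//; last by move=> i; exact: integrable_sum.
  apply: eq_bigr => i _; rewrite Rintegral_sum//; apply: eq_bigr => j _.
  rewrite (@RintegralZl _ _ R mu _ _ (Q i j) (measurable_itv _) (corr_lintegrable i j lpow)).
  by rewrite (form_corr (rc i) (rc j) lpow).
apply=> x x0.
pose ca f := prim (fun s => cos (x * s) * f s) T.
pose sa f := prim (fun s => sin (x * s) * f s) T.
have lc := czero_lintegrable T (czero_cos x); have ls := czero_lintegrable T (czero_sin x).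
rewrite (_ : Rintegral _ _ _ = \sum_i \sum_j (Q i j / 2) * (cos (b * pi / 2) * (ca (r i) * ca (r j) + sa (r i) * sa (r j)) +
    sin (b * pi / 2) * (sa (r i) * ca (r j) - ca (r i) * sa (r j)))).
  have := Qpos (fun i => ca (r i)) (fun i => sa (r i)).
  set S := (X in 0 <= X -> _) => S0.
  suff -> : \sum_i \sum_j (Q i j / 2) * (cos (b * pi / 2) * (ca (r i) * ca (r j) + sa (r i) * sa (r j)) +
    sin (b * pi / 2) * (sa (r i) * ca (r j) - ca (r i) * sa (r j))) = S / 2 by rewrite divr_ge0.
  by rewrite mulr_suml; apply: eq_bigr => i _; rewrite mulr_suml; apply: eq_bigr => j _; ring.
transitivity (\int[mu]_(t in `]0, T[) (\sum_i \sum_j (Q i j / 2) *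
   (cos (b * pi / 2) * (cos (x * t) * RR i j t + cos (x * t) * RR j i t) +
    sin (b * pi / 2) * (sin (x * t) * RR i j t - sin (x * t) * RR j i t)))).
  apply: eq_Rintegral => t _; rewrite /U /V !mulr_sumr -big_split; apply: eq_bigr => i _.
  by rewrite !mulr_sumr -big_split; apply: eq_bigr => j _ /=; ring.
have lci i j : lintegrable (fun t => cos (x * t) * RR i j t) T by exact: corr_lintegrable.
have lsi i j : lintegrable (fun t => sin (x * t) * RR i j t) T by exact: corr_lintegrable.
have lD i j := @integrable_D _ `]0, T[ _ _ (measurable_itv _) (lci i j) (lci j i).
have lB i j := @integrable_B _ `]0, T[ _ _ (measurable_itv _) (lsi i j) (lsi j i).
have li i j : lintegrable (fun t => (Q i j / 2) *
   (cos (b * pi / 2) * (cos (x * t) * RR i j t + cos (x * t) * RR j i t) +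
    sin (b * pi / 2) * (sin (x * t) * RR i j t - sin (x * t) * RR j i t))) T.
  by apply: integrable_Z => //; apply: integrable_D => //; apply: integrable_Z.
rewrite Rintegral_sum//; last by move=> i; exact: integrable_sum.
apply: eq_bigr => i _; rewrite Rintegral_sum//; apply: eq_bigr => j _.
rewrite RintegralZl//; last by apply: integrable_D => //; apply: integrable_Z.
rewrite RintegralD//; [|exact: integrable_Z|exact: integrable_Z].
rewrite !RintegralZl// RintegralD// RintegralB//.
by rewrite /RR form_cos// form_sin.
Qed.

End positivity.

(** * Coercivity of the form through mixtures of decaying exponentials *)

Section coercivity.
Context {R : realType}.
Implicit Types (f g q : R -> R) (x t a c T : R).
Local Notation mu := (@lebesgue_measure R).
Local Notation lintegrable f t := (mu.-integrable `]0, t[ (EFin \o f)).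
Local Notation hl := (`]0, +oo[%classic : set R).

Definition gammaI (p : R) := \int[mu]_(x in hl) (x `^ (p - 1) * expR (- (1 * x))).

Lemma gammaI_gt0 p : 0 < p <= 2 -> 0 < gammaI p.
Proof.
move=> p02; apply: (@Rintegral_gt0 _ _ _ 1 2) => //.
- exact: gamma_integrable.
- by move=> x _; rewrite mulr_ge0 ?powR_ge0 ?expR_ge0.
- by move=> x /=; rewrite !in_itv/= andbT => /andP[x1 _]; exact: lt_le_trans x1.
- by rewrite ltrDl.
- apply: cpos_within => // t t0; apply: isd_cont; exact: isd_M (isd_powR _ t0) (isd_expN 1 t).
- by move=> x /andP[x1 _]; rewrite mulr_gt0 ?expR_gt0// powR_gt0//; exact: lt_le_trans x1.
Qed.

Lemma gamma_scale p t : 0 < t -> 0 < p <= 2 ->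
  \int[mu]_(x in hl) (x `^ (p - 1) * expR (- (t * x))) = t `^ (- p) * gammaI p.
Proof.
move=> t0 p02; have ti0 : 0 < t^-1 by rewrite invr_gt0.
have c0 e : cpos (fun x => x `^ (p - 1) * expR (- (e * x))).
  by move=> u u0; apply: isd_cont; exact: isd_M (isd_powR _ u0) (isd_expN e u).
rewrite /gammaI /Rintegral.
rewrite (@ge0_integral_scale R t^-1 hl)//; last 2 first.
- by apply/measurable_EFinP; exact: cpos_measurable.
- by move=> x _; rewrite lee_fin mulr_ge0 ?powR_ge0 ?expR_ge0.
have -> : (fun x => t^-1 * x) @^-1` hl = hl.
  by apply/seteqP; split => x /=; rewrite !in_itv/= !andbT pmulr_rgt0.
have E : (\int[mu]_(x in hl) ((t^-1 * x) `^ (p - 1) * expR (- (t * (t^-1 * x))))%:E =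
    (t `^ (1 - p))%:E * \int[mu]_(x in hl) (x `^ (p - 1) * expR (- (1 * x)))%:E)%E.
  rewrite -integralZl//; last exact: gamma_integrable.
  apply: eq_integral => x; rewrite inE/= in_itv/= andbT => x0.
  rewrite -EFinM mulVKf ?gt_eqF// mul1r mulrA powRM ?(ltW x0) ?(ltW ti0)//.
  by rewrite -powR_inv1 ?(ltW t0)// -powRrM mulN1r opprB.
rewrite E muleA -EFinM fineM//; last by apply: integrable_fin_num => //; exact: gamma_integrable.
congr (_ * _); rewrite -powR_inv1 ?(ltW t0)// -powRDp//.
by congr (_ `^ _); ring.
Qed.

Lemma integrable_Zr (D : set R) f c : measurable D -> mu.-integrable D (EFin \o f) ->
  mu.-integrable D (EFin \o (fun x => f x * c)).
Proof.
move=> mD fi; rewrite (_ : (fun x => _) = (fun x => c * f x)); first exact: integrable_Z.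
by apply/funext => x; rewrite mulrC.
Qed.

(** The solution of z' = p - rho z with z(0) = 0, an exponential average of [p]. *)
Definition relax (rho : R) (p : R -> R) := vconv (fun s => expR (- (rho * s))) p.

Lemma czero_exp (rho : R) : czero (fun t : R => expR (rho * t)).
Proof. by apply: czero_continuous => t; apply: isd_cont (isd_exp (isd_Z rho (isd_id t))). Qed.

Lemma relaxE rho p t : czero p -> relax rho p t = expR (- (rho * t)) * prim (fun s => expR (rho * s) * p s) t.
Proof.
move=> pc; rewrite -RintegralZl//; last by apply: czero_lintegrable; exact: czero_M (czero_exp rho) pc.
by apply: eq_Rintegral => s _; rewrite mulrA -expRD; congr (expR _ * _); ring.
Qed.

Lemma relax0 rho p : relax rho p 0 = 0.
Proof. exact: vconv0. Qed.

Lemma czero_relax rho p : czero p -> czero (relax rho p).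
Proof.
move=> pc; rewrite (_ : relax rho p = fun t => expR (- (rho * t)) * prim (fun s => expR (rho * s) * p s) t).
  apply: czero_M; first by have := czero_exp (- rho); under eq_fun do rewrite mulNr.
  by apply: czero_prim => t; apply: czero_lintegrable; exact: czero_M (czero_exp rho) pc.
by apply/funext => t; exact: relaxE.
Qed.

Lemma isd_relax rho p t : czero p -> 0 < t -> is_derive t 1 (relax rho p) (p t - rho * relax rho p t).
Proof.
move=> pc t0; rewrite (_ : relax rho p = fun t => expR (- (rho * t)) * prim (fun s => expR (rho * s) * p s) t); last first.
  by apply/funext => u; exact: relaxE.
have dP := isd_prim (czero_M (czero_exp rho) pc) t0.
apply: isd_eq (isd_M (isd_expN rho t) dP) _.
rewrite [X in _ + X](_ : _ = p t); first by ring.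
by rewrite mulrA -expRD addNr expR0 mul1r.
Qed.

(** Since p = z' + rho z, the integral equals z(T)^2/2 plus rho times the integral of z^2. *)
Lemma relax_form_ge0 (z p : R -> R) rho T : 0 < T -> 0 <= rho -> czero p -> czero z -> z 0 = 0 ->
  (forall t, 0 < t -> is_derive t 1 z (p t - rho * z t)) ->
  0 <= \int[mu]_(t in `]0, T[) (p t * z t).
Proof.
move=> T0 r0 pc zc z0 dz.
have dF (t : R) : 0 < t -> is_derive t 1 (fun t => z t * z t / 2) (z t * (p t - rho * z t)).
  by move=> t0; apply: isd_eq (isd_M (isd_M (dz t t0) (dz t t0)) (isd_cst t 2^-1)) _; field.
have c1 : czero (fun t => p t - rho * z t) by exact: czero_B pc (czero_M (czero_cst rho) zc).
have cF' := czero_M zc c1.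
apply: (@le_trans _ _ (\int[mu]_(t in `]0, T[) (z t * (p t - rho * z t)))).
  rewrite (_ : Rintegral _ _ _ = (fun t => z t * z t / 2) T - (fun t => z t * z t / 2) 0).
    by rewrite /= z0 !mul0r subr0 divr_ge0// -expr2 sqr_ge0.
  apply: (@FTC_eq R _ (fun t => z t * z t / 2) T T0) => //.
  - exact: (czero_M (czero_M zc zc) (czero_cst 2^-1)).
  - by case: cF'.
  - by move=> t; exact: czero_lintegrable.
apply: le_Rintegral.
- exact: measurable_itv.
- exact: czero_lintegrable.
- by apply: czero_lintegrable; exact: (czero_M pc zc).
- move=> t _; rewrite mulrBr mulrC lerBlDr lerDl mulrCA mulr_ge0// -expr2; exact: sqr_ge0.
Qed.

(** All rates [rho] in [1, 2] are compared with the single average [z1]. The difference w = z1 - z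
    satisfies w' = (rho - 1) z - w; after subtracting the derivative of (z^2 + w^2)/2 and z1^2/4
    from p z, a nonnegative quadratic form in (z, w) remains. *)
Lemma relax_form_lb (z z1 p : R -> R) rho T : 0 < T -> 1 <= rho <= 2 -> czero p ->
  czero z -> z 0 = 0 -> (forall t, 0 < t -> is_derive t 1 z (p t - rho * z t)) ->
  czero z1 -> z1 0 = 0 -> (forall t, 0 < t -> is_derive t 1 z1 (p t - z1 t)) ->
  (\int[mu]_(t in `]0, T[) (z1 t ^+ 2)) / 4 <= \int[mu]_(t in `]0, T[) (p t * z t).
Proof.
move=> T0 /andP[r1 r2] pc zc z0 dz z1c z10 dz1.
have [w [wc wE]] : exists w, czero w /\ forall t, w t = z1 t - z t.
  by exists (fun t => z1 t - z t); split=> //; exact: czero_B.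
have dw (t : R) : 0 < t -> is_derive t 1 w ((rho - 1) * z t - w t).
  move=> t0; rewrite (_ : w = fun t => z1 t - z t); last exact/funext.
  by apply: isd_eq (isd_B (dz1 t t0) (dz t t0)) _; ring.
have [F [cF FE]] : exists F, czero F /\ forall t, F t = (z t * z t + w t * w t) / 2.
  exists (fun t => (z t * z t + w t * w t) / 2); split=> //.
  exact: (czero_M (czero_D (czero_M zc zc) (czero_M wc wc)) (czero_cst 2^-1)).
have [f [cf fE]] : exists f, czero f /\ forall t, f t = z t * (p t - rho * z t) + w t * ((rho - 1) * z t - w t).
  exists (fun t => z t * (p t - rho * z t) + w t * ((rho - 1) * z t - w t)); split => //.
  exact: (czero_D (czero_M zc (czero_B pc (czero_M (czero_cst rho) zc))) (czero_M wc (czero_B (czero_M (czero_cst (rho - 1)) zc) wc))).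
have dF (t : R) : 0 < t -> is_derive t 1 F (f t).
  move=> t0; rewrite (_ : F = fun t => (z t * z t + w t * w t) / 2); last exact/funext.
  apply: isd_eq (isd_M (isd_D (isd_M (dz t t0) (dz t t0)) (isd_M (dw t t0) (dw t t0))) (isd_cst t 2^-1)) _.
  by rewrite fE; field.
have z2c : czero (fun t => z1 t ^+ 2 / 4) by exact: (czero_M (czero_M z1c z1c) (czero_cst 4^-1)).
have I0 : 0 <= \int[mu]_(t in `]0, T[) f t.
  rewrite (_ : Rintegral _ _ _ = F T - F 0).
    rewrite [F 0](_ : _ = 0); last by rewrite FE wE z0 z10 subrr !mulr0 addr0 mul0r.
    by rewrite subr0 FE divr_ge0// addr_ge0// -expr2 sqr_ge0.
  apply: (@FTC_eq R _ F T T0) => //; first by case: cf.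
  by move=> t; exact: czero_lintegrable.
have l2 := czero_lintegrable T z2c; have lf := czero_lintegrable T cf.
rewrite -RintegralZr; [|exact: measurable_itv|by apply: czero_lintegrable; exact: (czero_M z1c z1c)].
apply: (@le_trans _ _ (\int[mu]_(t in `]0, T[) (z1 t ^+ 2 / 4 + f t))).
  by rewrite RintegralD// lerDl.
apply: le_Rintegral.
- exact: measurable_itv.
- exact: integrable_D.
- by apply: czero_lintegrable; exact: (czero_M pc zc).
move=> t _; rewrite -subr_ge0 fE.
have -> : z1 t = z t + w t by rewrite wE subrKC.
move: (z t) (w t) (p t) => zt wt pt.
rewrite (_ : _ - _ = (3 / 4 + (rho - 1)) * zt ^+ 2 + 3 / 4 * wt ^+ 2 - (rho - 1 + 2^-1) * (zt * wt)); last by field.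
have h1 := sqr_ge0 (zt + wt); have h2 := sqr_ge0 (zt - wt).
have zz := sqr_ge0 zt; have ww := sqr_ge0 wt.
nra.
Qed.

Variable b : R.
Hypothesis b01 : 0 < b < 1.

(* t^(b-1) is a superposition of the kernels e^(-rho t), all of which define
   nonnegative forms; only those with 1 < rho < 2 are used for the lower bound. *)
Lemma form_coercive p T : 0 < T -> czero p ->
  (8 * gammaI (1 - b))^-1 * \int[mu]_(t in `]0, T[) (relax 1 p t ^+ 2) <=
  \int[mu]_(t in `]0, T[) (p t * vconv (fun s => s `^ (b - 1)) p t).
Proof.
move=> T0 pc; have /andP[b0 b1] := b01.
have b02 : 0 < 1 - b <= 2 by lra.
have G0 := gammaI_gt0 b02; set G := gammaI _ in G0 *.
set Z := \int[mu]_(t in _) _.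
have Z0 : 0 <= Z by apply: Rintegral_ge0 => t _; exact: sqr_ge0.
have [C CP] := corr_bounded T0 pc pc.
have mR : measurable_fun setT (corr T p p) by exact: measurable_corr.
have C0 : 0 <= C by exact: le_trans (CP 0).
(* Integrated over []0, T[] this gives Z/8. The 8 is 4 from [relax_form_lb] times 2 from the bound
   rho^(-b) >= 1/2 on []1, 2[], an interval of length 1. *)
pose c := Z / (8 * T).
have cT : c * T = Z / 8 by rewrite /c; field; rewrite gt_eqF.
have c0 : 0 <= c by rewrite divr_ge0// mulr_ge0// ltW.
pose I12 : set R := [set` `]1, 2[].
(* Subtracting [c] for 1 < rho < 2 turns the lower bound into plain nonnegativity for each [rho],
   the form that [Fubini_ge0] accepts. *)
pose k rho tau := rho `^ (1 - b - 1) * expR (- (tau * rho)) * corr T p p tau - \1_I12 rho * c.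
have mI : measurable I12 by exact: measurable_itv.
have ig tau : 0 < tau -> mu.-integrable hl (EFin \o (fun rho => rho `^ (1 - b - 1) * expR (- (tau * rho)))).
  by move=> tau0; exact: gamma_integrable.
have i1 : mu.-integrable hl (EFin \o \1_I12).
  apply: (@eq_integrable _ _ _ mu hl _ ((EFin \o cst 1) \_ I12)) => //.
    by move=> x _; rewrite patchE /= indicE; case: ifP.
  apply: (@integrableS _ _ _ mu setT) => //.
  apply/(integrable_mkcond _ _).1 => //.
  apply: (@integrableS _ _ _ mu _ _ _ (measurable_itv _) (measurable_itv _) _ (lintegrable_cst 1 2)).
  by move=> x /=; rewrite !in_itv/= => /andP[x1 ->]; rewrite andbT (lt_trans ltr01).
have i12 : mu.-integrable hl (EFin \o (fun rho => \1_I12 rho * c)) by exact: integrable_Zr.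
have I12E : \int[mu]_(rho in hl) (\1_I12 rho * c) = c.
  rewrite RintegralZr// /Rintegral integral_indic//.
  rewrite (_ : I12 `&` hl = I12); last first.
    apply/seteqP; split => [x []//|x xI]; split => //; move: xI.
    by rewrite /I12/= !in_itv/= andbT => /andP[x1 _]; rewrite (lt_trans ltr01).
  rewrite /I12/= lebesgue_measure_itv/= lte_fin ltr1n -EFinB/=.
  by rewrite (_ : 2 - 1 = 1) ?mul1r//; lra.
have lpow := lintegrable_powR T b0.
have lpR : lintegrable (fun t => t `^ (b - 1) * corr T p p t) T by exact: (@corr_lintegrable _ T T0 1 (fun _ => p) (fun _ => pc) _ ord0 ord0).
have le e : lintegrable (fun t => expR (- (e * t))) T.
  by apply: czero_lintegrable; have := czero_exp (- e); under eq_fun do rewrite mulNr.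
have leR e : lintegrable (fun t => expR (- (e * t)) * corr T p p t) T by exact: (@corr_lintegrable _ T T0 1 (fun _ => p) (fun _ => pc) _ ord0 ord0).
have kE tau : 0 < tau -> \int[mu]_(rho in hl) k rho tau = G * (tau `^ (b - 1) * corr T p p tau) - c.
  move=> t0; rewrite /k RintegralB//; last exact: integrable_Zr (ig _ t0).
  rewrite RintegralZr//; last exact: ig.
  by rewrite I12E gamma_scale// opprB mulrAC mulrC.
have := @Fubini_ge0 R hl [set` `]0, T[] k (fun tau => C * G * tau `^ (b - 1) + c).
rewrite (_ : \int[mu]_(y in _) _ = G * \int[mu]_(t in `]0, T[) (t `^ (b - 1) * corr T p p t) - Z / 8).
  rewrite form_corr// => h.
  have krE rho : (fun tau => k rho tau) = (fun tau => rho `^ (1 - b - 1) * (expR (- (rho * tau)) * corr T p p tau) - \1_I12 rho * c).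
    by apply/funext => tau; rewrite /k mulrA [tau * _]mulrC.
  have lk rho : lintegrable (fun tau => rho `^ (1 - b - 1) * expR (- (tau * rho)) * corr T p p tau) T.
    rewrite (_ : (fun tau => _) = (fun tau => rho `^ (1 - b - 1) * (expR (- (rho * tau)) * corr T p p tau))); first exact: integrable_Z.
    by apply/funext => tau; rewrite mulrA [tau * _]mulrC.
  rewrite invfM mulrAC ler_pdivrMr// [leRHS]mulrC [_ * Z]mulrC -subr_ge0.
  apply: h => //.
  - apply: measurable_funB; last first.
      by apply: measurable_funM => //; apply: (@measurableT_comp _ _ _ _ _ _ (\1_I12 : R -> R)) => //; exact: measurable_indic.
    apply: measurable_funM; last exact: (@measurableT_comp _ _ _ _ _ _ (corr T p p)).
    apply: measurable_funM.
      by apply: (@measurableT_comp _ _ _ _ _ _ (fun x : R => x `^ (1 - b - 1))) => //; exact: measurable_powR.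
    apply: (measurableT_comp (@measurable_expR R)); apply: measurableT_comp => //.
    exact: measurable_funM.
  - move=> tau; rewrite /= in_itv/= => /andP[t0 tT]; apply: integrable_B => //.
    exact: integrable_Zr (ig _ t0).
  - move=> tau; rewrite /= in_itv/= => /andP[t0 tT].
    have ih : mu.-integrable hl (EFin \o (fun rho => C * (rho `^ (1 - b - 1) * expR (- (tau * rho))) + \1_I12 rho * c)).
      by apply: integrable_D => //; apply: integrable_Z => //; exact: ig.
    apply: (@le_trans _ _ (\int[mu]_(rho in hl) (C * (rho `^ (1 - b - 1) * expR (- (tau * rho))) + \1_I12 rho * c))).
      apply: le_Rintegral => //.
        by apply: integrable_norm; apply: integrable_B => //; exact: integrable_Zr (ig _ t0).
      move=> rho; rewrite /= in_itv/= andbT => r0.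
      apply: (le_trans (ler_normB _ _)); apply: lerD.
        rewrite normrM mulrC [X in _ * X <= _]ger0_norm ?mulr_ge0 ?powR_ge0 ?expR_ge0//.
        by rewrite ler_wpM2r ?mulr_ge0 ?powR_ge0 ?expR_ge0.
      by rewrite ger0_norm// mulr_ge0// indicE.
    rewrite RintegralD//; last by apply: integrable_Z => //; exact: ig.
    rewrite RintegralZl//; last exact: ig.
    by rewrite I12E gamma_scale// opprB [_ * gammaI _]mulrC mulrA.
  - apply: integrable_D => //; [exact: integrable_Z|exact: lintegrable_cst].
  - move=> rho; rewrite /= in_itv/= andbT => r0; apply: integrable_B => //; exact: lintegrable_cst.
  - move=> rho; rewrite /= in_itv/= andbT => r0.
    have -> : \int[mu]_(y in `]0, T[) k rho y = rho `^ (1 - b - 1) * \int[mu]_(t in `]0, T[) (p t * relax rho p t) - \1_I12 rho * (Z / 8).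
      rewrite krE RintegralB//; [|exact: integrable_Z|exact: lintegrable_cst].
      rewrite RintegralZl// form_corr// Rintegral_cst// -cT; congr (_ - _).
      rewrite (_ : fine _ = T) ?mulrA//.
      by rewrite /= lebesgue_measure_itv/= lte_fin T0 -EFinB/= subr0.
    have I0 := relax_form_ge0 T0 (ltW r0) pc (czero_relax rho pc) (relax0 rho p) (fun t => @isd_relax rho p t pc).
    rewrite subr_ge0 indicE; case: (boolP (rho \in I12)) => [|_]; last first.
      by rewrite mul0r mulr_ge0 ?powR_ge0.
    rewrite inE /I12/= in_itv/= => /andP[r1 r2]; rewrite mul1r.
    have r12 : 1 <= rho <= 2 by rewrite !ltW.
    have dz1 (t : R) : 0 < t -> is_derive t 1 (relax 1 p) (p t - relax 1 p t).
      by move=> t0; apply: isd_eq (isd_relax 1 pc t0) _; rewrite mul1r.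
    have h1 := relax_form_lb T0 r12 pc (czero_relax rho pc) (relax0 rho p) (fun t => @isd_relax rho p t pc) (czero_relax 1 pc) (relax0 1 p) dz1.
    have h2 : 2^-1 <= rho `^ (1 - b - 1).
      have -> : 1 - b - 1 = - b by ring.
      rewrite powRN lef_pV2 ?posrE ?powR_gt0//.
      apply: (le_trans (ge0_ler_powR _ _ _ (ltW r2))); rewrite ?nnegrE ?(ltW b0) ?(ltW r0)//.
      by rewrite -[leRHS]powRr1// ler_powR// ?(ltW b1)// ler1n.
    have -> : Z / 8 = 2^-1 * (Z / 4) by field.
    have Z4 : 0 <= Z / 4 by rewrite divr_ge0.
    have h0 : 0 <= 2^-1 :> R by rewrite invr_ge0.
    exact: (ler_pM h0 Z4 h2 h1).
transitivity (\int[mu]_(t in `]0, T[) (G * (t `^ (b - 1) * corr T p p t) - c)).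
  by apply: eq_Rintegral => t; rewrite inE/= in_itv/= => /andP[t0 _]; exact: kE.
rewrite RintegralB//; [|exact: integrable_Z|exact: lintegrable_cst].
rewrite RintegralZl// Rintegral_cst// -cT; congr (_ - _ * _).
rewrite /= lebesgue_measure_itv/= lte_fin T0 -EFinB/= subr0//.
Qed.

End coercivity.

(** * Asymptotics *)

Section asymptotics.
Context {R : realType}.
Implicit Types (f g h p q : R -> R) (x t a c l T : R).
Local Notation mu := (@lebesgue_measure R).
Local Notation lintegrable f t := (mu.-integrable `]0, t[ (EFin \o f)).
Local Notation hl := (`]0, +oo[%classic : set R).

(** The threshold is at least 1 because the derivative bounds below hold only away from the
    singularity at 0. *)
Lemma cvg_pinftyE f l : f x @[x --> +oo] --> l <->
  forall e : R, 0 < e -> exists2 M, 1 <= M & forall t, M <= t -> `|f t - l| <= e.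
Proof.
split=> [/cvgrPdist_le h e e0|h].
  have [M [_ MP]] := h e e0; exists (Num.max 1 (M + 1)); first by rewrite le_max lexx.
  move=> t; rewrite ge_max => /andP[_ Mt]; rewrite distrC; apply: MP; lra.
apply/cvgrPdist_le => e e0; have [M _ MP] := h e e0.
by exists M; split; [exact: num_real|move=> t Mt; rewrite distrC; exact: MP (ltW Mt)].
Qed.

Lemma nondec_cvg f C : (forall s t, 1 <= s <= t -> f s <= f t) -> (forall t, 1 <= t -> f t <= C) ->
  exists l, f x @[x --> +oo] --> l.
Proof.
move=> fm fC; pose g t := f (Num.max t 1).
have gm : {homo g : s t / s <= t}.
  by move=> s t st; apply: fm; rewrite le_max lexx orbT ge_max !le_max st lexx/= orbT.
have /(nondecreasing_cvgr gm) gl : has_ubound (range g).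
  by exists C => _ [t _ <-]; apply: fC; rewrite le_max lexx orbT.
exists (sup (range g)); apply/cvg_pinftyE => e e0.
have [M M1 MP] := (cvg_pinftyE g _).1 gl e e0; exists M => // t Mt.
by have := MP t Mt; rewrite /g max_l// (le_trans M1).
Qed.

Lemma lipschitz_bound f df L : (forall t, 1 <= t -> is_derive t 1 f (df t)) ->
  (forall t, 1 <= t -> `|df t| <= L) -> forall s t, 1 <= s <= t -> `|f t - f s| <= L * (t - s).
Proof.
move=> dF dL s t /andP[s1]; rewrite le_eqVlt => /predU1P[<-|st]; first by rewrite !subrr normr0 mulr0.
have h x : x \in `]s, t[ -> is_derive x 1 f (df x).
  by rewrite in_itv/= => /andP[sx _]; apply: dF; apply: ltW; exact: le_lt_trans sx.
have cf : {within `[s, t], continuous f}.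
  apply: continuous_in_subspaceT => x; rewrite inE/= in_itv/= => /andP[sx _].
  by apply: isd_cont; apply: dF; exact: le_trans sx.
have [c cst ->] := MVT st h cf.
rewrite normrM (ger0_norm (_ : 0 <= t - s)) ?subr_ge0 ?(ltW st)// ler_wpM2r ?subr_ge0 ?(ltW st)//.
by apply: dL; move: cst; rewrite in_itv/= => /andP[/ltW sc _]; exact: le_trans sc.
Qed.

(** On an interval of length [eta] after [t] the mean value theorem gives a point where |g| is at
    most e/2, since [h] varies by at most e eta/2. Moving back to [t] costs at most L eta, which the
    choice of [eta] keeps below e/2; L + 1 avoids a zero denominator. *)
Lemma barbalat h g L l : (forall t, 1 <= t -> is_derive t 1 h (g t)) ->
  (forall s t, 1 <= s <= t -> `|g t - g s| <= L * (t - s)) ->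
  h x @[x --> +oo] --> l -> g x @[x --> +oo] --> (0 : R).
Proof.
move=> dh gL hl; apply/cvg_pinftyE => e e0.
have L0 : 0 <= L.
  have := gL 1 2; rewrite lexx (_ : (1 : R) <= 2)/=; last by rewrite ler1n.
  by move=> /(_ isT) /(le_trans (normr_ge0 _)); rewrite pmulr_lge0//; lra.
pose eta := e / (2 * (L + 1)).
have L1 : 0 < L + 1 by rewrite ltr_wpDl.
have eta0 : 0 < eta by rewrite divr_gt0// mulr_gt0.
have e4 : 0 < e * eta / 4 by rewrite divr_gt0// mulr_gt0.
have [M M1 MP] := (cvg_pinftyE h l).1 hl _ e4; exists M => // t Mt.
have t1 : 1 <= t by exact: le_trans Mt.
have tt : t < t + eta by rewrite ltrDl.
have h' x : x \in `]t, t + eta[ -> is_derive x 1 h (g x).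
  by rewrite in_itv/= => /andP[sx _]; apply: dh; apply: ltW; exact: le_lt_trans sx.
have cf : {within `[t, t + eta], continuous h}.
  apply: continuous_in_subspaceT => x; rewrite inE/= in_itv/= => /andP[sx _].
  by apply: isd_cont; apply: dh; exact: le_trans sx.
have [c] := MVT tt h' cf; rewrite in_itv/= addrAC subrr add0r => /andP[tc ct] E.
have h1 : `|g c| * eta <= e * eta / 2.
  rewrite -{1}(gtr0_norm eta0) -normrM -E.
  rewrite (_ : _ - _ = (h (t + eta) - l) - (h t - l)); last by ring.
  apply: (le_trans (ler_normB _ _)).
  have := MP _ Mt; have : M <= t + eta by rewrite (le_trans Mt)// ltW.
  move=> /MP; lra.
have h2 : `|g c| <= e / 2 by rewrite -(ler_pM2r eta0) mulrAC.
have h3 := gL t c; rewrite t1 (ltW tc)/= in h3; have {}h3 := h3 isT.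
have h4 : L * (c - t) <= e / 2.
  apply: (@le_trans _ _ ((L + 1) * eta)).
    by apply: ler_pM => //; lra.
  by rewrite le_eqVlt; apply/orP; left; apply/eqP; rewrite /eta; field; rewrite gt_eqF.
rewrite subr0 (_ : g t = g c - (g c - g t)); last by ring.
apply: (le_trans (ler_normB _ _)); lra.
Qed.

Lemma ge1_powR (c t : R) : 0 <= c -> 1 <= t -> 1 <= t `^ c.
Proof. by move=> c0 t1; have := ler_powR t1 c0; rewrite powRr0. Qed.

Lemma powRN_cvg0 b : 0 < b -> t `^ (- b) @[t --> +oo] --> (0 : R).
Proof.
move=> b0; apply/cvg_pinftyE => e e0.
have ep : 0 < e `^ (- b^-1) by rewrite powR_gt0.
exists (Num.max 1 (e `^ (- b^-1))); first by rewrite le_max lexx.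
move=> t; rewrite ge_max => /andP[t1 et].
have t0 : 0 < t by exact: lt_le_trans t1.
rewrite subr0 ger0_norm ?powR_ge0// powRN -[leRHS]invrK lef_pV2 ?posrE ?powR_gt0 ?invr_gt0//.
apply: (@le_trans _ _ ((e `^ (- b^-1)) `^ b)); last first.
  by apply: ge0_ler_powR => //; rewrite ?nnegrE ?ltW.
by rewrite -powRrM mulNr mulVf ?gt_eqF// powR_inv1// ltW.
Qed.

Variable b : R.
Hypothesis b01 : 0 < b < 1.

(* ckern is the Caputo kernel of order 1 + b, up to the factor 1 / Gamma (1 - b). *)
Definition ckern (t : R) := t `^ (1 - b - 1).
(** What a unit initial velocity contributes to the response: it solves z' = ckern - z with z(0) =
    0. *)
Definition ckern_relax := vconv ckern (fun t => expR (- (1 * t))).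

Lemma cpos_ckern : cpos ckern.
Proof. exact: cpos_powR. Qed.

Lemma lintegrable_ckern T : lintegrable ckern T.
Proof. by apply: lintegrable_powR; move: b01; lra. Qed.

Lemma czero_expN : czero (fun t : R => expR (- (1 * t))).
Proof. by have := @czero_exp R (- 1); under eq_fun do rewrite mulNr. Qed.

Lemma czero_ckern_relax : czero ckern_relax.
Proof. by apply: czero_vconv_powR; [move: b01; lra|exact: czero_expN]. Qed.

Lemma ckern_relax_ge0 t : 0 <= ckern_relax t.
Proof. by apply: Rintegral_ge0 => s _; rewrite mulr_ge0 ?powR_ge0 ?expR_ge0. Qed.

Let ek s := expR (1 * s) * ckern s.

Let lek T : lintegrable ek T.
Proof.
have [C CP] := czero_bounded T (@czero_exp R 1).
apply: (@le_integrable _ _ _ mu _ _ _ (EFin \o (fun s => C * ckern s))) => //.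
- apply/measurable_EFinP; apply: measurable_funM; apply: cpos_measurable_itv; last exact: cpos_ckern.
  by case: (@czero_exp R 1).
- move=> s /=; rewrite in_itv/= => /andP[s0 sT]; rewrite lee_fin normrM [X in _ * X]ger0_norm ?powR_ge0//.
  rewrite [leRHS]ger0_norm; last by rewrite mulr_ge0 ?powR_ge0// (le_trans _ (CP s _))// !ltW.
  by rewrite ler_wpM2r ?powR_ge0//; apply: CP; rewrite !ltW.
- apply: integrable_Z => //; exact: lintegrable_ckern.
Qed.

Lemma ckern_relaxE t : ckern_relax t = expR (- (1 * t)) * prim ek t.
Proof.
rewrite /ckern_relax vconv_comm; last 2 first.
- apply: cpos_measurable_itv; exact: cpos_ckern.
- by apply: cpos_measurable_itv; case: czero_expN.
rewrite -RintegralZl//; apply: eq_Rintegral => s _; rewrite /ek mulrA -expRD.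
by congr (expR _ * _); ring.
Qed.

Lemma isd_ckern_relax t : 0 < t -> is_derive t 1 ckern_relax (ckern t - ckern_relax t).
Proof.
move=> t0; rewrite (_ : ckern_relax = fun t => expR (- (1 * t)) * prim ek t); last by apply/funext => u; exact: ckern_relaxE.
have dP : is_derive t 1 (prim ek) (ek t).
  apply: FTC_pos => //; apply: continuousM; first by have [h _] := @czero_exp R 1; exact: h.
  exact: cpos_ckern.
apply: isd_eq (isd_M (isd_expN 1 t) dP) _.
rewrite [X in _ + X](_ : _ = ckern t); first by ring.
by rewrite /ek mulrA -expRD addNr expR0 mul1r.
Qed.

(** The kernel is decreasing, so its weighted average over []0, t[] is at least its final value
    times the total weight 1 - e^(-t). *)
Lemma ckern_relax_lb t : 0 < t -> ckern t * (1 - expR (- (1 * t))) <= ckern_relax t.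
Proof.
move=> t0; rewrite ckern_relaxE.
have -> : ckern t * (1 - expR (- (1 * t))) = expR (- (1 * t)) * (ckern t * (expR (1 * t) - expR (1 * 0))).
  by rewrite mulr0 expR0 [RHS]mulrCA; congr (_ * _); rewrite mulrBr -expRD addNr expR0 mulr1.
rewrite ler_wpM2l ?expR_ge0//.
have ce := @czero_exp R 1.
have -> : expR (1 * t) - expR (1 * 0) = prim (fun s => expR (1 * s)) t.
  rewrite /prim; apply/esym; apply: (@FTC_eq R _ (fun s => expR (1 * s))) => //.
  - by move=> s _; apply: isd_eq (isd_exp (isd_Z 1 (isd_id s))) _; rewrite !mulr1.
  - by case: ce.
  - by move=> u; exact: czero_lintegrable.
rewrite -RintegralZl//; last exact: czero_lintegrable.
apply: le_Rintegral => //; first by apply: integrable_Z => //; exact: czero_lintegrable.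
move=> s /=; rewrite in_itv/= => /andP[s0 st]; rewrite mulrC ler_wpM2l ?expR_ge0//.
rewrite /ckern (_ : 1 - b - 1 = - b); last by ring.
by rewrite !powRN lef_pV2 ?posrE ?powR_gt0// ge0_ler_powR ?nnegrE ?(ltW s0) ?(ltW st) ?(ltW t0)//; move: b01; lra.
Qed.

Definition igammaf s := ckern s * expR (- (1 * s)).
(** The lower incomplete Gamma function of exponent 1 - b, a bounded primitive against which
    [ckern_relax] is compared. *)
Definition igamma t := prim igammaf t.

Lemma lintegrable_igammaf T : lintegrable igammaf T.
Proof. by apply: integrable_hl_lint; apply: gamma_integrable => //; move: b01; lra. Qed.

Lemma cpos_igammaf : cpos igammaf.
Proof. by move=> t t0; apply: isd_cont; exact: isd_M (isd_powR _ t0) (isd_expN 1 t). Qed.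

Lemma igamma_le t : igamma t <= gammaI (1 - b).
Proof.
have i : mu.-integrable hl (EFin \o igammaf) by apply: gamma_integrable => //; move: b01; lra.
rewrite -lee_fin /igamma /prim -lintegrable_EFin; last exact: lintegrable_igammaf.
rewrite /gammaI /Rintegral fineK; last exact: integrable_fin_num.
apply: ge0_subset_integral => //=.
- by case/integrableP: i.
- by move=> s _; rewrite lee_fin mulr_ge0 ?powR_ge0 ?expR_ge0.
- by move=> s /=; rewrite !in_itv/= andbT => /andP[].
Qed.

Lemma isd_igamma t : 0 < t -> is_derive t 1 igamma (igammaf t).
Proof. by move=> t0; apply: FTC_pos => //; [exact: lintegrable_igammaf|exact: cpos_igammaf]. Qed.

Lemma czero_igamma : czero igamma.
Proof. exact: czero_prim lintegrable_igammaf. Qed.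

Lemma ckern_relax_deriv_le t : 0 < t -> ckern t - ckern_relax t <= igammaf t.
Proof. by move=> /ckern_relax_lb; rewrite /igammaf; lra. Qed.

(* The right-hand side is integrable because ckern - ckern_relax is the
   derivative of the bounded function ckern_relax. *)
Lemma ckern_relax_deriv_abs t : 0 < t -> `|ckern t - ckern_relax t| <= 2 * igammaf t - (ckern t - ckern_relax t).
Proof.
move=> t0; have h := ckern_relax_deriv_le t0; have h0 : 0 <= igammaf t by rewrite mulr_ge0 ?powR_ge0 ?expR_ge0.
by case: (ger0P (ckern t - ckern_relax t)) => h1; lra.
Qed.

(** Both functions vanish at 0, and the derivative of [ckern_relax] is at most that of [igamma]. *)
Lemma ckern_relax_le t : 0 <= t -> ckern_relax t <= gammaI (1 - b).
Proof.
move=> t0; apply: le_trans (igamma_le t); rewrite -subr_le0.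
have -> : 0 = ckern_relax 0 - igamma 0 by rewrite /ckern_relax vconv0// /igamma prim0 subrr.
apply: (@ler0_le R (fun t => ckern_relax t - igamma t) (fun t => ckern t - ckern_relax t - igammaf t)) => //.
- by apply: czero_within; exact: czero_B czero_ckern_relax czero_igamma.
- by move=> x /andP[x0 _]; exact: isd_B (isd_ckern_relax x0) (isd_igamma x0).
- by move=> x /andP[x0 _]; rewrite subr_le0; exact: ckern_relax_deriv_le.
Qed.

Lemma ckern_le1 t : 1 <= t -> ckern t <= 1.
Proof.
move=> t1; rewrite /ckern (_ : 1 - b - 1 = - b); last by ring.
rewrite powRN invf_le1 ?powR_gt0 ?(lt_le_trans ltr01 t1)//.
by apply: ge1_powR => //; move: b01; lra.
Qed.

(** Both [igamma] and igamma - ckern_relax are nondecreasing and bounded above on [1, +oo[, so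
    [ckern_relax] has a limit. Its derivative is Lipschitz there, so it tends to 0 by Barbalat's
    lemma; this derivative is ckern - ckern_relax and [ckern] tends to 0, which forces the limit to
    be 0. *)
Lemma ckern_relax_cvg0 : ckern_relax x @[x --> +oo] --> (0 : R).
Proof.
have [l ql] : exists l, (fun t => igamma t - ckern_relax t) x @[x --> +oo] --> l.
  apply: (@nondec_cvg _ (gammaI (1 - b))).
    move=> s t /andP[s1 st]; have s0 : 0 < s by exact: lt_le_trans s1.
    have := @ler0_le R (fun t => ckern_relax t - igamma t) (fun t => ckern t - ckern_relax t - igammaf t) s t st.
    move=> h; suff hh : ckern_relax t - igamma t <= ckern_relax s - igamma s by rewrite /= -(opprB (ckern_relax t)) -(opprB (ckern_relax s)) lerN2.
    apply: h.
    - by apply: cpos_within => // u u0; have [h _] := czero_B czero_ckern_relax czero_igamma; exact: h.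
    - by move=> x /andP[sx _]; have x0 := lt_trans s0 sx; exact: isd_B (isd_ckern_relax x0) (isd_igamma x0).
    - by move=> x /andP[sx _]; have x0 := lt_trans s0 sx; rewrite subr_le0; exact: ckern_relax_deriv_le.
  by move=> t _; have := igamma_le t; have := ckern_relax_ge0 t; lra.
have [l' pl] : exists l, igamma x @[x --> +oo] --> l.
  apply: (@nondec_cvg _ (gammaI (1 - b))); last by move=> t _; exact: igamma_le.
  move=> s t /andP[s1 st]; have s0 : 0 < s by exact: lt_le_trans s1.
  have := @ler0_le R (fun t => 0 - igamma t) (fun t => 0 - igammaf t) s t st.
  move=> h; suff : 0 - igamma t <= 0 - igamma s by lra.
  apply: h.
  - by apply: cpos_within => // u u0; have [h _] := czero_B (czero_cst 0) czero_igamma; exact: h.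
  - by move=> x /andP[sx _]; have x0 := lt_trans s0 sx; exact: isd_B (isd_cst x 0) (isd_igamma x0).
  - by move=> x /andP[sx _]; have x0 := lt_trans s0 sx; rewrite sub0r oppr_le0 mulr_ge0 ?powR_ge0 ?expR_ge0.
have qcv : ckern_relax x @[x --> +oo] --> l' - l.
  have -> : ckern_relax = fun x => igamma x - (igamma x - ckern_relax x) by apply/funext => x; ring.
  exact: cvgB pl ql.
have dk (t : R) : 0 < t -> is_derive t 1 ckern ((1 - b - 1) * t `^ (1 - b - 1 - 1)).
  by move=> t0; exact: isd_powR.
have q'L : forall s t, 1 <= s <= t -> `|(ckern t - ckern_relax t) - (ckern s - ckern_relax s)| <= (b + (1 + gammaI (1 - b))) * (t - s).
  apply: (@lipschitz_bound _ (fun t => (1 - b - 1) * t `^ (1 - b - 1 - 1) - (ckern t - ckern_relax t))).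
    by move=> t t1; have t0 := lt_le_trans ltr01 t1; exact: isd_B (dk t t0) (isd_ckern_relax t0).
  move=> t t1; have t0 := lt_le_trans ltr01 t1; apply: (le_trans (ler_normB _ _)); apply: lerD.
    rewrite (_ : 1 - b - 1 = - b); last by ring.
    rewrite mulNr normrN ger0_norm; last by rewrite mulr_ge0 ?powR_ge0//; move: b01; lra.
    rewrite -[leRHS]mulr1 ler_wpM2l//; first by move: b01; lra.
    rewrite -opprD powRN invf_le1 ?powR_gt0//.
    by apply: ge1_powR => //; move: b01; lra.
  apply: (le_trans (ler_normB _ _)); rewrite ger0_norm ?powR_ge0// ger0_norm ?ckern_relax_ge0//.
  by apply: lerD; [exact: ckern_le1|apply: ckern_relax_le; exact: ltW].
have dq (t : R) : 1 <= t -> is_derive t 1 ckern_relax (ckern t - ckern_relax t) by move=> t1; apply: isd_ckern_relax; exact: lt_le_trans t1.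
have dq0 := barbalat dq q'L qcv.
have b0 : 0 < b by move: b01; lra.
have k0 := powRN_cvg0 b0.
have -> : ckern_relax = fun x => x `^ (- b) - (ckern x - ckern_relax x).
  by apply/funext => x; rewrite /ckern (_ : 1 - b - 1 = - b); ring.
by rewrite -[X in _ --> X](subr0 (0 : R)); exact: cvgB k0 dq0.
Qed.

End asymptotics.

(** * The energy estimate *)

Section energy.
Context {R : realType}.
Local Notation mu := (@lebesgue_measure R).
Local Notation lintegrable f t := (mu.-integrable `]0, t[ (EFin \o f)).

(** With w = u + iv this is the real part of e^(i b pi/2) w* Q w, in real coordinates. *)
Definition sector (b : R) n (Q : 'M[R]_n) (u v : 'I_n -> R) : R := \sum_i \sum_j
  Q i j * (cos (b * pi / 2) * (u i * u j + v i * v j) + sin (b * pi / 2) * (v i * u j - u i * v j)).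

Lemma sum_subscalar n (Q : 'M[R]_n) d (X : 'I_n -> 'I_n -> R) :
  \sum_i \sum_j (Q - d%:M) i j * X i j = \sum_i \sum_j Q i j * X i j - d * \sum_i X i i.
Proof.
rewrite mulr_sumr -sumrB; apply: eq_bigr => i _.
under eq_bigr do rewrite !mxE mulrBl.
rewrite sumrB; congr (_ - _); rewrite (bigD1 i)//= eqxx mulr1n big1 ?addr0// => j ji.
by rewrite eq_sym (negbTE ji) mulr0n mul0r.
Qed.

Variables (n : nat) (b : R) (P A : 'M[R]_n) (lam del c0 : R).
Hypotheses (b01 : 0 < b < 1) (lam0 : 0 < lam) (del0 : 0 < del) (c00 : 0 < c0).
Hypothesis Psym : forall i j, P i j = P j i.
Hypothesis Plam : forall u : 'I_n -> R, lam * \sum_i u i ^+ 2 <= \sum_i \sum_j P i j * (u i * u j).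
Hypothesis Qdel : forall u v : 'I_n -> R,
  del * \sum_i (u i ^+ 2 + v i ^+ 2) <= sector b (- (P *m A)) u v.

Local Notation J := (vconv (fun s => s `^ (b - 1))).

Lemma czero_J p : czero p -> czero (J p).
Proof. by move=> pc; exact: czero_vconv_powR. Qed.

(** [form_ge0] applied to -P A - del. On the diagonal the antisymmetric part vanishes, and cos(b
    pi/2) <= 1, so the subtraction costs no more than the margin in [Qdel]. *)
Lemma form_lb (r : 'I_n -> R -> R) T : 0 < T -> (forall i, czero (r i)) ->
  del * \sum_i \int[mu]_(t in `]0, T[) (r i t * J (r i) t) <=
  \sum_i \sum_j (- (P *m A)) i j * \int[mu]_(t in `]0, T[) (r i t * J (r j) t).
Proof.
move=> T0 rc.
rewrite -subr_ge0 -(@sum_subscalar n _ del (fun i j => \int[mu]_(t in `]0, T[) (r i t * J (r j) t))).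
apply: form_ge0 => // u v.
rewrite (@sum_subscalar n _ del (fun i j => cos (b * pi / 2) * (u i * u j + v i * v j) + sin (b * pi / 2) * (v i * u j - u i * v j))).
rewrite subr_ge0; apply: le_trans (Qdel u v); rewrite ler_wpM2l ?(ltW del0)//.
apply: ler_sum => i _; rewrite [v i * u i]mulrC subrr mulr0 addr0 -!expr2.
rewrite ler_piMl ?addr_ge0 ?sqr_ge0//; exact: cos_le1.
Qed.

Variables (r f : 'I_n -> R -> R) (h H : R -> R).
Hypothesis rc : forall i, czero (r i).
Hypothesis dr : forall i (t : R), 0 < t -> is_derive t 1 (r i) (c0 * \sum_l A i l * J (r l) t + f i t).
Hypothesis fh : forall i t, 0 < t -> `|f i t| <= h t.
Hypothesis Hc : czero H.
Hypothesis dH : forall t : R, 0 < t -> is_derive t 1 H (h t).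

Let V t := \sum_i \sum_j P i j * (r i t * r j t).
Let CP := \sum_i \sum_j `|P i j|.

Lemma czero_sum2 (g : 'I_n -> 'I_n -> R -> R) : (forall i j, czero (g i j)) ->
  czero (fun t => \sum_i \sum_j g i j t).
Proof. by move=> gc; apply: czero_sum => i; apply: czero_sum => j; exact: gc. Qed.

(* The functional r'Pr + 2 c0 int r'(-P A) J r - 2 m CP H is nonincreasing. *)
Lemma energy T m : 0 < T -> (forall i t, 0 <= t <= T -> `|r i t| <= m) ->
  lam * \sum_i r i T ^+ 2 + 2 * c0 * del * (8 * gammaI (1 - b))^-1 *
    \sum_i \int[mu]_(t in `]0, T[) (relax 1 (r i) t ^+ 2) <= V 0 + 2 * m * CP * (H T - H 0).
Proof.
move=> T0 rm.
have cJ i j : czero (fun t => r i t * J (r j) t) by apply: czero_M => //; exact: czero_J.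
pose I t := \sum_i \sum_j (- (P *m A)) i j * prim (fun t => r i t * J (r j) t) t.
have cI : czero I.
  apply: czero_sum2 => i j; apply: (czero_M (czero_cst _)); apply: czero_prim => t.
  exact: czero_lintegrable.
have cV : czero V by apply: czero_sum2 => i j; exact: (czero_M (czero_cst _) (czero_M (rc i) (rc j))).
pose W t := V t + 2 * c0 * I t - 2 * m * CP * H t.
have cW : czero W.
  exact: (czero_B (czero_D cV (czero_M (czero_cst _) cI)) (czero_M (czero_cst _) Hc)).
pose r' i t := c0 * \sum_l A i l * J (r l) t + f i t.
pose W' t := \sum_i \sum_j P i j * (r' i t * r j t + r i t * r' j t) +
  2 * c0 * (\sum_i \sum_j (- (P *m A)) i j * (r i t * J (r j) t)) - 2 * m * CP * h t.
have dW (t : R) : 0 < t -> is_derive t 1 W (W' t).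
  move=> t0; apply: isd_B; last by apply: isd_Z; exact: dH.
  apply: isd_D.
    apply: isd_sum => i; apply: isd_sum => j; apply: isd_Z; apply: isd_M; exact: dr.
  apply: isd_Z; apply: isd_sum => i; apply: isd_sum => j; apply: isd_Z.
  exact: isd_prim.
(* The symmetry of [P] makes the derivative of r'Pr equal to 2 r'P(c0 A J r + f), and the term in J
   r cancels against the derivative of 2 c0 [I]. Only the forcing is left. *)
have W'E t : W' t = 2 * (\sum_i \sum_j P i j * (r i t * f j t)) - 2 * m * CP * h t.
  rewrite /W'; congr (_ - _).
  have -> : \sum_i \sum_j P i j * (r' i t * r j t + r i t * r' j t) = 2 * \sum_i \sum_j P i j * (r i t * r' j t).
    rewrite mulrC mulr_natr mulr2n.
    under eq_bigr do (under eq_bigr do rewrite mulrDr; rewrite big_split/=).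
    rewrite big_split/=; congr (_ + _).
    rewrite exchange_big/=; apply: eq_bigr => i _; apply: eq_bigr => j _.
    by rewrite Psym; ring.
  rewrite -mulrA -mulrDr; congr (_ * _).
  have -> : \sum_i \sum_j P i j * (r i t * r' j t) = \sum_i \sum_j P i j * (r i t * f j t) +
      c0 * \sum_i \sum_j (P *m A) i j * (r i t * J (r j) t).
    rewrite mulr_sumr -big_split/=; apply: eq_bigr => i _.
    rewrite (_ : \sum_j (P *m A) i j * _ = \sum_j P i j * (r i t * \sum_l A j l * J (r l) t)).
      by rewrite mulr_sumr -big_split/=; apply: eq_bigr => j _; rewrite /r'; ring.
    under eq_bigr do rewrite mxE mulr_suml.
    rewrite exchange_big/=; apply: eq_bigr => j _.
    by rewrite mulrA !mulr_sumr; apply: eq_bigr => l _; ring.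
  rewrite -addrA -mulrDr -big_split/= [X in c0 * X](_ : _ = 0) ?mulr0 ?addr0//.
  apply: big1 => i _; rewrite -big_split/=; apply: big1 => j _.
  have -> : (- (P *m A)) i j = - ((P *m A) i j) by rewrite [LHS]mxE.
  by rewrite mulNr addrN.
(* The forcing term is at most 2 m CP h because |r| <= m up to time [T] and |f| <= h. *)
have W'le t : 0 < t < T -> W' t <= 0.
  move=> /andP[t0 tT]; rewrite W'E subr_le0 (_ : 2 * m * CP * h t = 2 * (CP * (m * h t))); last by ring.
  rewrite ler_pM2l// mulr_suml; apply: ler_sum => i _; rewrite mulr_suml; apply: ler_sum => j _.
  apply: (le_trans (ler_norm _)); rewrite !normrM ler_wpM2l// ler_pM//; last exact: fh.
  by apply: rm; rewrite !ltW.
have WT : W T <= W 0.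
  apply: (@ler0_le R W W') => //; first exact: ltW.
    exact: czero_within.
  by move=> t /andP[t0 _]; exact: dW.
have I0 : I 0 = 0 by apply: big1 => i _; apply: big1 => j _; rewrite prim0 mulr0.
have IT : del * ((8 * gammaI (1 - b))^-1 * \sum_i \int[mu]_(t in `]0, T[) (relax 1 (r i) t ^+ 2)) <= I T.
  apply: le_trans (form_lb T0 rc); rewrite ler_wpM2l ?(ltW del0)// mulr_sumr.
  by apply: ler_sum => i _; exact: form_coercive.
have VT := Plam (fun i => r i T).
have IT' : 2 * c0 * (del * ((8 * gammaI (1 - b))^-1 * \sum_i \int[mu]_(t in `]0, T[) (relax 1 (r i) t ^+ 2))) <= 2 * c0 * I T.
  by rewrite ler_wpM2l ?mulr_ge0 ?(ltW c00).
move: WT; rewrite /W I0 mulr0 addr0 [2 * m * CP * (_ - _)]mulrBr !mulrA in IT' * => WT.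
rewrite -/(V T) in VT; lra.
Qed.

Let N t := \sum_i r i t ^+ 2.

Let gg : 0 < 2 * c0 * del * (8 * gammaI (1 - b))^-1.
Proof.
have b02 : 0 < 1 - b <= 2 by move: b01; lra.
by rewrite !mulr_gt0// invr_gt0 mulr_gt0// gammaI_gt0.
Qed.

Let CP0 : 0 <= CP.
Proof. by apply: sumr_ge0 => i _; apply: sumr_ge0. Qed.

Let V0 : 0 <= V 0.
Proof.
by apply: le_trans (Plam _); rewrite mulr_ge0 ?(ltW lam0)// sumr_ge0// => i _; exact: sqr_ge0.
Qed.

Let rN i t m : N t <= m ^+ 2 -> 0 <= m -> `|r i t| <= m.
Proof.
move=> Nm m0; rewrite -(@ler_pXn2r _ 2) ?nnegrE// real_normK ?num_real//.
apply: le_trans Nm; rewrite /N (bigD1 i)//= lerDl sumr_ge0// => j _; exact: sqr_ge0.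
Qed.

Let I2ge0 T i : 0 <= \int[mu]_(t in `]0, T[) (relax 1 (r i) t ^+ 2).
Proof. by apply: Rintegral_ge0 => t _; exact: sqr_ge0. Qed.

Let key K T : (forall t, 0 < t -> H t - H 0 <= K) -> 0 <= T -> exists2 m, 0 <= m &
  (forall i t, 0 <= t <= T -> `|r i t| <= m) /\ (lam * m ^+ 2 <= V 0 + 2 * m * CP * K \/ m ^+ 2 = N 0).
Proof.
move=> HK T0.
have cN : czero N by apply: czero_sum => i; exact: (czero_M (rc i) (rc i)).
have [ts tsT tsM] := EVT_max T0 (@czero_within _ _ T cN).
have N0 : 0 <= N ts by apply: sumr_ge0 => i _; exact: sqr_ge0.
have bd i t : 0 <= t <= ts -> `|r i t| <= Num.sqrt (N ts).
  move=> /andP[t0 tts]; apply: rN; rewrite ?sqrtr_ge0// sqr_sqrtr//; apply: tsM.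
  by move: tsT; rewrite !in_itv/= t0/= => /andP[_]; exact: le_trans.
exists (Num.sqrt (N ts)); first exact: sqrtr_ge0.
split.
  by move=> i t tT; apply: rN; rewrite ?sqrtr_ge0// sqr_sqrtr//; apply: tsM; rewrite in_itv.
rewrite sqr_sqrtr//; move: tsT; rewrite in_itv/= le_eqVlt => /andP[/predU1P[<-|ts0] _]; first by right.
left; apply: le_trans (le_trans (energy ts0 bd) _).
  by rewrite lerDl mulr_ge0 ?(ltW gg)// sumr_ge0.
by rewrite lerD2l ler_wpM2l ?HK// !mulr_ge0 ?sqrtr_ge0.
Qed.

Lemma energy_bounded K : (forall t, 0 < t -> H t - H 0 <= K) ->
  exists2 B, 0 <= B & forall i t, 0 <= t -> `|r i t| <= B.
Proof.
(* For m >= 1, dividing lam m^2 <= V(0) + 2 m CP K by lam m gives m <= D. This bound does not depend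
   on the horizon. *)
move=> HK; pose D := (V 0 + 2 * CP * `|K|) / lam.
have D0 : 0 <= D by rewrite divr_ge0 ?(ltW lam0)// addr_ge0// !mulr_ge0.
exists (Num.sqrt (N 0) + (1 + D)); first by rewrite !addr_ge0 ?sqrtr_ge0.
move=> i t t0; have [m m0 [mt mD]] := key HK t0.
have tt : 0 <= t <= t by rewrite t0 lexx.
apply: (le_trans (mt i t tt)); case: mD => [mD|mN]; last first.
  by rewrite -mN sqrtr_sqr ger0_norm// lerDl addr_ge0.
apply: (@le_trans _ _ (1 + D)); last by rewrite lerDr sqrtr_ge0.
have [m1|m1] := leP m 1; first by rewrite (le_trans m1)// lerDl.
apply: (@le_trans _ _ D); last by rewrite lerDr.
have m0' : 0 < m by exact: lt_trans m1.
rewrite ler_pdivlMr// -(ler_pM2l m0') (_ : m * (m * lam) = lam * m ^+ 2); last by ring.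
apply: (le_trans mD); rewrite mulrDr; apply: lerD; first by rewrite ler_peMl// ltW.
rewrite (_ : m * (2 * CP * `|K|) = 2 * m * CP * `|K|); last by ring.
by rewrite ler_wpM2l ?ler_norm// !mulr_ge0.
Qed.

(** With K = 0 and zero initial value the quadratic inequality reads lam m^2 <= 0. *)
Lemma energy_zero : (forall t, 0 < t -> H t - H 0 <= 0) -> (forall i, r i 0 = 0) ->
  forall i t, 0 <= t -> r i t = 0.
Proof.
move=> HK r0 i t t0; have [m m0 [mt mD]] := key HK t0.
have tt : 0 <= t <= t by rewrite t0 lexx.
have Vz : V 0 = 0 by apply: big1 => j _; apply: big1 => l _; rewrite r0 mul0r mulr0.
have Nz : N 0 = 0 by apply: big1 => j _; rewrite r0 expr0n.
have m2 : m ^+ 2 = 0.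
  case: mD => [|->//]; rewrite Vz mulr0 addr0 pmulr_rle0// => m2; apply/eqP.
  by rewrite eq_le m2 sqr_ge0.
have mz : m = 0 by apply/eqP; rewrite -sqrf_eq0 m2.
by apply/eqP; rewrite -normr_le0 -mz; exact: mt.
Qed.

Lemma energy_integral K : (forall t, 0 < t -> H t - H 0 <= K) ->
  exists C, forall i t, 0 < t -> \int[mu]_(s in `]0, t[) (relax 1 (r i) s ^+ 2) <= C.
Proof.
move=> HK; have [B B0 rB] := energy_bounded HK.
exists ((V 0 + 2 * B * CP * K) / (2 * c0 * del * (8 * gammaI (1 - b))^-1)) => i t t0.
have rB' j s : 0 <= s <= t -> `|r j s| <= B by move=> /andP[s0 _]; exact: rB.
rewrite ler_pdivlMr// mulrC.
apply: le_trans (le_trans (energy t0 rB') _); last first.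
  by rewrite lerD2l ler_wpM2l ?HK// !mulr_ge0.
apply: (@le_trans _ _ (2 * c0 * del * (8 * gammaI (1 - b))^-1 * \sum_i \int[mu]_(s in `]0, t[) (relax 1 (r i) s ^+ 2))).
  rewrite ler_pM2l// [leRHS](bigD1 i)//= lerDl sumr_ge0// => j _; exact: I2ge0.
by rewrite lerDr mulr_ge0 ?(ltW lam0)// sumr_ge0// => j _; exact: sqr_ge0.
Qed.

(** The averaging weights on []0, t[] have total mass 1 - e^(-t), less than 1. *)
Lemma relax_bounded (B : R) (p : R -> R) : czero p -> (forall t, 0 <= t -> `|p t| <= B) ->
  forall t, 0 < t -> `|relax 1 p t| <= B.
Proof.
move=> pc pB t t0; have ce := @czero_exp R 1.
have B0 : 0 <= B by exact: le_trans (pB 0 (lexx _)).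
have E1 : prim (fun s => expR (1 * s)) t = expR (1 * t) - expR (1 * 0).
  apply: (@FTC_eq R _ (fun s => expR (1 * s))) => //.
  - by move=> s _; apply: isd_eq (isd_exp (isd_Z 1 (isd_id s))) _; rewrite !mulr1.
  - by case: ce.
  - by move=> u; exact: czero_lintegrable.
have le := czero_lintegrable t ce.
have : `|prim (fun s => expR (1 * s) * p s) t| <= B * (expR (1 * t) - expR (1 * 0)).
  rewrite -E1 /prim -RintegralZl//; apply: abs_Rintegral_le => //.
  - by apply: czero_lintegrable; exact: czero_M ce pc.
  - exact: integrable_Z.
  move=> s /=; rewrite in_itv/= => /andP[s0 _]; rewrite normrM mulrC [X in _ * X <= _]ger0_norm ?expR_ge0//.
  by rewrite ler_wpM2r ?expR_ge0// pB// ltW.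
rewrite mulr0 expR0 => h1; rewrite relaxE// normrM ger0_norm ?expR_ge0//.
apply: (@le_trans _ _ (expR (- (1 * t)) * (B * (expR (1 * t) - 1)))); first by rewrite ler_wpM2l ?expR_ge0.
rewrite mulrCA mulrBr -expRD addNr expR0 mulr1 ler_piMr// lerBlDr lerDl expR_ge0//.
Qed.

(** [X] is a bounded primitive of Bp J r, so every unit interval contains a point where J r is
    bounded, and the uniform Hölder estimate spreads this bound to all times. Hence r is Lipschitz.
    The average z has z^2 Lipschitz with finite integral, so z tends to 0; then z' = r - z is
    Lipschitz and tends to 0 as well. *)
Lemma energy_cvg K Bp CX Cf (X : 'I_n -> R -> R) : (forall t, 0 < t -> H t - H 0 <= K) -> 0 < Bp ->
  (forall i (t : R), 0 < t -> is_derive t 1 (X i) (Bp * J (r i) t)) ->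
  (forall i t, 1 <= t -> `|X i t| <= CX) -> (forall i t, 1 <= t -> `|f i t| <= Cf) ->
  forall i, r i x @[x --> +oo] --> (0 : R).
Proof.
move=> HK Bp0 dX XC fC i; have /andP[b0 b1] := b01.
have [B B0 rB] := energy_bounded HK; have [C IC] := energy_integral HK.
have JB l t : 1 <= t -> `|J (r l) t| <= 2 * CX / Bp + 2 * B / b.
  move=> t1; have t0 : 0 < t by exact: lt_le_trans t1.
  have tt : t < t + 1 by rewrite ltrDl.
  have dh x : x \in `]t, t + 1[ -> is_derive x 1 (X l) (Bp * J (r l) x).
    by rewrite in_itv/= => /andP[tx _]; apply: dX; exact: lt_trans tx.
  have cf : {within `[t, t + 1], continuous X l}.
    by apply: cpos_within => // x x0; apply: isd_cont; exact: dX.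
  have [c] := MVT tt dh cf; rewrite in_itv/= addrAC subrr add0r mulr1 => /andP[tc ct] E.
  have h1 : `|J (r l) c| <= 2 * CX / Bp.
    rewrite ler_pdivlMr// mulrC -{1}(gtr0_norm Bp0) -normrM -E (le_trans (ler_normB _ _))//.
    have h1 := XC l t t1; have h2 : `|X l (t + 1)| <= CX by apply: XC; rewrite lerDr ltW.
    lra.
  (* The horizon is taken to be [c] itself; the Hölder constant depends only on the global bound
     [B], and c - t <= 1. *)
  have h2 : `|J (r l) c - J (r l) t| <= 2 * B / b.
    have ct0 : 0 <= c - t by rewrite subr_ge0 ltW.
    have := @vconv_powR_holder R b (r l) B (t + (c - t)) t (c - t) b01 (rc l).
    rewrite subrKC => /(_ _ (ltW t0) ct0 (lexx _)) h2.
    apply: (le_trans (h2 _)); first by move=> s /andP[s0 _]; exact: rB.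
    rewrite mulrA ler_wpM2r ?invr_ge0 ?(ltW b0)// ler_piMr// ?mulr_ge0//.
    have c1 : c - t <= 1 by rewrite lerBlDl addrC (le_trans (ltW ct))// addrC.
    have := ge0_ler_powR (ltW b0) _ _ c1; rewrite powR1; apply; rewrite nnegrE//.
  rewrite -[J (r l) t](subKr (J (r l) c)).
  by apply: (le_trans (ler_normB _ _)); apply: lerD.
pose CJ := 2 * CX / Bp + 2 * B / b.
pose L1 := c0 * (\sum_l `|A i l| * CJ) + Cf.
have rL : forall s t, 1 <= s <= t -> `|r i t - r i s| <= L1 * (t - s).
  apply: lipschitz_bound.
    by move=> t t1; apply: dr; exact: lt_le_trans t1.
  move=> t t1; apply: (le_trans (ler_normD _ _)); apply: lerD; last exact: fC.
  rewrite normrM (gtr0_norm c00) ler_pM2l//.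
  apply: (le_trans (ler_norm_sum _ _ _)); apply: ler_sum => l _.
  by rewrite normrM ler_wpM2l//; exact: JB.
pose z := relax 1 (r i).
have zB t : 0 < t -> `|z t| <= B by move=> t0; exact: (relax_bounded (rc i) (rB i) t0).
have dz (t : R) : 0 < t -> is_derive t 1 z (r i t - z t).
  by move=> t0; apply: isd_eq (isd_relax 1 (rc i) t0) _; rewrite mul1r.
have z'B t : 1 <= t -> `|r i t - z t| <= 2 * B.
  move=> t1; have t0 := lt_le_trans ltr01 t1; apply: (le_trans (ler_normB _ _)).
  by have := rB i t (ltW t0); have := zB t t0; lra.
have dz1 (t : R) : 1 <= t -> is_derive t 1 z (r i t - z t).
  by move=> t1; apply: dz; exact: lt_le_trans t1.
have zc : czero z by exact: czero_relax.
have z2c : czero (fun t => z t ^+ 2) by exact: (czero_M zc zc).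
have dz2 (t : R) : 1 <= t -> is_derive t 1 (fun t => z t ^+ 2) (2 * z t * (r i t - z t)).
  by move=> t1; apply: isd_eq (isd_M (dz1 t t1) (dz1 t t1)) _; ring.
have z2L : forall s t, 1 <= s <= t -> `|z t ^+ 2 - z s ^+ 2| <= 2 * B * (2 * B) * (t - s).
  apply: (lipschitz_bound dz2) => t t1; rewrite !normrM ler_pM// ?mulr_ge0//; last exact: z'B.
  by rewrite ger0_norm// ler_wpM2l//; apply: zB; exact: lt_le_trans t1.
have dG (t : R) : 1 <= t -> is_derive t 1 (prim (fun t => z t ^+ 2)) (z t ^+ 2).
  by move=> t1; apply: isd_prim => //; exact: lt_le_trans t1.
have [l Gl] : exists l : R, prim (fun t => z t ^+ 2) x @[x --> +oo] --> l.
  apply: (@nondec_cvg _ _ C).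
    move=> s t /andP[s1 st]; have s0 := lt_le_trans ltr01 s1.
    rewrite /prim (@lint_split _ _ s t) ?(ltW s0)//; last exact: czero_lintegrable.
    by rewrite lerDl; apply: Rintegral_ge0 => u _; exact: sqr_ge0.
  by move=> t t1; apply: IC; exact: lt_le_trans t1.
have z20 := barbalat dG z2L Gl.
have z0 : z x @[x --> +oo] --> (0 : R).
  apply/cvg_pinftyE => e e0.
  have [M M1 MP] := (cvg_pinftyE _ _).1 z20 (e ^+ 2) (exprn_gt0 2 e0).
  exists M => // t /MP; rewrite !subr0 normrX => h2.
  by rewrite -(@ler_pXn2r _ 2) ?nnegrE// ltW.
have z'L : forall s t, 1 <= s <= t -> `|(r i t - z t) - (r i s - z s)| <= (L1 + 2 * B) * (t - s).
  move=> s t st; rewrite (_ : _ - _ = (r i t - r i s) - (z t - z s)); last by ring.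
  apply: (le_trans (ler_normB _ _)); rewrite mulrDl; apply: lerD; first exact: rL.
  by apply: (lipschitz_bound dz1 z'B).
have z'0 := barbalat dz1 z'L z0.
have -> : r i = fun t => (r i t - z t) + z t by apply/funext => t; rewrite subrK.
by rewrite -[X in _ --> X](addr0 (0 : R)); exact: cvgD.
Qed.

End energy.

(** * Caputo derivatives and stability *)

Section caputo.
Context {R : realType}.
Local Notation mu := (@lebesgue_measure R).
Local Notation lintegrable f t := (mu.-integrable `]0, t[ (EFin \o f)).

Lemma GammaE (p : R) : Gamma p = gammaI p.
Proof. by apply: eq_Rintegral => t _; rewrite mul1r. Qed.

Lemma derive1n2 (f : R -> R) : f^`(2)%classic = (f^`()^`())%classic.
Proof. by rewrite derive1nS derive1n1. Qed.

Section domain.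
Variable f : R -> R.
Hypothesis fd : caputo_dom f.

Lemma caputo_czero : czero f.
Proof. by apply/czeroP; case: fd. Qed.

Lemma caputo_isd (t : R) : 0 < t -> is_derive t 1 f (f^`()%classic t).
Proof. by case: fd => _ _ h _ /h[h1 _ _]; exact: derivable_isd. Qed.

Lemma caputo_isd2 (t : R) : 0 < t -> is_derive t 1 f^`()%classic (f^`(2)%classic t).
Proof. by case: fd => _ _ h _ /h[_ h1 _]; rewrite derive1n2; exact: derivable_isd. Qed.

Lemma caputo_cpos2 : cpos f^`(2)%classic.
Proof. by case: fd => _ _ h _ t /h[]. Qed.

Lemma caputo_lint2 t : lintegrable f^`(2)%classic t.
Proof.
have [t0|t0] := leP t 0; first by rewrite set_itv_ge ?bnd_simp -?leNgt//; exact: integrable_set0.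
by case: fd => _ _ _; exact.
Qed.

Lemma caputo_deriv (v t : R) : f^`()%classic t @[t --> 0^'+] --> v -> 0 < t ->
  f^`()%classic t = v + prim f^`(2)%classic t.
Proof.
(* The derivative at 0 is two-sided and depends on negative times, so it is replaced there by its
   right limit [v]; this makes [F] a [czero] function. *)
move=> fv t0; pose F t := if t <= 0 then v else f^`()%classic t.
have FE u : 0 < u -> F u = f^`()%classic u by rewrite /F leNgt => ->.
have dF (u : R) : 0 < u -> is_derive u 1 F (f^`(2)%classic u).
  move=> u0; apply: isd_near (caputo_isd2 u0); near=> y; rewrite FE//; near: y; exact: near_pos.
have cF : czero F.
  split; first by move=> u u0; exact: isd_cont (dF u u0).
  rewrite {2}/F lexx; apply: cvg_trans fv; apply: near_eq_cvg; near=> y.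
  by rewrite FE//; near: y; exact: nbhs_right_gt.
rewrite /prim (@FTC_eq R _ F t t0)//; first by rewrite FE// /F lexx subrKC.
  exact: caputo_cpos2.
exact: caputo_lint2.
Unshelve. all: by end_near. Qed.

End domain.

Lemma cvg_sum0 (I : Type) (s : seq I) (g : I -> R -> R) :
  (forall i, g i t @[t --> +oo] --> (0 : R)) -> \sum_(i <- s) g i t @[t --> +oo] --> (0 : R).
Proof.
move=> g0; elim: s => [|i s IHs].
  by under eq_fun do rewrite big_nil; exact: cvg_cst.
have h := cvgD (g0 i) IHs; rewrite addr0 in h.
by under eq_fun do rewrite big_cons; exact: h.
Qed.

Section system.
Variables (n : nat) (b : R) (A : 'M[R]_n) (x : 'I_n -> R -> R) (v : 'I_n -> R).
Hypotheses (b01 : 0 < b < 1) (xd : forall i, caputo_dom (x i)).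
Hypothesis xv : forall i, (x i)^`()%classic t @[t --> 0^'+] --> v i.
Hypothesis eqx : forall i t, 0 < t -> caputo (1 + b) (x i) t = \sum_j A i j * x j t.

Let G := gammaI (1 - b).
Let Bp := (Beta b (1 - b))^-1.
Local Notation J := (vconv (fun s => s `^ (b - 1))).

Let b1_01 : 0 < 1 - b <= 2. Proof. by move: b01; lra. Qed.
Let b1_0 : 0 < 1 - b. Proof. by move: b01; lra. Qed.
Let b0 : 0 < b. Proof. by move: b01; lra. Qed.
Let G0 : 0 < G. Proof. exact: gammaI_gt0. Qed.
Let Bp0 : 0 < Bp. Proof. by rewrite invr_gt0 Beta_gt0. Qed.

(* resp is the convolution of x'' + v e^(-t) with the Caputo kernel;
   the term in v makes J resp proportional to x' - v e^(-t) rather than x' - v. *)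
Definition resp i t := G * \sum_j A i j * x j t + ckern_relax b t * v i.
Let y i t := (x i)^`(2)%classic t + v i * expR (- (1 * t)).

Let ycpos i : cpos (y i).
Proof.
move=> t t0; apply: continuousD; first exact: caputo_cpos2.
by apply: isd_cont; exact: isd_Z (v i) (isd_expN 1 t).
Qed.

Let ly i t : lintegrable (y i) t.
Proof.
apply: integrable_D => //; first exact: caputo_lint2.
by apply: integrable_Z => //; apply: czero_lintegrable; exact: czero_expN.
Qed.

Lemma czero_resp i : czero (resp i).
Proof.
apply: czero_D; last by apply: (czero_M _ (czero_cst _)); exact: czero_ckern_relax.
apply: (czero_M (czero_cst _)); apply: czero_sum => j; apply: (czero_M (czero_cst _)).
exact: caputo_czero.
Qed.

Lemma respE i t : 0 < t -> resp i t = vconv (@ckern R b) (y i) t.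
Proof.
move=> t0; rewrite /resp -eqx// /caputo.
have -> : 2 - (1 + b) = 1 - b by ring.
have -> : 1 - (1 + b) = 1 - b - 1 by ring.
rewrite GammaE -/G mulVKf; last by rewrite gt_eqF.
have l1 : lintegrable (fun s => ckern b (t - s) * (x i)^`(2)%classic s) t.
  by apply: lintegrable_powR_conv => //; [exact: caputo_lint2|exact: caputo_cpos2].
have l2 : lintegrable (fun s => ckern b (t - s) * expR (- (1 * s))) t.
  by apply: lintegrable_powR_conv => //; [apply: czero_lintegrable; exact: czero_expN|case: (@czero_expN R)].
rewrite /ckern_relax /vconv -RintegralZr// -RintegralD//; last exact: integrable_Zr.
by apply: eq_Rintegral => s _; rewrite /y /ckern; ring.
Qed.

(** Abel inversion: the convolution of t^(b-1) with t^(-b) is the constant Beta(b, 1 - b), so J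
    undoes the Caputo kernel up to one integration. *)
Lemma J_resp i t : 0 < t -> J (resp i) t = Beta b (1 - b) * prim (y i) t.
Proof.
move=> t0; have B0 := Beta_gt0 b0 b1_0.
transitivity (vconv (fun s => s `^ (b - 1)) (vconv (@ckern R b) (y i)) t).
  apply: eq_vconv => // s; rewrite in_itv/= => /andP[s0 _]; exact: respE.
rewrite (@vconv_assoc R (Beta b (1 - b)))//; last 3 first.
- exact: lintegrable_powR.
- exact: lintegrable_powR.
- move=> u /andP[u0 ut]; have := beta_integral b0 b1_0 u0.
  rewrite (_ : b + (1 - b) - 1 = 0); last by ring.
  rewrite powRr0 mulr1 => <-; rewrite le_eqVlt; apply/orP; left; apply/eqP.
  by apply: eq_integral => s _; rewrite ger0_norm// mulr_ge0 ?powR_ge0.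
rewrite /prim -(@RintegralZl _ _ R mu _ _ (Beta b (1 - b)) (measurable_itv _) (ly i t)).
apply: eq_Rintegral => s; rewrite inE/= in_itv/= => /andP[s0 st].
have ts0 : 0 < t - s by rewrite subr_gt0.
rewrite (vconv_powR b0 b1_0 ts0) (_ : b + (1 - b) - 1 = 0); last by ring.
by rewrite powRr0 mulr1.
Qed.

Lemma primyE i t : 0 < t -> prim (y i) t = (x i)^`()%classic t - v i * expR (- (1 * t)).
Proof.
move=> t0; rewrite (caputo_deriv (xd i) (@xv i) t0).
have le u : lintegrable (fun t => expR (- (1 * t))) u by apply: czero_lintegrable; exact: czero_expN.
rewrite /prim RintegralD//; [|exact: caputo_lint2|exact: integrable_Z].
rewrite RintegralZl// (_ : \int[mu]_(s in `]0, t[) expR (- (1 * s)) = 1 - expR (- (1 * t))); first by ring.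
transitivity ((fun t => - expR (- (1 * t))) t - (fun t => - expR (- (1 * t))) 0); last first.
  by rewrite mulr0 oppr0 expR0; ring.
apply: (@FTC_eq R _ (fun t => - expR (- (1 * t))) t t0) => //.
- by have := czero_M (czero_cst (-1)) (@czero_expN R); under eq_fun do rewrite mulN1r.
- by move=> u u0; apply: isd_eq (isd_N (isd_expN 1 u)) _; rewrite mulN1r opprK.
- by case: (@czero_expN R).
Qed.

Lemma state_deriv i (t : R) : 0 < t -> is_derive t 1 (x i) (Bp * J (resp i) t + v i * expR (- (1 * t))).
Proof.
move=> t0; apply: isd_eq (caputo_isd (xd i) t0) _.
rewrite J_resp// primyE// /Bp mulKf ?subrK//.
by rewrite gt_eqF// Beta_gt0.
Qed.

Let f i t := G * expR (- (1 * t)) * (\sum_j A i j * v j) + (ckern b t - ckern_relax b t) * v i.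

Lemma resp_deriv i (t : R) : 0 < t ->
  is_derive t 1 (resp i) (G * Bp * \sum_j A i j * J (resp j) t + f i t).
Proof.
move=> t0.
have d : is_derive t 1 (fun t => \sum_j A i j * x j t) (\sum_j A i j * (Bp * J (resp j) t + v j * expR (- (1 * t)))).
  by apply: isd_sum => j; apply: isd_Z; exact: state_deriv.
apply: isd_eq (isd_D (isd_Z G d) (isd_M (isd_ckern_relax b01 t0) (isd_cst t (v i)))) _.
have -> : \sum_j A i j * (Bp * J (resp j) t + v j * expR (- (1 * t))) =
    Bp * (\sum_j A i j * J (resp j) t) + expR (- (1 * t)) * (\sum_j A i j * v j).
  by rewrite !mulr_sumr -big_split; apply: eq_bigr => j _ /=; ring.
by rewrite /f; ring.
Qed.

Let cst := \sum_i (G * `|\sum_j A i j * v j| + `|v i|).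
(** A majorant of all components of the forcing with an explicit primitive. The increments of [H]
    are bounded because [igamma] is bounded above and [ckern_relax] is nonnegative. *)
Let h t := cst * (expR (- (1 * t)) + (2 * igammaf b t - (ckern b t - ckern_relax b t))).
Let H t := cst * (- expR (- (1 * t)) + (2 * igamma b t - ckern_relax b t)).

Let cst_ge i : G * `|\sum_j A i j * v j| + `|v i| <= cst.
Proof.
rewrite /cst [leRHS](bigD1 i)//= lerDl; apply: sumr_ge0 => j _.
by rewrite addr_ge0// mulr_ge0// ltW.
Qed.

Let cst0 : 0 <= cst.
Proof. by apply: sumr_ge0 => j _; rewrite addr_ge0// mulr_ge0// ltW. Qed.

Let fh i t : 0 < t -> `|f i t| <= h t.
Proof.
move=> t0; have h1 := ckern_relax_deriv_abs b01 t0; have h2 := cst_ge i.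
have e0 := expR_ge0 (- (1 * t)); have q0 := le_trans (normr_ge0 _) h1.
rewrite /h mulrDr; apply: (le_trans (ler_normD _ _)); apply: lerD.
  rewrite !normrM (gtr0_norm G0) (ger0_norm e0) mulrAC ler_wpM2r//.
  by apply: le_trans h2; rewrite lerDl.
rewrite normrM mulrC ler_pM//; apply: le_trans h2.
by rewrite lerDr mulr_ge0// ltW.
Qed.

Let Hc : czero H.
Proof.
apply: (czero_M (czero_cst _)); apply: czero_D.
  by have := czero_M (czero_cst (-1)) (@czero_expN R); under eq_fun do rewrite mulN1r.
by apply: czero_B; [apply: (czero_M (czero_cst _)); exact: czero_igamma|exact: czero_ckern_relax].
Qed.

Let dH (t : R) : 0 < t -> is_derive t 1 H (h t).
Proof.
move=> t0; apply: isd_Z; apply: isd_D.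
  by apply: isd_eq (isd_N (isd_expN 1 t)) _; rewrite mulN1r opprK.
by apply: isd_B; [apply: isd_Z; exact: isd_igamma|exact: isd_ckern_relax].
Qed.

Let HK t : 0 < t -> H t - H 0 <= cst * (1 + 2 * G).
Proof.
move=> t0; rewrite /H -mulrBr ler_wpM2l//.
have -> : ckern_relax b 0 = 0 by exact: vconv0.
have -> : igamma b 0 = 0 by exact: prim0.
rewrite !mulr0 oppr0 expR0.
have h1 := igamma_le b01 t; have h2 := ckern_relax_ge0 b t; have h3 := expR_ge0 (- (1 * t)).
rewrite -/G in h1; lra.
Qed.

Variables (P : 'M[R]_n) (lam del : R).
Hypotheses (lam0 : 0 < lam) (del0 : 0 < del) (Au : A \in unitmx).
Hypothesis Psym : forall i j, P i j = P j i.
Hypothesis Plam : forall u : 'I_n -> R, lam * \sum_i u i ^+ 2 <= \sum_i \sum_j P i j * (u i * u j).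
Hypothesis Qdel : forall u w : 'I_n -> R,
  del * \sum_i (u i ^+ 2 + w i ^+ 2) <= sector b (- (P *m A)) u w.

Let GBp : 0 < G * Bp. Proof. exact: mulr_gt0. Qed.

Let xE i t : x i t = \sum_j invmx A i j * ((resp j t - ckern_relax b t * v j) / G).
Proof.
transitivity ((invmx A *m (A *m (\col_j x j t))) i 0).
  by rewrite mulKmx// mxE.
rewrite mxE; apply: eq_bigr => j _; congr (_ * _).
rewrite /resp addrK mulrC mulKf ?gt_eqF// mxE; apply: eq_bigr => l _.
by rewrite mxE.
Qed.

Lemma state_zero : (forall i, v i = 0) -> (forall i, x i 0 = 0) -> forall i t, 0 <= t -> x i t = 0.
Proof.
move=> v0 x0 i t t0.
(* Zero initial velocity kills the whole forcing bound, so [H] is constant and [energy_zero]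
   applies. *)
have cz : cst = 0.
  apply: big1 => j _; rewrite v0 normr0 addr0 big1 ?normr0 ?mulr0// => l _.
  by rewrite v0 mulr0.
have HK0 u : 0 < u -> H u - H 0 <= 0 by move=> /HK; rewrite cz mul0r.
have r0 j : resp j 0 = 0.
  by rewrite /resp v0 mulr0 addr0 big1 ?mulr0// => l _; rewrite x0 mulr0.
have := energy_zero b01 lam0 del0 GBp Psym Plam Qdel czero_resp resp_deriv fh Hc dH HK0 r0.
move=> rz; rewrite xE big1// => j _; rewrite rz// v0 mulr0 subrr mul0r mulr0//.
Qed.

Lemma state_cvg i : x i t @[t --> +oo] --> (0 : R).
Proof.
have [B B0 rB] := energy_bounded b01 lam0 del0 GBp Psym Plam Qdel czero_resp resp_deriv fh Hc dH HK.
pose Cx := \sum_i \sum_j `|invmx A i j| * ((B + G * `|v j|) / G).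
have xB j t : 0 <= t -> `|x j t| <= Cx.
  move=> t0; rewrite xE; apply: (@le_trans _ _ (\sum_l `|invmx A j l| * ((B + G * `|v l|) / G))).
    apply: (le_trans (ler_norm_sum _ _ _)); apply: ler_sum => l _.
    rewrite normrM ler_wpM2l// normrM normfV (gtr0_norm G0) ler_wpM2r ?invr_ge0 ?(ltW G0)//.
    apply: (le_trans (ler_normB _ _)); apply: lerD; first exact: rB.
    rewrite normrM ler_wpM2r// ger0_norm ?ckern_relax_ge0//; exact: ckern_relax_le.
  rewrite /Cx [leRHS](bigD1 j)//= lerDl; apply: sumr_ge0 => l _; apply: sumr_ge0 => m _.
  by rewrite mulr_ge0// divr_ge0 ?(ltW G0)// addr_ge0// mulr_ge0// ltW.
(* This is x + v e^(-t): adding the exponential removes the non-homogeneous term of [state_deriv],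
   and the sum remains bounded. *)
pose X j t := x j t - - (v j * expR (- (1 * t))).
pose CX := Cx + \sum_j `|v j|.
have XC j t : 1 <= t -> `|X j t| <= CX.
  move=> t1; have t0 : 0 <= t by exact: le_trans t1.
  apply: (le_trans (ler_normB _ _)); apply: lerD; first exact: xB.
  rewrite normrN normrM (ger0_norm (expR_ge0 _)).
  apply: (@le_trans _ _ `|v j|); first by rewrite ler_piMr// expR_le1 mul1r oppr_le0.
  by rewrite (bigD1 j)//= lerDl sumr_ge0.
have dX j (t : R) : 0 < t -> is_derive t 1 (X j) (Bp * J (resp j) t).
  move=> t0; apply: isd_eq (isd_B (state_deriv j t0) (isd_N (isd_Z (v j) (isd_expN 1 t)))) _.
  by rewrite mulN1r mulrN opprK addrK.
pose Cf := cst * (1 + (1 + G)).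
have fC j t : 1 <= t -> `|f j t| <= Cf.
  move=> t1; have t0 : 0 < t by exact: lt_le_trans t1.
  have e0 := expR_ge0 (- (1 * t)); have e1 : expR (- (1 * t)) <= 1 by rewrite expR_le1 mul1r oppr_le0 ltW.
  have h2 := cst_ge j.
  rewrite /Cf mulrDr; apply: (le_trans (ler_normD _ _)); apply: lerD.
    rewrite !normrM (gtr0_norm G0) (ger0_norm e0) mulrAC ler_pM// ?mulr_ge0 ?(ltW G0)//.
    by apply: le_trans h2; rewrite lerDl.
  rewrite normrM mulrC ler_pM//; first by apply: le_trans h2; rewrite lerDr mulr_ge0// ltW.
  apply: (le_trans (ler_normB _ _)); apply: lerD.
    by rewrite ger0_norm ?powR_ge0//; exact: ckern_le1.
  by rewrite ger0_norm ?ckern_relax_ge0//; apply: ckern_relax_le => //; exact: ltW.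
have rcv j := energy_cvg b01 lam0 del0 GBp Psym Plam Qdel czero_resp resp_deriv fh Hc dH HK Bp0 dX XC fC j.
have q0 := ckern_relax_cvg0 b01.
rewrite (_ : x i = fun t => \sum_j invmx A i j * ((resp j t - ckern_relax b t * v j) / G)); last by apply/funext => t; exact: xE.
apply: cvg_sum0 => j.
suff h0 : (resp j t - ckern_relax b t * v j) / G @[t --> +oo] --> (0 : R).
  by rewrite -[X in _ --> X](mulr0 (invmx A i j)); exact: cvgMr.
rewrite -[X in _ --> X](mul0r G^-1); apply: cvgMl.
rewrite -[X in _ --> X](subr0 (0 : R)); apply: cvgB; first exact: rcv.
by rewrite -[X in _ --> X](mul0r (v j)); exact: cvgMl.
Qed.

End system.
End caputo.

(** * Existence by Picard iteration *)

Section picard.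
Context {R : realType}.
Local Notation mu := (@lebesgue_measure R).
Local Notation lintegrable f t := (mu.-integrable `]0, t[ (EFin \o f)).

Lemma geo_series (u : nat -> R) D : (forall m, `|u m| <= D * 2^-1 ^+ m) ->
  forall m, `|limn (series u) - series u m| <= 2 * D * 2^-1 ^+ m.
Proof.
move=> uD.
have D0 : 0 <= D by have := le_trans (normr_ge0 _) (uD 0%N); rewrite expr0 mulr1.
have hcv : cvgn (series u).
  apply: normed_cvg; apply: (@series_le_cvg _ _ (geometric D 2^-1)) => //.
  - by move=> k; exact: normr_ge0.
  - by move=> k; rewrite /= mulr_ge0// exprn_ge0.
  - apply: is_cvg_geometric_series; rewrite ger0_norm//; lra.
have tail (m j : nat) : `|series u (m + j)%N - series u m| <= 2 * D * 2^-1 ^+ m - 2 * D * 2^-1 ^+ (m + j)%N.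
  elim: j => [|j IH]; first by rewrite addn0 !subrr normr0.
  rewrite addnS /series/= big_nat_recr//= -/(series u (m + j)%N).
  rewrite (_ : _ + _ - _ = (series u (m + j)%N - series u m) + u (m + j)%N); last by rewrite /series/=; ring.
  apply: (le_trans (ler_normD _ _)); have := uD (m + j)%N; move: IH; rewrite exprS; lra.
move=> m; apply/ler_addgt0Pr => e e0.
have /cvgrPdist_le /(_ e e0) [N _ NP] := hcv.
rewrite (_ : _ - _ = (limn (series u) - series u (m + N)%N) + (series u (m + N)%N - series u m)); last by ring.
apply: (le_trans (ler_normD _ _)); rewrite addrC; apply: lerD.
  by apply: (le_trans (tail m N)); rewrite lerBlDr lerDl !mulr_ge0// exprn_ge0.
by apply: NP; rewrite /= leq_addl.
Qed.

Lemma czero_unif (f : R -> R) :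
  (forall T e : R, 0 < T -> 0 < e -> exists2 g, czero g & forall t, 0 <= t <= T -> `|f t - g t| <= e) -> czero f.
Proof.
move=> fu; split.
  move=> t t0; apply/cvgrPdist_le => e e0.
  have T0 : 0 < t + 1 by lra.
  have e3 : 0 < e / 3 by lra.
  have [g [gc _] fg] := fu _ _ T0 e3.
  have /cvgrPdist_le/(_ _ e3) := gc t t0 => gt.
  near=> s.
  have s0 : 0 < s by near: s; exact: near_pos.
  have sT : s < t + 1 by near: s; apply: lt_nbhsl; rewrite ltrDl.
  have h1 : `|g t - g s| <= e / 3 by near: s.
  have h2 : `|f t - g t| <= e / 3 by apply: fg; lra.
  have h3 : `|f s - g s| <= e / 3 by apply: fg; lra.
  move: h1 h2 h3; rewrite !ler_norml => /andP[? ?] /andP[? ?] /andP[? ?]; lra.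
apply/cvgrPdist_le => e e0.
have e3 : 0 < e / 3 by lra.
have [g [_ gc] fg] := fu 1 _ ltr01 e3.
have /cvgrPdist_le/(_ _ e3) := gc => gt.
near=> s.
have s0 : 0 < s by near: s; exact: nbhs_right_gt.
have sT : s < 1 by near: s; exact: nbhs_right_lt.
have h1 : `|g 0 - g s| <= e / 3 by near: s.
have h2 : `|f 0 - g 0| <= e / 3 by apply: fg; lra.
have h3 : `|f s - g s| <= e / 3 by apply: fg; lra.
move: h1 h2 h3; rewrite !ler_norml => /andP[? ?] /andP[? ?] /andP[? ?]; lra.
Unshelve. all: by end_near. Qed.

Variables (n : nat) (b : R) (M : 'M[R]_n) (g : 'I_n -> R -> R).
Hypotheses (b01 : 0 < b < 1) (gc : forall i, czero (g i)).
Local Notation J := (vconv (fun s => s `^ (b - 1))).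

Let b0 : 0 < b. Proof. by move: b01; lra. Qed.

(** Up to the constant Gamma(b), the Riemann-Liouville integral of order 1 + b. *)
Definition primJ f := prim (J f).

Lemma czero_primJ f : czero f -> czero (primJ f).
Proof. by move=> fc; apply: czero_prim => t; apply: czero_lintegrable; exact: czero_J. Qed.

(* In the norm sup |f t| e^(-lam t) the operator primJ is a contraction for large lam. *)
Lemma primJ_bound f (C lam T t : R) : czero f -> 0 <= C -> 0 < lam ->
  (forall s, 0 <= s <= T -> `|f s| <= C * expR (lam * s)) -> 0 <= t <= T ->
  `|primJ f t| <= C * (T `^ b / b) / lam * expR (lam * t).
Proof.
move=> fc C0 lam0 fC /andP[t0 tT].
have Tb0 : 0 <= T `^ b / b by rewrite divr_ge0 ?powR_ge0// ltW.
have Jb s : 0 < s < t -> `|J f s| <= C * (T `^ b / b) * expR (lam * s).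
  move=> /andP[s0 st]; apply: (@le_trans _ _ (C * expR (lam * s) * (s `^ b / b))).
    rewrite -(integral_powR b0 (ltW s0)) -(@RintegralZl _ _ R mu _ _ _ (measurable_itv _) (lintegrable_powR s b0)).
    rewrite -[X in _ <= X](_ : vconv (fun s => s `^ (b - 1)) (fun _ => C * expR (lam * s)) s = _); last first.
      rewrite vconv_comm//; first by apply: cpos_measurable_itv; exact: cpos_powR.
    have l1 : lintegrable (fun u => (s - u) `^ (b - 1) * (C * expR (lam * s))) s.
      by apply: lintegrable_vconv_powR => //; exact: czero_cst.
    apply: abs_Rintegral_le => //; first exact: lintegrable_vconv_powR.
    move=> u /=; rewrite in_itv/= => /andP[u0 us]; rewrite normrM ger0_norm ?powR_ge0// ler_wpM2l ?powR_ge0//.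
    apply: (le_trans (fC u _)); first by rewrite (ltW u0)/= (le_trans (ltW us))// (le_trans (ltW st)).
    by rewrite ler_wpM2l// ler_expR ler_pM2l// ltW.
  rewrite mulrAC ler_wpM2r ?expR_ge0// ler_wpM2l// ler_wpM2r ?invr_ge0 ?(ltW b0)//.
  have sT : s <= T by rewrite (le_trans (ltW st)).
  by rewrite ge0_ler_powR ?nnegrE ?(ltW b0) ?(ltW s0) ?(le_trans (ltW s0) sT).
have le u : lintegrable (fun s => expR (lam * s)) u by apply: czero_lintegrable; exact: czero_exp.
move: t0; rewrite le_eqVlt => /predU1P[<-|t0].
  by rewrite /primJ prim0 normr0 mulr_ge0 ?expR_ge0// divr_ge0 ?(ltW lam0)// mulr_ge0.
have E : \int[mu]_(s in `]0, t[) expR (lam * s) = lam^-1 * expR (lam * t) - lam^-1 * expR (lam * 0).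
  apply: (@FTC_eq R _ (fun t => lam^-1 * expR (lam * t)) t t0) => //.
  - by apply: (czero_M (czero_cst _)); exact: czero_exp.
  - move=> u _; apply: isd_eq (isd_Z lam^-1 (isd_exp (isd_Z lam (isd_id u)))) _.
    by rewrite mulr1 mulrCA mulVf ?mulr1// gt_eqF.
  - by case: (@czero_exp R lam).
apply: (@le_trans _ _ (C * (T `^ b / b) * \int[mu]_(s in `]0, t[) expR (lam * s))).
  rewrite -(@RintegralZl _ _ R mu _ _ _ (measurable_itv _) (le t)); apply: abs_Rintegral_le => //.
  - by apply: czero_lintegrable; exact: czero_J.
  - exact: integrable_Z.
rewrite E -[leRHS]mulrA; apply: ler_wpM2l; first exact: mulr_ge0.
by rewrite gerBl mulr_ge0 ?expR_ge0// invr_ge0 ltW.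
Qed.

Lemma primJ_B f h t : czero f -> czero h -> primJ (fun s => f s - h s) t = primJ f t - primJ h t.
Proof.
move=> fc hc; rewrite /primJ /prim -RintegralB//; last 2 first.
- by apply: czero_lintegrable; exact: czero_J.
- by apply: czero_lintegrable; exact: czero_J.
apply: eq_Rintegral => s _; rewrite /vconv -RintegralB//; last 2 first.
- exact: lintegrable_vconv_powR.
- exact: lintegrable_vconv_powR.
by apply: eq_Rintegral => u _; rewrite mulrBr.
Qed.

(** The terms of the Neumann series of the Volterra equation p = M primJ p + g. *)
Fixpoint picard_term (m : nat) : 'I_n -> R -> R :=
  if m is m'.+1 then fun i t => \sum_j M i j * primJ (picard_term m' j) t else g.

Lemma czero_picard_term m i : czero (picard_term m i).
Proof.
elim: m i => [|m IH] i //=.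
by apply: czero_sum => j; apply: (czero_M (czero_cst _)); exact: czero_primJ.
Qed.

Let S := \sum_i \sum_j `|M i j|.

Let S_ge i : \sum_j `|M i j| <= S.
Proof. by rewrite /S [leRHS](bigD1 i)//= lerDl; apply: sumr_ge0 => j _; exact: sumr_ge0. Qed.

Let S0 : 0 <= S.
Proof. by apply: sumr_ge0 => i _; exact: sumr_ge0. Qed.

Lemma picard_term_bound T : 0 < T -> exists2 D, 0 <= D &
  forall m i t, 0 <= t <= T -> `|picard_term m i t| <= D * 2^-1 ^+ m.
Proof.
move=> T0; have [Cg CgP] : exists Cg : 'I_n -> R, forall i t, 0 <= t <= T -> `|g i t| <= Cg i.
  have h i := cid (czero_bounded T (gc i)).
  by exists (fun i => sval (h i)) => i; exact: (svalP (h i)).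
pose C := \sum_i `|Cg i|.
have C0 : 0 <= C by exact: sumr_ge0.
have Tb0 : 0 <= T `^ b / b by rewrite divr_ge0 ?powR_ge0// ltW.
(* Chosen so that S (T^b/b) / lam <= 1/2: each iteration halves the weighted norm. The summand 1
   keeps [lam] positive. *)
pose lam := 2 * (S * (T `^ b / b)) + 1.
have lam0 : 0 < lam by rewrite ltr_wpDl// mulr_ge0// mulr_ge0.
have key m i t : 0 <= t <= T -> `|picard_term m i t| <= C * 2^-1 ^+ m * expR (lam * t).
  elim: m i t => [|m IH] i t tT.
    have /andP[t0 _] := tT.
    rewrite expr0 mulr1; apply: (@le_trans _ _ C).
      rewrite (le_trans (CgP i t tT))// (le_trans (ler_norm _))// /C [leRHS](bigD1 i)//= lerDl sumr_ge0//.
    by rewrite ler_peMr// -expR0 ler_expR mulr_ge0// ltW.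
  have Cm : 0 <= C * 2^-1 ^+ m by rewrite mulr_ge0// exprn_ge0.
  rewrite /=; apply: (le_trans (ler_norm_sum _ _ _)).
  apply: (@le_trans _ _ (\sum_j `|M i j| * (C * 2^-1 ^+ m * (T `^ b / b) / lam * expR (lam * t)))).
    apply: ler_sum => j _; rewrite normrM ler_wpM2l//.
    by apply: primJ_bound => //; [exact: czero_picard_term|move=> s sT; exact: IH].
  rewrite -mulr_suml; apply: (@le_trans _ _ (S * (C * 2^-1 ^+ m * (T `^ b / b) / lam * expR (lam * t)))).
    by rewrite ler_wpM2r// mulr_ge0 ?expR_ge0// divr_ge0 ?(ltW lam0)// mulr_ge0.
  rewrite exprS (_ : S * _ = (S * (T `^ b / b) / lam) * (C * 2^-1 ^+ m * expR (lam * t))); last by ring.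
  rewrite [leRHS](_ : _ = 2^-1 * (C * 2^-1 ^+ m * expR (lam * t))); last by ring.
  rewrite ler_wpM2r ?mulr_ge0 ?expR_ge0 ?exprn_ge0// ler_pdivrMr// /lam; lra.
exists (C * expR (lam * T)); first by rewrite mulr_ge0// expR_ge0.
move=> m i t tT; apply: (le_trans (key m i t tT)); rewrite mulrAC.
have /andP[t0 tT'] := tT.
by rewrite ler_wpM2r ?exprn_ge0// ler_wpM2l// ler_expR ler_pM2l.
Qed.

Let p i t := limn (series (fun m => picard_term m i t)).
Let s m i t := series (fun m => picard_term m i t) m.

Let czero_s m i : czero (s m i).
Proof. by rewrite /s /series/=; apply: czero_sum => k; exact: czero_picard_term. Qed.

Let p_unif T : 0 < T -> exists2 D, 0 <= D &
  forall m i t, 0 <= t <= T -> `|p i t - s m i t| <= D * 2^-1 ^+ m.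
Proof.
move=> T0; have [D D0 DP] := picard_term_bound T0; exists (2 * D); first exact: mulr_ge0.
by move=> m i t tT; apply: geo_series => k; exact: DP.
Qed.

Let half_small (D e : R) : 0 <= D -> 0 < e -> exists m, D * 2^-1 ^+ m <= e.
Proof.
move=> D0 e0; have : (geometric D 2^-1) @ \oo --> (0 : R).
  by apply: cvg_geometric; rewrite ger0_norm//; lra.
move=> /cvgrPdist_le/(_ e e0)[N _ /(_ N (leqnn N))]; rewrite sub0r normrN => h.
by exists N; apply: le_trans h; exact: ler_norm.
Qed.

Let czero_p i : czero (p i).
Proof.
apply: czero_unif => T e T0 e0; have [D D0 DP] := p_unif T0; have [m mP] := half_small D0 e0.
by exists (s m i) => // t tT; apply: le_trans mP; exact: DP.
Qed.

Let sS m i t : s m.+1 i t = \sum_j M i j * primJ (s m j) t + g i t.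
Proof.
have KKS j : primJ (s m j) t = \sum_(0 <= k < m) primJ (picard_term k j) t.
  elim: m => [|m IH].
    (* The empty partial sum is written as g - g so that [primJ_B] gives its image 0. *)
    rewrite big_geq// (_ : s 0 j = fun x => g j x - g j x) ?primJ_B ?subrr//.
    by apply/funext => x; rewrite /s /series/= big_geq// subrr.
  rewrite big_nat_recr//= -IH.
  have -> : picard_term m j = fun x => s m.+1 j x - s m j x.
    by apply/funext => x; rewrite /s /series/= big_nat_recr//= addrAC subrr add0r.
  by rewrite primJ_B// subrKC.
rewrite /s /series/= big_nat_recl//= addrC; congr (_ + _).
rewrite exchange_big/=; apply: eq_bigr => j _; rewrite KKS mulr_sumr//.
Qed.

Lemma picard : exists2 p : 'I_n -> R -> R, (forall i, czero (p i)) &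
  forall i t, 0 <= t -> p i t = \sum_j M i j * primJ (p j) t + g i t.
Proof.
exists p => // i t t0; apply/eqP; rewrite -subr_eq0 -normr_le0; apply/ler_addgt0Pr => e e0.
rewrite add0r.
have T0 : 0 < t + 1 by lra.
have tT : 0 <= t <= t + 1 by lra.
(* The defect of [p] splits into p - s_(m+1) and the image of p - s_m. The 1 in [E] pays for the
   first, and the other summand is [primJ_bound] at rate 1 for the second. *)
have [D D0 DP] := p_unif T0; pose E := 1 + S * ((t + 1) `^ b / b * expR t).
have E1 : 1 <= E.
  by rewrite lerDl mulr_ge0// mulr_ge0 ?expR_ge0// divr_ge0 ?powR_ge0// ltW.
have DE : 0 <= D * E by rewrite mulr_ge0// (le_trans ler01).
have [m mP] := half_small DE e0; apply: le_trans mP.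
rewrite (_ : _ - _ = (p i t - s m.+1 i t) - \sum_j M i j * primJ (fun x => p j x - s m j x) t); last first.
  have -> : \sum_j M i j * primJ (fun x => p j x - s m j x) t = \sum_j M i j * primJ (p j) t - \sum_j M i j * primJ (s m j) t.
    by rewrite -sumrB; apply: eq_bigr => j _; rewrite (primJ_B _ (czero_p j) (czero_s m j)) mulrBr.
  by rewrite sS; ring.
apply: (le_trans (ler_normB _ _)); rewrite mulrAC /E mulrDr mulr1; apply: lerD.
  apply: (le_trans (DP m.+1 i t tT)); rewrite ler_wpM2l// exprS ler_piMl ?exprn_ge0//; lra.
apply: (le_trans (ler_norm_sum _ _ _)).
apply: (@le_trans _ _ (\sum_j `|M i j| * (D * 2^-1 ^+ m * ((t + 1) `^ b / b) / 1 * expR (1 * t)))).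
  apply: ler_sum => j _; rewrite normrM ler_wpM2l//; apply: primJ_bound => //.
  - exact: (czero_B (czero_p j) (czero_s m j)).
  - by rewrite mulr_ge0// exprn_ge0.
  - move=> x xT; apply: (le_trans (DP m j x xT)); rewrite ler_peMr ?mulr_ge0 ?exprn_ge0//.
    by rewrite -[leLHS]expR0 ler_expR mul1r; case/andP: xT.
rewrite -mulr_suml divr1 mul1r (_ : D * _ * (S * _) = S * (D * 2^-1 ^+ m * ((t + 1) `^ b / b) * expR t)); last by ring.
by rewrite ler_wpM2r// !mulr_ge0 ?expR_ge0 ?exprn_ge0 ?powR_ge0// invr_ge0 ltW.
Qed.

End picard.

(** * Existence for the forced Caputo system *)

Section existence.
Context {R : realType}.
Local Notation mu := (@lebesgue_measure R).
Local Notation lintegrable f t := (mu.-integrable `]0, t[ (EFin \o f)).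

(** Membership in the Caputo domain from candidate derivatives known only at positive times; the
    iterated derivatives agree with them near every t > 0, which is enough for the limits
    involved. *)
Lemma caputo_intro (f f1 f2 : R -> R) (v : R) : czero f ->
  (forall t : R, 0 < t -> is_derive t 1 f (f1 t)) -> (forall t : R, 0 < t -> is_derive t 1 f1 (f2 t)) ->
  f1 t @[t --> 0^'+] --> v -> cpos f2 -> (forall t, lintegrable f2 t) ->
  [/\ caputo_dom f, f^`()%classic t @[t --> 0^'+] --> v & forall t, 0 < t -> f^`(2)%classic t = f2 t].
Proof.
move=> fc df df1 f1v f2c lf2.
have E1 t : 0 < t -> f^`()%classic t = f1 t by move=> t0; exact: isd_derive1 (df t t0).
have d1 (t : R) : 0 < t -> is_derive t 1 f^`()%classic (f2 t).
  by move=> t0; apply: isd_near (df1 t t0); near=> y; rewrite E1//; near: y; exact: near_pos.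
have E2 t : 0 < t -> f^`(2)%classic t = f2 t.
  by move=> t0; rewrite derive1n2; exact: isd_derive1 (d1 t t0).
have lim1 : f^`()%classic t @[t --> 0^'+] --> v.
  apply: cvg_trans f1v; apply: near_eq_cvg; near=> y; rewrite E1//; near: y; exact: nbhs_right_gt.
split=> //; split.
- by apply/czeroP.
- by exists v.
- move=> t t0; split; first exact: isd_derivable (df t t0).
    exact: isd_derivable (d1 t t0).
  apply: (@cvg_trans _ (f2 @ t)); last by rewrite E2//; exact: f2c.
  by apply: near_eq_cvg; near=> y; rewrite E2//; near: y; exact: near_pos.
- move=> t t0; apply: (@eq_integrable _ _ _ mu _ (measurable_itv _) (EFin \o f2)) => //.
  move=> s sI; have s0 : 0 < s by move: sI; rewrite inE/= in_itv/= => /andP[].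
  by congr EFin; rewrite E2.
Unshelve. all: by end_near. Qed.

Lemma eq_caputo (f f2 : R -> R) alpha t : (forall s, 0 < s -> f^`(2)%classic s = f2 s) ->
  caputo alpha f t = (gammaI (2 - alpha))^-1 * vconv (fun s => s `^ (1 - alpha)) f2 t.
Proof.
move=> E; rewrite /caputo GammaE; congr (_ * _); apply: eq_Rintegral => s sI.
have s0 : 0 < s by move: sI; rewrite inE/= in_itv/= => /andP[].
by rewrite E.
Qed.

Lemma cpos_sum (I : Type) (s : seq I) (f : I -> R -> R) : (forall i, cpos (f i)) ->
  cpos (fun x => \sum_(i <- s) f i x).
Proof.
move=> fc; elim: s => [|i s IHs].
  by under eq_fun do rewrite big_nil; move=> t t0; exact: cst_continuous.
under eq_fun do rewrite big_cons.
by move=> t t0; exact: (continuousD (fc i t t0) (IHs t t0)).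
Qed.

Lemma caputo_comb n (c : 'I_n -> R) (f : 'I_n -> R -> R) (v : 'I_n -> R) alpha : alpha < 2 ->
  (forall i, caputo_dom (f i)) -> (forall i, (f i)^`()%classic t @[t --> 0^'+] --> v i) ->
  [/\ caputo_dom (fun t => \sum_i c i * f i t),
    (fun t => \sum_i c i * f i t)^`()%classic t @[t --> 0^'+] --> \sum_i c i * v i &
    forall t, 0 < t -> caputo alpha (fun t => \sum_i c i * f i t) t = \sum_i c i * caputo alpha (f i) t].
Proof.
move=> a2 fd fv.
have [] := @caputo_intro (fun t => \sum_i c i * f i t) (fun t => \sum_i c i * (f i)^`()%classic t)
  (fun t => \sum_i c i * (f i)^`(2)%classic t) (\sum_i c i * v i).
- by apply: czero_sum => i; apply: (czero_M (czero_cst _)); exact: caputo_czero.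
- by move=> t t0; apply: isd_sum => i; apply: isd_Z; exact: caputo_isd.
- by move=> t t0; apply: isd_sum => i; apply: isd_Z; exact: caputo_isd2.
- elim: (index_enum _) => [|i s IHs].
    by rewrite big_nil; under eq_fun do rewrite big_nil; exact: cvg_cst.
  rewrite big_cons; under eq_fun do rewrite big_cons.
  have h : c i * (f i)^`()%classic t @[t --> 0^'+] --> c i * v i by apply: cvgMr; exact: fv.
  exact: cvgD h IHs.
- apply: cpos_sum => i t t0; apply: continuousM; first exact: cst_continuous.
  exact: caputo_cpos2 (fd i) t t0.
- by move=> t; apply: integrable_sum => // i; apply: integrable_Z => //; exact: caputo_lint2.
move=> h1 h2 h3; split=> // t t0.
rewrite (eq_caputo _ _ h3); under [RHS]eq_bigr do rewrite (@eq_caputo _ _ _ _ (fun _ _ => erefl)) mulrCA.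
rewrite -mulr_sumr; congr (_ * _); rewrite /vconv.
have E1 : 1 - alpha = 2 - alpha - 1 by ring.
have li i : lintegrable (fun s => (t - s) `^ (1 - alpha) * (f i)^`(2)%classic s) t.
  have a0 : 0 < 2 - alpha by rewrite subr_gt0.
  rewrite E1; exact: (@lintegrable_powR_conv R (2 - alpha) _ t a0 (caputo_lint2 (fd i) t) (caputo_cpos2 (fd i))).
under [RHS]eq_bigr do rewrite -RintegralZl//.
rewrite -Rintegral_sum//; last by move=> i; exact: integrable_Z.
apply: eq_Rintegral => s _; rewrite mulr_sumr; apply: eq_bigr => i _; exact: mulrCA.
Qed.

Lemma caputo_Cdiff2 (g : R -> R) (c : R) : Cdiff 2 g -> caputo_dom (fun t => c * g t).
Proof.
move=> [dg g2].
have d0 (t : R) : is_derive t 1 g (g^`()%classic t) by apply: derivable_isd; exact: (dg 0%N).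
have d1 (t : R) : is_derive t 1 g^`()%classic (g^`(2)%classic t).
  by rewrite derive1n2; apply: derivable_isd; have := dg 1%N isT t; rewrite derive1n1.
have g2c : czero g^`(2)%classic by exact: czero_continuous.
have gc : czero (fun t => c * g t).
  by apply: (czero_M (czero_cst c)); apply: czero_continuous => t; exact: isd_cont (d0 t).
have dd0 (t : R) : 0 < t -> is_derive t 1 (fun t => c * g t) (c * g^`()%classic t).
  by move=> _; exact: isd_Z c (d0 t).
have dd1 (t : R) : 0 < t -> is_derive t 1 (fun t => c * g^`()%classic t) (c * g^`(2)%classic t).
  by move=> _; exact: isd_Z c (d1 t).
have lim : c * g^`()%classic t @[t --> 0^'+] --> c * g^`()%classic 0.
  by apply: cvgMr; apply: cvg_at_right_filter; exact: isd_cont (d1 0).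
have [cg2 _] := czero_M (czero_cst c) g2c.
have lg2 t : lintegrable (fun t => c * g^`(2)%classic t) t.
  by apply: czero_lintegrable; exact: czero_M (czero_cst c) g2c.
by have [] := caputo_intro gc dd0 dd1 lim cg2 lg2.
Qed.

(** The differentiated equation p = c A primJ p + g' has a continuous solution, and x = x0 + c prim
    (primJ p) satisfies D^alpha x = prim p. Integrating the equation for [p] gives A (x - x0) + g -
    g(0), so [x0] is chosen with A x0 = -g(0). Solving for the derivative of D^alpha x makes x'' = c
    J p continuous. *)
Lemma caputo_exists n (b : R) (A : 'M[R]_n) (g : 'I_n -> R -> R) : 0 < b < 1 -> A \in unitmx ->
  (forall i, Cdiff 2 (g i)) ->
  exists2 x : 'I_n -> R -> R, (forall i, caputo_dom (x i)) &
    forall i t, 0 < t -> caputo (1 + b) (x i) t = \sum_j A i j * x j t + g i t.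
Proof.
move=> b01 Au gd.
have b0 : 0 < b by lra.
have b1_0 : 0 < 1 - b by lra.
have b1_01 : 0 < 1 - b <= 2 by lra.
have g0 := gammaI_gt0 b1_01; have B0 := Beta_gt0 b1_0 b0.
(* This cancels the normalization of the Caputo derivative and the Beta constant of the convolution
   of the two powers. *)
pose c := gammaI (1 - b) / Beta (1 - b) b.
have dg i (t : R) : is_derive t 1 (g i) ((g i)^`()%classic t).
  by have [h _] := gd i; apply: derivable_isd; exact: (h 0%N).
have gc i : czero (g i)^`()%classic.
  apply: czero_continuous => t; have [h _] := gd i; have := h 1%N isT t; rewrite derive1n1 => h1.
  exact: isd_cont (derivable_isd h1).
have [p pc pE] := picard (c *: A) b01 gc.
pose x0 i := (invmx A *m (\col_j - g j 0)) i 0.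
have x0E i : \sum_j A i j * x0 j = - g i 0.
  have : (A *m (invmx A *m (\col_j - g j 0))) i 0 = - g i 0 by rewrite mulKVmx// mxE.
  by rewrite mxE.
pose x i t := x0 i + c * prim (primJ b (p i)) t.
have cK i : czero (primJ b (p i)) by exact: czero_primJ.
have cJ i : czero (vconv (fun s => s `^ (b - 1)) (p i)) by exact: czero_J.
have cPK i : czero (prim (primJ b (p i))) by apply: czero_prim => t; exact: czero_lintegrable.
have xd i : [/\ caputo_dom (x i), (x i)^`()%classic t @[t --> 0^'+] --> (0 : R) &
    forall t, 0 < t -> (x i)^`(2)%classic t = c * vconv (fun s => s `^ (b - 1)) (p i) t].
  apply: (@caputo_intro (x i) (fun t => c * primJ b (p i) t)).
  - exact: (czero_D (czero_cst _) (czero_M (czero_cst _) (cPK i))).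
  - move=> t t0; apply: isd_eq (isd_D (isd_cst t (x0 i)) (isd_Z c (isd_prim (cK i) t0))) _.
    by rewrite add0r.
  - by move=> t t0; apply: isd_Z; apply: isd_prim.
  - have [_ h] := czero_M (czero_cst c) (cK i).
    by rewrite /= {2}/primJ prim0 mulr0 in h.
  - by have [h _] := czero_M (czero_cst c) (cJ i).
  - by move=> t; apply: czero_lintegrable; exact: czero_M (czero_cst c) (cJ i).
exists x; first by move=> i; have [] := xd i.
move=> i t t0; have [_ _ E2] := xd i.
rewrite (eq_caputo _ _ E2).
have -> : 2 - (1 + b) = 1 - b by ring.
have -> : 1 - (1 + b) = 1 - b - 1 by ring.
have lb u := lintegrable_powR u b0; have lb1 u := lintegrable_powR u b1_0.
have -> : vconv (fun s => s `^ (1 - b - 1)) (fun t => c * vconv (fun s => s `^ (b - 1)) (p i) t) t =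
    c * (Beta (1 - b) b * prim (p i) t).
  transitivity (c * vconv (fun s => s `^ (1 - b - 1)) (vconv (fun s => s `^ (b - 1)) (p i)) t).
    rewrite -(@RintegralZl _ _ R mu _ _ c (measurable_itv _)); last first.
      by apply: lintegrable_vconv_powR.
    by apply: eq_Rintegral => s _; exact: mulrCA.
  congr (_ * _); rewrite (@vconv_assoc R (Beta (1 - b) b))//; last 2 first.
  - exact: czero_lintegrable.
  - move=> u /andP[u0 ut]; have := beta_integral b1_0 b0 u0.
    rewrite (_ : 1 - b + b - 1 = 0); last by ring.
    rewrite powRr0 mulr1 => <-; rewrite le_eqVlt; apply/orP; left; apply/eqP.
    by apply: eq_integral => s _; rewrite ger0_norm// mulr_ge0 ?powR_ge0.
  rewrite /prim -(@RintegralZl _ _ R mu _ _ _ (measurable_itv _) (czero_lintegrable t (pc i))).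
  apply: eq_Rintegral => s; rewrite inE/= in_itv/= => /andP[s0 st].
  have ts0 : 0 < t - s by rewrite subr_gt0.
  rewrite (vconv_powR b1_0 b0 ts0) (_ : 1 - b + b - 1 = 0); last by ring.
  by rewrite powRr0 mulr1.
have -> : (gammaI (1 - b))^-1 * (c * (Beta (1 - b) b * prim (p i) t)) = prim (p i) t.
  by rewrite /c; field; rewrite !gt_eqF.
have -> : prim (p i) t = \sum_j (c *: A) i j * prim (primJ b (p j)) t + (g i t - g i 0).
  have -> : g i t - g i 0 = prim (g i)^`()%classic t.
    apply/esym; apply: FTC_eq => //.
    - by apply: czero_continuous => u; exact: isd_cont (dg i u).
    - by case: (gc i).
    - by move=> u; exact: czero_lintegrable.
  have lK j : lintegrable (fun t => (c *: A) i j * primJ b (p j) t) t.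
    by apply: integrable_Z => //; exact: czero_lintegrable.
  transitivity (prim (fun t => \sum_j (c *: A) i j * primJ b (p j) t + (g i)^`()%classic t) t).
    by apply: eq_Rintegral => s; rewrite inE/= in_itv/= => /andP[s0 _]; apply: pE; exact: ltW.
  rewrite /prim RintegralD//; [|exact: integrable_sum|exact: czero_lintegrable].
  rewrite Rintegral_sum//; congr (_ + _); apply: eq_bigr => j _.
  by rewrite RintegralZl//; exact: czero_lintegrable.
have -> : \sum_j A i j * x j t = - g i 0 + \sum_j (c *: A) i j * prim (primJ b (p j)) t.
  by rewrite -x0E -big_split; apply: eq_bigr => j _ /=; rewrite /x mxE; ring.
by ring.
Qed.

End existence.

(** * Matrix inequalities *)

Section linear_algebra.
Context {R : realType}.

Definition bilmx m n (M : 'M[R]_(m, n)) (u : 'cV[R]_m) (v : 'cV[R]_n) : R := (u^T *m M *m v) 0 0.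

Lemma bilmxE m n (M : 'M[R]_(m, n)) u v : bilmx M u v = \sum_i \sum_j M i j * (u i 0 * v j 0).
Proof.
rewrite /bilmx -mulmxA mxE; apply: eq_bigr => i _; rewrite !mxE mulr_sumr; apply: eq_bigr => j _.
by rewrite mulrCA.
Qed.

Lemma bilmx_tr m n (M : 'M[R]_(m, n)) u v : bilmx M^T u v = bilmx M v u.
Proof. by rewrite !bilmxE exchange_big/=; apply: eq_bigr => i _; apply: eq_bigr => j _; rewrite mxE [u _ _ * _]mulrC. Qed.

Lemma bilmxDl m n (M : 'M[R]_(m, n)) u w v : bilmx M (u + w) v = bilmx M u v + bilmx M w v.
Proof. by rewrite /bilmx linearD/= !mulmxDl mxE. Qed.

Lemma bilmxDr m n (M : 'M[R]_(m, n)) u v w : bilmx M u (v + w) = bilmx M u v + bilmx M u w.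
Proof. by rewrite /bilmx mulmxDr mxE. Qed.

Lemma bilmxDm m n (M N : 'M[R]_(m, n)) u v : bilmx (M + N) u v = bilmx M u v + bilmx N u v.
Proof. by rewrite /bilmx mulmxDr mulmxDl mxE. Qed.

Lemma bilmxZl m n (M : 'M[R]_(m, n)) a u v : bilmx M (a *: u) v = a * bilmx M u v.
Proof. by rewrite /bilmx linearZ/= -!scalemxAl mxE. Qed.

Lemma bilmxZr m n (M : 'M[R]_(m, n)) a u v : bilmx M u (a *: v) = a * bilmx M u v.
Proof. by rewrite /bilmx -scalemxAr mxE. Qed.

Lemma bilmxNm m n (M : 'M[R]_(m, n)) u v : bilmx (- M) u v = - bilmx M u v.
Proof. by rewrite /bilmx mulmxN mulNmx mxE. Qed.

Lemma bilmx0l m n (M : 'M[R]_(m, n)) v : bilmx M 0 v = 0.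
Proof. by rewrite /bilmx trmx0 !mul0mx mxE. Qed.

Lemma bilmx0r m n (M : 'M[R]_(m, n)) u : bilmx M u 0 = 0.
Proof. by rewrite /bilmx mulmx0 mxE. Qed.

Lemma bilmx_mulr m n p (M : 'M[R]_(m, n)) (N : 'M[R]_(n, p)) u v : bilmx (M *m N) u v = bilmx M u (N *m v).
Proof. by rewrite /bilmx !mulmxA. Qed.

Lemma bilmx_mull m n p (M : 'M[R]_(m, n)) (N : 'M[R]_(n, p)) u v : bilmx (M *m N) u v = bilmx N (M^T *m u) v.
Proof. by rewrite /bilmx trmx_mul trmxK !mulmxA. Qed.

Lemma bilmx1E m (u : 'cV[R]_m) : bilmx 1%:M u u = \sum_i u i 0 ^+ 2.
Proof.
by rewrite /bilmx mulmx1 mxE; apply: eq_bigr => i _; rewrite mxE expr2.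
Qed.

Lemma bilmx1_ge0 m (u : 'cV[R]_m) : 0 <= bilmx 1%:M u u.
Proof. by rewrite bilmx1E sumr_ge0// => i _; exact: sqr_ge0. Qed.

Lemma bilmx1_gt0 m (u : 'cV[R]_m) : u != 0 -> 0 < bilmx 1%:M u u.
Proof.
move=> u0; rewrite lt_neqAle bilmx1_ge0 andbT eq_sym; apply: contra u0.
rewrite bilmx1E psumr_eq0; last by move=> i _; exact: sqr_ge0.
move=> /allP h; apply/eqP/matrixP => i j; rewrite ord1 mxE; apply/eqP.
by have := h i (mem_index_enum i); rewrite sqrf_eq0.
Qed.

Lemma unitmx_inj n (M : 'M[R]_n) : (forall y : 'cV[R]_n, M *m y = 0 -> y = 0) -> M \in unitmx.
Proof.
move=> h; rewrite -unitmx_tr -row_free_unit; apply: inj_row_free => v vM.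
by apply: trmx_inj; rewrite trmx0; apply: h; apply: trmx_inj; rewrite trmx_mul trmxK trmx0.
Qed.

Lemma bilmx_le_norm n (M : 'M[R]_n) u : bilmx M u u <= (\sum_i \sum_j `|M i j|) * bilmx 1%:M u u.
Proof.
rewrite bilmxE mulr_suml; apply: ler_sum => i _; rewrite mulr_suml; apply: ler_sum => j _.
apply: (le_trans (ler_norm _)); rewrite normrM ler_wpM2l//.
have h k : u k 0 ^+ 2 <= bilmx 1%:M u u.
  by rewrite bilmx1E (bigD1 k)//= lerDl sumr_ge0// => l _; exact: sqr_ge0.
have := h i; have := h j; have := sqr_ge0 (`|u i 0| - `|u j 0|).
rewrite sqrrB !real_normK ?num_real// normrM; lra.
Qed.

(* M^-1 bounds the inverse form, and expanding the form at u - t M^-1 u gives u'Mu >= (2t - t^2 C) u'u. *)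
Lemma posdef_coercive n (B : 'M[R]_n) : (forall u, u != 0 -> 0 < bilmx B u u) ->
  exists2 d, 0 < d & forall u, d * bilmx 1%:M u u <= bilmx B u u.
Proof.
move=> Bpos; pose M := B + B^T.
have ME u : bilmx M u u = 2 * bilmx B u u by rewrite bilmxDm bilmx_tr; ring.
have MT : M^T = M by rewrite /M linearD/= trmxK addrC.
have Mu : M \in unitmx.
  apply: unitmx_inj => y My; apply/eqP; apply: contraT => /Bpos.
  have : bilmx M y y = 0 by rewrite -[M]mul1mx bilmx_mulr My bilmx0r.
  by rewrite ME; lra.
pose C := 1 + \sum_i \sum_j `|invmx M i j|.
have C0 : 0 < C by rewrite ltr_wpDr// sumr_ge0// => i _; exact: sumr_ge0.
(* The choice t = C^-1 maximizes 2t - C t^2, with value C^-1; the half comes from M = B + B^T. *)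
exists (2^-1 * C^-1); first by rewrite mulr_gt0// invr_gt0.
move=> u; rewrite -mulrA -(@ler_pM2l _ 2)// -ME mulVKf//.
pose w := u - C^-1 *: (invmx M *m u).
have w0 : 0 <= bilmx M w w.
  have [->|/Bpos h] := eqVneq w 0; first by rewrite bilmx0l.
  by rewrite ME mulr_ge0// ltW.
have cross : bilmx M u (invmx M *m u) = bilmx 1%:M u u by rewrite -bilmx_mulr mulmxV.
have inv : bilmx M (invmx M *m u) (invmx M *m u) = bilmx (invmx M) u u.
  by rewrite -bilmx_mulr mulmxV// -(bilmx_tr 1%:M u (invmx M *m u)) trmx1 -bilmx_mulr mul1mx.
have iC : bilmx (invmx M) u u <= C * bilmx 1%:M u u.
  by apply: (le_trans (bilmx_le_norm _ _)); rewrite ler_wpM2r ?bilmx1_ge0// lerDr.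
move: w0; rewrite /w -scaleNr bilmxDl !bilmxDr !bilmxZl !bilmxZr cross inv.
have cross' : bilmx M (invmx M *m u) u = bilmx 1%:M u u by rewrite -bilmx_tr MT cross.
rewrite cross'.
have := ler_wpM2l (_ : 0 <= C^-1 * C^-1) iC.
rewrite mulr_ge0 ?invr_ge0 ?(ltW C0)// => /(_ isT).
rewrite (_ : C^-1 * C^-1 * (C * _) = C^-1 * bilmx 1%:M u u); last by field; rewrite gt_eqF.
lra.
Qed.

(** The vector of two blocks [a], [b] written through Kronecker products of columns, so that forms
    of [S *t G] factor. *)
Definition stack2 n (a b : 'cV[R]_n) : 'cV[R]_(2 * n) :=
  (delta_mx 0 0 : 'cV[R]_2) *t a + (delta_mx 1 0 : 'cV[R]_2) *t b.

Lemma tens_form m n (S : 'M[R]_2) (G : 'M[R]_(m, n)) i j (a : 'cV[R]_m) (b : 'cV[R]_n) :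
  bilmx (S *t G) ((delta_mx i 0 : 'cV[R]_2) *t a : 'cV[R]_(2 * m)) ((delta_mx j 0 : 'cV[R]_2) *t b : 'cV[R]_(2 * n)) =
  S i j * bilmx G a b.
Proof.
(* A Kronecker product of columns has [1 * 1] columns; [z] is the only index of that type. *)
pose z : 'I_(1 * 1) := mxtens_index (0 : 'I_1, 0 : 'I_1).
transitivity ((((delta_mx i 0 : 'cV[R]_2)^T *m S *m delta_mx j 0) *t (a^T *m G *m b)) z z).
  by rewrite -!tensmx_mul -trmx_tens /bilmx; congr (fun_of_matrix _ _ _); exact/val_inj.
rewrite tensmxE; congr (_ * _).
by rewrite trmx_delta -rowE -colE !mxE.
Qed.

Lemma stack2_form m n (S : 'M[R]_2) (G : 'M[R]_(m, n)) (a b : 'cV[R]_m) (c d : 'cV[R]_n) :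
  bilmx (S *t G) (stack2 a b) (stack2 c d) =
  S 0 0 * bilmx G a c + S 0 1 * bilmx G a d + (S 1 0 * bilmx G b c + S 1 1 * bilmx G b d).
Proof. by rewrite /stack2 bilmxDl !bilmxDr !tens_form. Qed.

Lemma bilmx_block m n (P : 'M[R]_m) (Q : 'M[R]_(m, n)) (S : 'M[R]_(n, m)) (N : 'M[R]_n) v w :
  bilmx (block_mx P Q S N) (col_mx v w) (col_mx v w) = bilmx P v v + bilmx S w v + (bilmx Q v w + bilmx N w w).
Proof. by rewrite /bilmx tr_col_mx mul_row_block mul_row_col !mulmxDl !mxE. Qed.

Lemma stack2_neq0 n (a b : 'cV[R]_n) : (a != 0) || (b != 0) -> stack2 a b != 0.
Proof.
move=> ab; apply/eqP => v0.
have : bilmx ((1%:M : 'M[R]_2) *t (1%:M : 'M[R]_n)) (stack2 a b) (stack2 a b) = 0 by rewrite v0 bilmx0l.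
rewrite stack2_form !mxE/= !mul1r !mul0r addr0 add0r => h.
have a0 := bilmx1_ge0 a; have b0 := bilmx1_ge0 b.
by case/orP: ab => /bilmx1_gt0; lra.
Qed.

Section lmi.
Variables (n p q : nat) (alpha : R) (A0 X : 'M[R]_n) (DA : 'M[R]_(n, p)) (EA : 'M[R]_(q, n)) (FA : 'M[R]_(p, q)).
Let s := sin (pi / 2 * alpha).
Let c := cos (pi / 2 * alpha).
Hypothesis LMI : negdefmx (block_mx
             (Sym (Theta alpha *t (A0^T *m X)) + 1%:M *t (EA^T *m EA))
             ((1%:M : 'M[R]_2) *t (X^T *m DA))
             ((1%:M : 'M[R]_2) *t (DA^T *m X))
             (- ((1%:M : 'M[R]_2) *t (1%:M : 'M[R]_p)))).
Hypothesis HF : negdefmx (FA *m FA^T - 1%:M).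

(** The hypothesis bounds F^T, while the claim is about F. With |F^T F x|^2 <= |F x|^2, expanding |x
    - F^T F x|^2 >= 0 gives |x|^2 - 2|Fx|^2 + |Fx|^2 >= 0. *)
Lemma contraction x : bilmx 1%:M (FA *m x) (FA *m x) <= bilmx 1%:M x x.
Proof.
have h1 : bilmx 1%:M (FA^T *m (FA *m x)) (FA^T *m (FA *m x)) <= bilmx 1%:M (FA *m x) (FA *m x).
  have [->|y0] := eqVneq (FA *m x) 0; first by rewrite !mulmx0 !bilmx0l.
  have [_ /(_ _ y0)] := HF; rewrite -/(bilmx _ _ _) bilmxDm bilmxNm.
  by rewrite -{1}[FA *m FA^T]mulmx1 -mulmxA -{1}[FA^T]mul1mx bilmx_mull mulmx1 bilmx_mulr; lra.
have h2 := bilmx1_ge0 (x - FA^T *m (FA *m x)).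
have h3 : bilmx 1%:M x (FA^T *m (FA *m x)) = bilmx 1%:M (FA *m x) (FA *m x).
  by rewrite -bilmx_mulr mul1mx bilmx_tr -[FA]mul1mx bilmx_mulr mul1mx.
move: h2; rewrite -scaleN1r bilmxDl !bilmxDr !bilmxZl !bilmxZr -(bilmx_tr 1%:M x (FA^T *m (FA *m x))) trmx1 h3; lra.
Qed.

Let G := (A0 + DA *m FA *m EA)^T *m X.

Lemma lmi_form a b : (a != 0) || (b != 0) ->
  s * (bilmx G a a + bilmx G b b) - c * bilmx G a b + c * bilmx G b a < 0.
Proof.
move=> ab; pose G0 := A0^T *m X; pose Y := X^T *m DA *m FA *m EA.
have GE u v : bilmx G u v = bilmx G0 u v + bilmx Y v u.
  by rewrite /G linearD/= mulmxDl bilmxDm; congr (_ + _); rewrite -bilmx_tr /Y !trmx_mul !trmxK !mulmxA.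
(* The lower block of the test vector is F_A E_A applied to the rotated pair, so that the
   off-diagonal blocks of the LMI reproduce the uncertain part of [G]. *)
pose w0 := FA *m (EA *m (s *: a + c *: b)); pose w1 := FA *m (EA *m (s *: b - c *: a)).
have v0 : col_mx (stack2 a b) (stack2 w0 w1) != 0.
  by rewrite col_mx_eq0 negb_and stack2_neq0.
have [_ /(_ _ v0)] := LMI; rewrite -/(bilmx _ _ _) bilmx_block bilmxDm /Sym bilmxDm bilmx_tr bilmxNm !stack2_form.
rewrite !mxE/= !mul1r !mul0r !addr0 !add0r.
have HY u z : bilmx (X^T *m DA) u (FA *m (EA *m z)) = bilmx Y u z by rewrite /Y !bilmx_mulr.
have HYt u z : bilmx (DA^T *m X) (FA *m (EA *m z)) u = bilmx Y u z.
  by rewrite -HY -bilmx_tr trmx_mul trmxK.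
rewrite !HY !HYt -scaleNr !bilmxDr !bilmxZr.
have KE z : bilmx (EA^T *m EA) z z = bilmx 1%:M (EA *m z) (EA *m z).
  by rewrite bilmx_mull trmxK -{1}[EA]mul1mx bilmx_mulr.
have c0 := contraction (EA *m (s *: a + c *: b)).
have c1 := contraction (EA *m (s *: b + (- c) *: a)).
have sc : s ^+ 2 + c ^+ 2 = 1 by rewrite addrC cos2Dsin2.
have primJ : bilmx 1%:M (EA *m (s *: a + c *: b)) (EA *m (s *: a + c *: b)) +
    bilmx 1%:M (EA *m (s *: b + (- c) *: a)) (EA *m (s *: b + (- c) *: a)) =
    bilmx (EA^T *m EA) a a + bilmx (EA^T *m EA) b b.
  rewrite -!KE !bilmxDl !bilmxDr !bilmxZl !bilmxZr.
  rewrite -[RHS]mul1r -sc; ring.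
rewrite !GE -/w0 -/w1 -/s -/c -/G0; rewrite -/w0 in c0.
have E1 : w1 = FA *m (EA *m (s *: b + (- c) *: a)) by rewrite /w1 -scaleNr.
rewrite -E1 in c1.
lra.
Qed.

End lmi.

End linear_algebra.

(** * Reduction to the rank normal form *)

Section reduction.
Context {R : realType}.

Lemma reduction n1 n2 (E A X : 'M[R]_(n1 + n2)) (s c : R) : \rank E = n1 -> 0 < s ->
  E^T *m X = X^T *m E -> (forall v, 0 <= bilmx (E^T *m X) v v) ->
  (forall a b, (a != 0) || (b != 0) ->
    s * (bilmx (A^T *m X) a a + bilmx (A^T *m X) b b) - c * bilmx (A^T *m X) a b + c * bilmx (A^T *m X) b a < 0) ->
  exists (M0 P0 : 'M[R]_(n1 + n2)) (A1 P : 'M[R]_n1),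
    [/\ M0 \in unitmx, P0 \in unitmx, M0 *m E *m P0 = block_mx 1%:M 0 0 0,
        M0 *m A *m P0 = block_mx A1 0 0 1%:M &
    [/\ P^T = P, forall v, 0 <= bilmx P v v & forall a b, (a != 0) || (b != 0) ->
    s * (bilmx (A1^T *m P) a a + bilmx (A1^T *m P) b b) - c * bilmx (A1^T *m P) a b + c * bilmx (A1^T *m P) b a < 0]].
Proof.
move=> rE s0 EX EXpos AX.
pose L := col_ebase E; pose U := row_ebase E.
have Lu : L \in unitmx by exact: col_ebase_unit.
have Uu : U \in unitmx by exact: row_ebase_unit.
pose D : 'M[R]_(n1 + n2) := block_mx 1%:M 0 0 0.
have ED : E = L *m D *m U by have := mulmx_ebase E; rewrite rE pid_mx_block => /esym.
pose At := invmx L *m A *m invmx U; pose Xt := L^T *m X *m invmx U.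
have Ui : U *m invmx U = 1%:M by exact: mulmxV.
have UiT : (invmx U)^T *m U^T = 1%:M by rewrite -trmx_mul Ui trmx1.
have LiT : (invmx L)^T *m L^T = 1%:M by rewrite -trmx_mul mulmxV ?trmx1.
have DX : (invmx U)^T *m (E^T *m X) *m invmx U = D *m Xt.
  have DT : D^T = D by rewrite /D tr_block_mx !trmx0 trmx1.
  by rewrite ED !trmx_mul DT /Xt !mulmxA UiT mul1mx.
have AtX : (invmx U)^T *m (A^T *m X) *m invmx U = At^T *m Xt.
  by rewrite /At /Xt !trmx_mul -!mulmxA (mulmxA (invmx L)^T) LiT mul1mx.
have DXs : (D *m Xt)^T = D *m Xt.
  have YT : (E^T *m X)^T = E^T *m X by rewrite trmx_mul trmxK EX.
  by rewrite -DX trmx_mul (trmx_mul _ (E^T *m X)) trmxK YT mulmxA.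
have bilmxU (Y : 'M[R]_(n1 + n2)) a b : bilmx ((invmx U)^T *m Y *m invmx U) a b = bilmx Y (invmx U *m a) (invmx U *m b).
  by rewrite bilmx_mulr bilmx_mull trmxK.
have DXpos v : 0 <= bilmx (D *m Xt) v v by rewrite -DX bilmxU.
have Uinj v : v != 0 -> invmx U *m v != 0.
  by apply: contra_neq => h; rewrite -[v](mulKVmx Uu) h mulmx0.
have AtXneg a b : (a != 0) || (b != 0) ->
    s * (bilmx (At^T *m Xt) a a + bilmx (At^T *m Xt) b b) - c * bilmx (At^T *m Xt) a b + c * bilmx (At^T *m Xt) b a < 0.
  move=> ab; rewrite -AtX !bilmxU; apply: AX.
  by case/orP: ab => /Uinj ->; rewrite ?orbT.
pose A11 := ulsubmx At; pose A12 := ursubmx At; pose A21 := dlsubmx At; pose A22 := drsubmx At.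
pose X11 := ulsubmx Xt; pose X12 := ursubmx Xt; pose X21 := dlsubmx Xt; pose X22 := drsubmx Xt.
have AtE : At = block_mx A11 A12 A21 A22 by rewrite submxK.
have XtE : Xt = block_mx X11 X12 X21 X22 by rewrite submxK.
have DXE : D *m Xt = block_mx X11 X12 0 0.
  by rewrite XtE mulmx_block !mul1mx !mul0mx !addr0.
(* The lower block row of D Xt is zero, so its symmetry forces X12 = 0 and leaves X11 symmetric. *)
have [PT X120] : X11^T = X11 /\ X12 = 0.
  move: DXs; rewrite DXE tr_block_mx !trmx0 => /eq_block_mx[-> h _ _].
  by split=> //; rewrite -h.
have Xpos v : 0 <= bilmx X11 v v.
  have := DXpos (col_mx v 0); rewrite DXE bilmx_block !bilmx0l !bilmx0r !addr0//.
(* On vectors annihilated by the second block row of [At], the form sees only X11. This serves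
   twice: for the kernel of A22, where the form would vanish, and for the graph that carries the
   reduced system. *)
have red u v w z : A21 *m u + A22 *m w = 0 ->
    bilmx (At^T *m Xt) (col_mx u w) (col_mx v z) = bilmx X11 (A11 *m u + A12 *m w) v.
  move=> h0; rewrite bilmx_mull trmxK AtE mul_block_col h0 XtE X120.
  by rewrite /bilmx tr_col_mx trmx0 mul_row_block mul_row_col !mul0mx !addr0 mulmx0 mul0mx addr0.
have A22u : A22 \in unitmx.
  apply: unitmx_inj => y Ay; apply/eqP; apply: contraT => y0.
  have v0 : col_mx (0 : 'cV[R]_n1) y != 0 by rewrite col_mx_eq0 negb_and y0 orbT.
  have := AtXneg (col_mx 0 y) 0; rewrite v0 => /(_ isT).
  rewrite !bilmx0r !bilmx0l !mulr0 subr0 !addr0 red ?mulmx0 ?Ay ?addr0// bilmx0r mulr0 ltxx//.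
(* The Schur complement of A22. [Ml] and [Pr] perform the block elimination and leave the normal
   form of [E] unchanged. *)
pose A1 := A11 - A12 *m invmx A22 *m A21.
pose Ml : 'M[R]_(n1 + n2) := block_mx 1%:M (- (A12 *m invmx A22)) 0 (invmx A22).
pose Pr : 'M[R]_(n1 + n2) := block_mx 1%:M 0 (- (invmx A22 *m A21)) 1%:M.
have Mlu : Ml \in unitmx.
  by rewrite unitmxE det_ublock det1 mul1r -unitmxE unitmx_inv.
have Pru : Pr \in unitmx by rewrite unitmxE det_lblock !det1 mulr1 unitr1.
exists (Ml *m invmx L), (invmx U *m Pr), A1, X11; split.
- by rewrite unitmx_mul Mlu unitmx_inv.
- by rewrite unitmx_mul unitmx_inv Uu.
- rewrite ED !mulmxA -(mulmxA Ml) mulVmx// mulmx1 -(mulmxA _ U) Ui mulmx1.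
  by rewrite /Ml /D /Pr !mulmx_block !(mul1mx, mulmx0, mul0mx, addr0, mulmx1).
- rewrite !mulmxA -(mulmxA Ml) -(mulmxA Ml) -/At AtE /Ml /Pr !mulmx_block.
  rewrite !(mul1mx, mulmx0, mul0mx, addr0, add0r, mulmx1) mulVmx//.
  have -> : A12 + - (A12 *m invmx A22) *m A22 = 0 by rewrite mulNmx -mulmxA mulVmx// mulmx1 subrr.
  by rewrite mul0mx addr0 mul1mx subrr mulNmx.
split=> // a b ab.
(* The graph of the algebraic constraint A21 v + A22 w = 0. *)
pose T1 (v : 'cV[R]_n1) : 'cV[R]_(n1 + n2) := col_mx v (- (invmx A22 *m A21 *m v)).
have T1E u v : bilmx (At^T *m Xt) (T1 u) (T1 v) = bilmx (A1^T *m X11) u v.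
  rewrite /T1 red; last by rewrite mulmxN -mulmxA mulKVmx// subrr.
  by rewrite bilmx_mull trmxK /A1 mulmxBl mulmxN !mulmxA.
rewrite -!T1E; apply: AtXneg.
by case/orP: ab => ab; rewrite !col_mx_eq0 !negb_and ab ?orbT.
Qed.

(** Taking b = 0 in the sector inequality gives u'A1'Pu < 0 for u <> 0, hence A1 is injective. If
    moreover u'Pu = 0, then moving from u in the direction A1 u decreases the form below 0 to first
    order, contradicting P >= 0. *)
Lemma posdef_of_sector n (s c : R) (P A1 : 'M[R]_n) : 0 < s -> P^T = P -> (forall v, 0 <= bilmx P v v) ->
  (forall a b, (a != 0) || (b != 0) ->
    s * (bilmx (A1^T *m P) a a + bilmx (A1^T *m P) b b) - c * bilmx (A1^T *m P) a b + c * bilmx (A1^T *m P) b a < 0) ->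
  A1 \in unitmx /\ forall u, u != 0 -> 0 < bilmx P u u.
Proof.
move=> s0 PT Ppos AP.
have neg a : a != 0 -> bilmx (A1^T *m P) a a < 0.
  move=> a0; have := AP a 0; rewrite a0 => /(_ isT).
  by rewrite !bilmx0r !bilmx0l !mulr0 subr0 !addr0 pmulr_rlt0.
split.
  apply: unitmx_inj => y Ay; apply/eqP; apply: contraT => /neg.
  by rewrite bilmx_mull trmxK Ay bilmx0l ltxx.
move=> u u0; rewrite lt_neqAle Ppos andbT eq_sym; apply/negP => /eqP Pu.
have := neg u u0; rewrite bilmx_mull trmxK; set w := A1 *m u; set m := bilmx P w u => m0.
have W0 := Ppos w; set W := bilmx P w w in W0.
have mE : bilmx P u w = m by rewrite /m -bilmx_tr PT.
(* A step small enough for the linear term 2 t m to dominate t^2 W; W + 1 is positive even if W =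
   0. *)
pose t := - m / (W + 1).
have W1 : 0 < W + 1 by rewrite ltr_wpDl.
have t0 : 0 < t by rewrite divr_gt0// oppr_gt0.
have := Ppos (u + t *: w); rewrite bilmxDl !bilmxDr !bilmxZl !bilmxZr Pu mE -/m -/W add0r.
have tW : t * W <= - m.
  by rewrite /t mulrAC ler_pdivrMr// ler_pM2l ?oppr_gt0// lerDl.
rewrite (_ : _ + _ = t * (m + (m + t * W))); last by ring.
by rewrite pmulr_rge0//; lra.
Qed.

(* The sector form is the quadratic form of this block matrix at (u, v). *)
Lemma sector_coercive n (b : R) (Q : 'M[R]_n) :
  (forall u v : 'cV[R]_n, (u != 0) || (v != 0) -> 0 < sector b Q (fun i => u i 0) (fun i => v i 0)) ->
  exists2 d, 0 < d & forall u v : 'I_n -> R, d * \sum_i (u i ^+ 2 + v i ^+ 2) <= sector b Q u v.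
Proof.
move=> Qpos; pose cb := cos (b * pi / 2); pose sb := sin (b * pi / 2).
pose B : 'M[R]_(n + n) := block_mx (cb *: Q) (- sb *: Q) (sb *: Q) (cb *: Q).
have bilmxZm m p (M : 'M[R]_(m, p)) a u v : bilmx (a *: M) u v = a * bilmx M u v.
  by rewrite /bilmx -scalemxAr -scalemxAl mxE.
have BE u v : bilmx B (col_mx u v) (col_mx u v) = sector b Q (fun i => u i 0) (fun i => v i 0).
  rewrite bilmx_block !bilmxZm !bilmxE !mulr_sumr -!big_split/=; apply: eq_bigr => i _.
  rewrite !mulr_sumr -!big_split/=; apply: eq_bigr => j _.
  by rewrite -/cb -/sb; ring.
have [w|d d0 dP] := @posdef_coercive R _ B.
  rewrite -[w]vsubmxK BE col_mx_eq0 negb_and; exact: Qpos.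
exists d => // u v.
have := dP (col_mx (\col_i u i) (\col_i v i)); rewrite BE.
have -> : sector b Q (fun i => (\col_i u i) i 0) (fun i => (\col_i v i) i 0) = sector b Q u v.
  by apply: eq_bigr => i _; apply: eq_bigr => j _; rewrite !mxE.
apply: le_trans; rewrite le_eqVlt; apply/orP; left; apply/eqP; congr (_ * _).
rewrite bilmx1E big_split_ord/= big_split/=; congr (_ + _); apply: eq_bigr => i _.
  by rewrite col_mxEu mxE.
by rewrite col_mxEd mxE.
Qed.

Lemma posdef_coercive_fun n (P : 'M[R]_n) : (forall u, u != 0 -> 0 < bilmx P u u) ->
  exists2 d, 0 < d & forall u : 'I_n -> R, d * \sum_i u i ^+ 2 <= \sum_i \sum_j P i j * (u i * u j).
Proof.
move=> /posdef_coercive[d d0 dP]; exists d => // u.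
have := dP (\col_i u i); rewrite bilmx1E bilmxE.
under eq_bigr do rewrite mxE.
by under [X in _ <= X]eq_bigr do under eq_bigr do rewrite !mxE.
Qed.

End reduction.

(** * Admissibility *)

Section admissibility.
Context {R : realType}.

Lemma cv_norm_le n (x : 'cV[R]_n) : `|x| <= \sum_i `|x i 0|.
Proof.
have [->|x0] := eqVneq `|x| 0; first by exact: sumr_ge0.
have [[i j] E] := mx_norm_neq0 x0; have {}E : `|x| = `|x i j| by exact: E.
by rewrite E ord1 (bigD1 i)//= lerDl sumr_ge0.
Qed.

Lemma caputo_B (f g : R -> R) (v w alpha : R) : alpha < 2 -> caputo_dom f -> caputo_dom g ->
  f^`()%classic t @[t --> 0^'+] --> v -> g^`()%classic t @[t --> 0^'+] --> w ->
  [/\ caputo_dom (fun t => f t - g t), (fun t => f t - g t)^`()%classic t @[t --> 0^'+] --> v - w &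
    forall t, 0 < t -> caputo alpha (fun t => f t - g t) t = caputo alpha f t - caputo alpha g t].
Proof.
move=> a2 fd gd fv gw.
have := @caputo_comb R 2 (fun i => if i == ord0 then 1 else -1) (fun i => if i == ord0 then f else g)
  (fun i => if i == ord0 then v else w) alpha a2.
have E (T : Type) (F : T -> 'I_2 -> R) : (fun t => \sum_i F t i) = (fun t => F t ord0 + F t (lift ord0 ord0)).
  by apply/funext => t; rewrite !big_ord_recl big_ord0 addr0.
have E2 (F : 'I_2 -> R) : \sum_i F i = F ord0 + F (lift ord0 ord0) by rewrite !big_ord_recl big_ord0 addr0.
rewrite !E E2 /= !mul1r mulN1r.
have -> : (fun t => 1 * f t + -1 * g t) = (fun t => f t - g t) by apply/funext => t; rewrite mul1r mulN1r.
move=> []; [by move=> i; case: ifP|by move=> i; case: ifP|].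
move=> h1 h2 h3; split=> // t t0; rewrite (h3 t t0) E2 /= mul1r mulN1r//.
Qed.

Lemma continuous_sumr (I : Type) (s : seq I) (f : I -> R -> R) : (forall i, continuous (f i)) ->
  continuous (fun x => \sum_(i <- s) f i x).
Proof.
move=> fc; elim: s => [|i s IHs].
  by under eq_fun do rewrite big_nil; move=> t; exact: cst_continuous.
under eq_fun do rewrite big_cons.
by move=> t; exact: (continuousD (fc i t) (IHs t)).
Qed.

Lemma Cdiff2_comb n (c : 'I_n -> R) (g : 'I_n -> R -> R) : (forall i, Cdiff 2 (g i)) ->
  Cdiff 2 (fun t => \sum_i c i * g i t).
Proof.
move=> gd; pose f := fun t => \sum_i c i * g i t.
have d0 i (t : R) : is_derive t 1 (g i) ((g i)^`()%classic t).
  by have [h _] := gd i; apply: derivable_isd; exact: (h 0%N).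
have d1 i (t : R) : is_derive t 1 (g i)^`()%classic ((g i)^`(2)%classic t).
  by have [h _] := gd i; rewrite derive1n2; apply: derivable_isd; have := h 1%N isT t; rewrite derive1n1.
have df (t : R) : is_derive t 1 f (\sum_i c i * (g i)^`()%classic t).
  by apply: isd_sum => i; exact: isd_Z.
have E1 : f^`()%classic = fun t => \sum_i c i * (g i)^`()%classic t.
  by apply/funext => t; exact: isd_derive1 (df t).
have df1 (t : R) : is_derive t 1 f^`()%classic (\sum_i c i * (g i)^`(2)%classic t).
  by rewrite E1; apply: isd_sum => i; exact: isd_Z.
have E2 : f^`(2)%classic = fun t => \sum_i c i * (g i)^`(2)%classic t.
  by rewrite derive1n2; apply/funext => t; exact: isd_derive1 (df1 t).
split.
  move=> k; have [->|k1] := posnP k.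
    move=> _ t; rewrite derive1n0; exact: isd_derivable (df t).
  move=> k2; have -> : k = 1%N by apply/eqP; rewrite eqn_leq k1 andbT -ltnS.
  move=> t; rewrite derive1n1; exact: isd_derivable (df1 t).
rewrite E2; apply: continuous_sumr => i t.
by apply: continuousM; [exact: cst_continuous|have [_ h] := gd i; exact: h].
Qed.

Lemma solution_B n (alpha : R) (E A : 'M[R]_n) (g x y : R -> 'cV[R]_n) (x0 v0 : 'cV[R]_n) :
  alpha < 2 -> solution alpha E A g x -> solution alpha E A g y -> initial_data x x0 v0 -> initial_data y x0 v0 ->
  solution alpha E A (fun _ => 0) (fun t => x t - y t) /\ initial_data (fun t => x t - y t) 0 0.
Proof.
move=> a2 [xd xE] [yd yE] [x00 xv] [y00 yv].
have h i := caputo_B a2 (xd i) (yd i) (xv i) (yv i).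
have cE i : component (fun t => x t - y t) i = (fun t => component x i t - component y i t).
  by apply/funext => t; rewrite /component !mxE.
split; last first.
  split; first by rewrite x00 y00 subrr.
  by move=> i; rewrite cE mxE; have [_ + _] := h i; rewrite subrr.
split; first by move=> i; rewrite cE; have [] := h i.
move=> t t0; have -> : caputo_vec alpha (fun t => x t - y t) t = caputo_vec alpha x t - caputo_vec alpha y t.
  by apply/matrixP => i j; rewrite !mxE cE; have [_ _ ->] := h i.
rewrite [LHS]mulmxBr.
have xt := xE t t0.
have yt := yE t t0.
transitivity ((A *m x t + g t) - (A *m y t + g t)); first exact: (congr2 (fun u w : 'cV[R]_n => u - w) xt yt).
by rewrite opprD addrACA subrr -mulmxBr.
Qed.

Variables (n1 n2 : nat) (E A M0 P0 : 'M[R]_(n1 + n2)) (A1 P : 'M[R]_n1) (b lam del : R).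
Hypotheses (b01 : 0 < b < 1) (M0u : M0 \in unitmx) (P0u : P0 \in unitmx).
Hypothesis ME : M0 *m E *m P0 = block_mx 1%:M 0 0 0.
Hypothesis MA : M0 *m A *m P0 = block_mx A1 0 0 1%:M.
Hypotheses (lam0 : 0 < lam) (del0 : 0 < del) (A1u : A1 \in unitmx).
Hypothesis Psym : forall i j, P i j = P j i.
Hypothesis Plam : forall u : 'I_n1 -> R, lam * \sum_i u i ^+ 2 <= \sum_i \sum_j P i j * (u i * u j).
Hypothesis Qdel : forall u w : 'I_n1 -> R,
  del * \sum_i (u i ^+ 2 + w i ^+ 2) <= sector b (- (P *m A1)) u w.
Let alpha := 1 + b.
Let a2 : alpha < 2. Proof. by rewrite /alpha; move: b01; lra. Qed.

Lemma equation_split (d x w : 'cV[R]_(n1 + n2)) : E *m (P0 *m d) = A *m (P0 *m x) + w <->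
  usubmx d = A1 *m usubmx x + usubmx (M0 *m w) /\ 0 = dsubmx x + dsubmx (M0 *m w).
Proof.
have -> : (E *m (P0 *m d) = A *m (P0 *m x) + w) <->
    block_mx 1%:M 0 0 0 *m d = block_mx A1 0 0 1%:M *m x + M0 *m w.
  rewrite -ME -MA -!mulmxA -mulmxDr; split=> [->//|h].
  by have := congr1 (mulmx (invmx M0)) h; rewrite !mulKmx.
rewrite -{1}[d]vsubmxK -{1}[x]vsubmxK -{1}[M0 *m w]vsubmxK !mul_block_col !mul0mx !mul1mx !addr0 add0r.
rewrite add_col_mx; split=> [/eq_col_mx[]//|[-> <-]//].
Qed.

Definition coord (x : R -> 'cV[R]_(n1 + n2)) k t := \sum_j invmx P0 k j * component x j t.

Lemma coordE x t : invmx P0 *m x t = \col_k coord x k t.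
Proof. by apply/matrixP => k j; rewrite !mxE ord1. Qed.

Section sol.
Variables (g x : R -> 'cV[R]_(n1 + n2)) (v : 'cV[R]_(n1 + n2)).
Hypothesis sx : solution alpha E A g x.
Hypothesis xv : forall i, (component x i)^`()%classic t @[t --> 0^'+] --> v i 0.

Let cc k := caputo_comb (invmx P0 k) a2 sx.1 xv.

Lemma coord_dom k : caputo_dom (coord x k).
Proof. by have [] := cc k. Qed.

Lemma coord_lim k : (coord x k)^`()%classic t @[t --> 0^'+] --> (invmx P0 *m v) k 0.
Proof. by have [_ h _] := cc k; rewrite mxE. Qed.

Lemma coord_eq t : 0 < t ->
  (forall i, caputo alpha (coord x (lshift n2 i)) t = \sum_j A1 i j * coord x (lshift n2 j) t + (M0 *m g t) (lshift n2 i) 0) /\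
  (forall i, coord x (rshift n1 i) t = - (M0 *m g t) (rshift n1 i) 0).
Proof.
move=> t0; have cE : invmx P0 *m caputo_vec alpha x t = \col_k caputo alpha (coord x k) t.
  apply/matrixP => k j; rewrite mxE [RHS]mxE; have [_ _ h] := cc k.
  transitivity (\sum_i invmx P0 k i * caputo alpha (component x i) t); last exact/esym/(h t t0).
  by apply: eq_bigr => l _; rewrite mxE.
have := sx.2 t t0; rewrite -{1}[caputo_vec _ _ _](mulKVmx P0u) -{1}[x t](mulKVmx P0u).
move=> /equation_split; rewrite cE coordE => -[h1 h2]; split=> i.
  have := congr1 (fun m : 'cV[R]_n1 => m i 0) h1; rewrite !mxE => ->; congr (_ + _).
  by apply: eq_bigr => j _; rewrite !mxE.
have := congr1 (fun m : 'cV[R]_n2 => m i 0) h2; rewrite !mxE => /esym/eqP.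
by rewrite addr_eq0 => /eqP.
Qed.

End sol.

Lemma admissible_stable : asymptotically_stable alpha E A.
Proof.
move=> x sx; have [v xv] : exists v : 'cV[R]_(n1 + n2), forall i, (component x i)^`()%classic t @[t --> 0^'+] --> v i 0.
  have h i : {v : R | (component x i)^`()%classic t @[t --> 0^'+] --> v}.
    by apply: cid; case: (sx.1 i).
  by exists (\col_i sval (h i)) => i; rewrite mxE; exact: (svalP (h i)).
have cv k : coord x k t @[t --> +oo] --> (0 : R).
  case: (split_ordP k) => i ->.
    apply: (@state_cvg R n1 b A1 (fun i => coord x (lshift n2 i)) (fun i => (invmx P0 *m v) (lshift n2 i) 0)
      b01 _ _ _ P lam del) => //.
    - by move=> j; exact: (coord_dom sx xv).
    - by move=> j; exact: (coord_lim sx xv).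
    - move=> j t t0; have [h _] := coord_eq sx xv t0; rewrite h.
      by rewrite mulmx0 mxE addr0.
  apply/cvg_pinftyE => e e0; exists 1 => // t t1; have t0 := lt_le_trans ltr01 t1.
  (* Without forcing the algebraic coordinates vanish at every positive time. *)
  by have [_ h] := coord_eq sx xv t0; rewrite subr0 h mulmx0 mxE oppr0 normr0 ltW.
have xE t i : x t i 0 = \sum_k P0 i k * coord x k t.
  rewrite -[x t](mulKVmx P0u) mxE; apply: eq_bigr => k _; congr (_ * _).
  by rewrite coordE mxE.
have xi i : x t i 0 @[t --> +oo] --> (0 : R).
  under eq_fun do rewrite xE.
  by apply: cvg_sum0 => k; rewrite -[X in _ --> X](mulr0 (P0 i k)); apply: cvgMr; exact: cv.
have xs : \sum_i `|x t i 0| @[t --> +oo] --> (0 : R).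
  by apply: cvg_sum0 => i; rewrite -[X in _ --> X](normr0 R); apply: cvg_norm; exact: xi.
apply: (@squeeze_cvgr _ _ _ _ (fun=> 0) (fun t => \sum_i `|x t i 0|)) => //; last exact: cvg_cst.
by near=> t; rewrite normr_ge0 cv_norm_le.
Unshelve. all: by end_near. Qed.

Lemma admissible_regular : regular alpha E A.
Proof.
split.
  (* Two derivatives suffice: the algebraic coordinates of the solution are minus the forcing, which
     must itself lie in the Caputo domain, and [caputo_exists] uses the derivative of the
     forcing. *)
  exists 2%N => g gd.
  pose h k t := (M0 *m g t) k 0.
  have hd k : Cdiff 2 (h k).
    have := @Cdiff2_comb _ (M0 k) (fun j => component g j) gd.
    by rewrite (_ : h k = fun t => \sum_j M0 k j * component g j t)//; apply/funext => t; rewrite /h mxE.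
  have [z1 z1d z1E] := caputo_exists b01 A1u (fun i => hd (lshift n2 i)).
  pose z (k : 'I_(n1 + n2)) : R -> R := match fintype.split k with inl i => z1 i | inr i => fun t => -1 * h (rshift n1 i) t end.
  have zl i : z (lshift n2 i) = z1 i by rewrite /z (unsplitK (inl i)).
  have relax i : z (rshift n1 i) = fun t => -1 * h (rshift n1 i) t by rewrite /z (unsplitK (inr i)).
  have zd k : caputo_dom (z k).
    by case: (split_ordP k) => i ->; [rewrite zl|rewrite relax; exact: caputo_Cdiff2].
  have [v zv] : exists v : 'I_(n1 + n2) -> R, forall k, (z k)^`()%classic t @[t --> 0^'+] --> v k.
    have hv k : {v : R | (z k)^`()%classic t @[t --> 0^'+] --> v} by apply: cid; case: (zd k).
    by exists (fun k => sval (hv k)) => k; exact: (svalP (hv k)).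
  exists (fun t => P0 *m \col_k z k t).
  have cE i : component (fun t => P0 *m \col_k z k t) i = fun t => \sum_k P0 i k * z k t.
    by apply/funext => t; rewrite /component mxE; apply: eq_bigr => k _; rewrite mxE.
  have cc i := caputo_comb (P0 i) a2 zd zv.
  split; first by move=> i; rewrite cE; have [] := cc i.
  move=> t t0.
  have -> : caputo_vec alpha (fun t => P0 *m \col_k z k t) t = P0 *m \col_k caputo alpha (z k) t.
    apply/matrixP => i j; rewrite mxE [RHS]mxE cE; have [_ _ h3] := cc i.
    transitivity (\sum_k P0 i k * caputo alpha (z k) t); first exact: (h3 t t0).
    by apply: eq_bigr => k _; rewrite mxE.
  apply/equation_split; split; apply/matrixP => i j; rewrite !mxE zl || rewrite !mxE relax.
    rewrite z1E//; congr (_ + _); last by rewrite /h mxE ord1.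
    by apply: eq_bigr => l _; rewrite !mxE zl.
  by rewrite /h mxE ord1 mulN1r addNr.
move=> g x y x0 v0 sx sy ix iy t t0.
have [s0 [w0 wv]] := solution_B a2 sx sy ix iy; set w := (fun t => x t - y t) in s0 w0 wv.
have cl0 k : coord w k 0 = 0.
  rewrite /coord big1// => j _; have -> : component w j 0 = (0 : 'cV[R]_(n1 + n2)) j 0 by exact: (congr1 (fun m : 'cV[R]_(n1 + n2) => m j 0) w0).
  by rewrite mxE mulr0.
have z0 k u : 0 <= u -> coord w k u = 0.
  case: (split_ordP k) => i ->.
    move: u; apply: (@state_zero R n1 b A1 (fun i => coord w (lshift n2 i)) (fun i => (invmx P0 *m 0) (lshift n2 i) 0)
      b01 _ _ _ P lam del) => //.
    - by move=> j; exact: (coord_dom s0 wv).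
    - by move=> j; exact: (coord_lim s0 wv).
    - move=> j u u0; have [h _] := coord_eq s0 wv u0; rewrite h.
      by rewrite mulmx0 mxE addr0.
    - by move=> j; rewrite mulmx0 mxE.
  (* The equation is silent at time 0, where the value comes from the initial data. *)
  rewrite le_eqVlt => /predU1P[<-//|u0].
  by have [_ h] := coord_eq s0 wv u0; rewrite h mulmx0 mxE oppr0.
apply/eqP; rewrite -subr_eq0 -/(w t) -[w t](mulKVmx P0u) coordE.
rewrite (_ : \col_k _ = 0) ?mulmx0//; apply/matrixP => k j; rewrite !mxE; exact: z0.
Qed.

Lemma admissible_impulse_free : impulse_free alpha E A.
Proof.
(* N = 0 has index 1, except that in size 0 the identity is also 0 and the index is 0. In both cases
   the sum over 1 <= k < h is empty. *)
exists M0, P0, n1, n2, erefl, A1, 0, (n2 != 0%N); split.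
  split=> //; rewrite ?castmx_id//.
  case: (n2) => [|m]; split=> //=.
  - by apply/matrixP => -[].
  - case=> [_|//]; rewrite expr0; exact/eqP/oner_neq0.
move=> x0 v0 u; rewrite /response_terms (_ : index_iota 1 _ = [::])//.
by case: (n2 != 0%N).
Qed.

Lemma admissible_of_reduction : admissible alpha E A.
Proof. by split; [exact: admissible_regular|exact: admissible_impulse_free|exact: admissible_stable]. Qed.

End admissibility.

Unset Implicit Arguments.

Theorem theorem32 (R : realType) (n p q : nat) (alpha : R)
    (alpha_gt1 : 1 < alpha) (alpha_lt2 : alpha < 2)
    (E A0 : 'M[R]_n) (DA : 'M[R]_(n, p)) (EA : 'M[R]_(q, n))
    (LMI : exists X : 'M[R]_n,
       [/\ negdefmx (block_mx
             (Sym (Theta alpha *t (A0^T *m X)) + 1%:M *t (EA^T *m EA))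
             ((1%:M : 'M[R]_2) *t (X^T *m DA))
             ((1%:M : 'M[R]_2) *t (DA^T *m X))
             (- ((1%:M : 'M[R]_2) *t (1%:M : 'M[R]_p)))),
           E^T *m X = X^T *m E &
           possemidefmx (E^T *m X)]) :
  robust_admissible alpha E A0 DA EA.
Proof.
move=> FA HF; have [X [Hneg EX [_ Hpos]]] := LMI.
have [b aE] : exists b, alpha = 1 + b by exists (alpha - 1); rewrite subrKC.
have b01 : 0 < b < 1 by lra.
have /andP[b0 b1] := b01.
have form := lmi_form Hneg HF.
have pi0 := @pi_gt0 R.
(* The shift by pi/2 turns the angle of the LMI into the angle b pi/2 of the kernel. *)
have aE' : pi / 2 * alpha = b * pi / 2 + pi / 2 by rewrite aE; field.
have sE : sin (pi / 2 * alpha) = cos (b * pi / 2) by rewrite aE' sinD sin_pihalf cos_pihalf; ring.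
have cE : cos (pi / 2 * alpha) = - sin (b * pi / 2) by rewrite aE' cosD sin_pihalf cos_pihalf; ring.
have s0 : 0 < sin (pi / 2 * alpha).
  rewrite sE cos_gt0_pihalf//; apply/andP; split; first by rewrite (@lt_trans _ _ 0)// ?oppr_lt0 ?divr_gt0 ?mulr_gt0.
  by rewrite ltr_pM2r ?invr_gt0// gtr_pMl.
rewrite aE; set A := A0 + DA *m FA *m EA in form *.
(* From here on the LMI enters only through the sector inequality; generalizing over the matrix of
   the system lets [n] be replaced by n1 + n2. *)
have {Hneg HF LMI} form' := form; clear form; move: A form' => A form.
have [n1 [n2 [en rE]]] : exists n1 n2, (n1 + n2)%N = n /\ \rank E = n1.
  by exists (\rank E), (n - \rank E)%N; split=> //; rewrite subnKC// rank_leq_row.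
clear A0 DA EA; subst n.
have [M0 [P0 [A1 [P [M0u P0u ME MA [PT Ppos AP]]]]]] := reduction rE s0 EX Hpos form.
have [A1u Pdef] := posdef_of_sector s0 PT Ppos AP.
have [lam lam0 Plam] := posdef_coercive_fun Pdef.
have [|del del0 Qdel] := @sector_coercive R n1 b (- (P *m A1)).
  move=> u v uv; have := AP u v uv.
  (* Transposition with P symmetric: the form of A1'P at (x, y) is that of P A1 at (y, x), which
     exchanges the two cross terms. *)
  have qE (x y : 'cV[R]_n1) : bilmx (A1^T *m P) x y = - \sum_i \sum_j (- (P *m A1)) i j * (y i 0 * x j 0).
    by rewrite -bilmxE bilmxNm opprK -bilmx_tr trmx_mul PT trmxK.
  rewrite !qE sE cE => h.
  have -> : sector b (- (P *m A1)) (fun i => u i 0) (fun i => v i 0) =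
      cos (b * pi / 2) * (\sum_i \sum_j (- (P *m A1)) i j * (u i 0 * u j 0) + \sum_i \sum_j (- (P *m A1)) i j * (v i 0 * v j 0)) +
      sin (b * pi / 2) * (\sum_i \sum_j (- (P *m A1)) i j * (v i 0 * u j 0) - \sum_i \sum_j (- (P *m A1)) i j * (u i 0 * v j 0)).
    rewrite -sumrB -big_split/= !mulr_sumr -big_split/=; apply: eq_bigr => i _.
    rewrite -sumrB -big_split/= !mulr_sumr -big_split/=; apply: eq_bigr => j _; ring.
  move: h; lra.
apply: (admissible_of_reduction b01 M0u P0u ME MA lam0 del0 A1u _ Plam Qdel).
by move=> i j; rewrite -{1}PT mxE.
Qed.
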